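(* Let $X,X_1,X_2,\dots$ be i.i.d. with law $\mathbf P$ on $(S,\mathcal F)$, let $\widehat{\mathbf P}_n$ be the empirical measure of $X_1,\dots,X_n$, and let $k_n$ be positive integers with $k_n\to\infty$ and $k_n/n<c_0<\infty$ for all $n$. Given $X_1,\dots,X_n$, let $X_1^*,\dots,X_{k_n}^*$ be i.i.d. with law $\widehat{\mathbf P}_n$ and let $\mathbf P^*_{k_n}$ be their empirical measure. Let $a_n>0$ be a decreasing sequence with $a_n\to0$, $a_{n+1}/a_n\to1$, $k_na_n^2\to\infty$. Let $h:\mathbb R_+\to\mathbb R_+$ be an increasing function with $\lim_{n\to\infty}nh(ca_n)=0$ for each $c>0$. Let $t>2$ and $\Omega_0\subset\Lambda_{0\Theta_{t,h}}$, with interior $\mathrm{int}$ and closure $\mathrm{cl}$ in the $\tau_{\Theta_{t,h}}$-topology. (1) For every $\epsilon>0$ there are $n_0=n_0(\epsilon,\{k_i\}_{i=1}^\infty,\Omega_0)$ and positive constants $C=C(\epsilon,\Omega_0)$, $C_1=C_1(\epsilon,\Omega_0)$, $C_2=C_2(\epsilon,\Omega_0)$ such that for all $n>n_0$ the inequality $$(k_na_n^2)^{-1}\log(\widehat{\mathbf P}_n)_*\big(\mathbf P^*_{k_n}\in\widehat{\mathbf P}_n+a_n\Omega_0\big)\ge-\rho_0^2(\mathrm{int}(\Omega_0),\mathbf P)-\epsilon,$$ and, if in addition $\rho_0^2(\mathrm{cl}(\Omega_0),\mathbf P)<\infty$, the inequality $$(k_na_n^2)^{-1}\log(\widehat{\mathbf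 P}_n)^*\big(\mathbf P^*_{k_n}\in\widehat{\mathbf P}_n+a_n\Omega_0\big)\le-\rho_0^2(\mathrm{cl}(\Omega_0),\mathbf P)+\epsilon,$$ hold on sets of events (in terms of $X_1,\dots,X_n$) having inner probability more than $$\kappa_n=1-C\,[\beta_{1n}+\beta_{2n}],\qquad \beta_{1n}=n\,h\!\left(\frac{a_n}{\epsilon C_1}\right),\quad \beta_{2n}=C_2\,n^{1-t/2}.$$ (2) If $\rho_0^2(\mathrm{cl}(\Omega_0),\mathbf P)=\infty$, then for every $L>0$ there are $n_0$ and positive constants $C=C(L,\Omega_0)$, $C_1=C_1(L,\Omega_0)$, $C_2=C_2(L,\Omega_0)$ such that for all $n>n_0$ $$(k_na_n^2)^{-1}\log(\widehat{\mathbf P}_n)^*\big(\mathbf P^*_{k_n}\in\widehat{\mathbf P}_n+a_n\Omega_0\big)\le-L$$ holds on a set of events having inner probability more than $$\kappa_{1n}=1-C\,[\beta_{1n}+\beta_{2n}],\qquad \beta_{1n}=n\,h\!\left(\frac{a_n}{C_1}\right),\quad \beta_{2n}=C_2\,n^{1-t/2}.$$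
   Context: $S$ is a Hausdorff topological space with Borel $\sigma$-field $\mathcal F$; $\Lambda$ is the set of probability measures on $(S,\mathcal F)$; $\mathbf P\in\Lambda$. The law $\mathbf P$, the number $t$, the function $h$ and the sequences $a_n,k_n$ are fixed. $\Theta_{t,h}$ is the set of measurable $f:S\to\mathbb R$ with $\mathbf E|f(X)|^t<\infty$ and $\mathbf P(|f(X)|>s^{-1})<h(s)$ for all $s>0$. For $\Sigma=\Theta_{t,h}$: $\Lambda_\Sigma=\{\mathbf Q\in\Lambda:\int|f|\,d\mathbf Q<\infty\ \forall f\in\Sigma\}$; $\Lambda_{0\Sigma}$ is the set of signed measures $\mathbf G$ of bounded variation on $(S,\mathcal F)$ with $\mathbf G(S)=0$ and $\int|f|\,d|\mathbf G|<\infty$ for all $f\in\Sigma$, where $|\mathbf G|$ is the total variation measure. The $\tau_\Sigma$-topology (on $\Lambda_\Sigma$ or $\Lambda_{0\Sigma}$) is the coarsest topology making all maps $\mathbf G\mapsto\int f\,d\mathbf G$, $f\in\Sigma$, continuous; $\sigma_\Sigma$ is the smallest $\sigma$-field making all these maps measurable. Rate function: $\rho_0^2(\mathbf G,\mathbf P)=\frac12\int\left(\frac{d\mathbf G}{d\mathbf P}\right)^2d\mathbf P$ if $\mathbf G\ll\mathbf P$, and $=\infty$ otherwise; $\rho_0^2(\Omega_0,\mathbf P)=\inf\{\rho_0^2(\mathbf G,\mathbf P):\mathbf G\in\Omega_0\}$ (with $\inf\emptyset=\infty$). Outer/inner probability: for a probability space $(\Upsilon,\mathcal A,\mathbf Q)$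 and $B\subset\Upsilon$, $(\mathbf Q)^*(B)=\inf\{\mathbf Q(A):B\subseteq A,\ A\in\mathcal A\}$ and $(\mathbf Q)_*(B)=1-(\mathbf Q)^*(\Upsilon\setminus B)$. Here $(\widehat{\mathbf P}_n)^*$ and $(\widehat{\mathbf P}_n)_*$ refer to the conditional law of $\mathbf P^*_{k_n}$ given $X_1,\dots,X_n$ on the $\sigma$-algebra $\sigma_{\Theta_{t,h}}$; they are functions of $X_1,\dots,X_n$. The inner probability of sets of events in terms of $X_1,\dots,X_n$ is with respect to the law of the sample. The event $\mathbf P^*_{k_n}\in\widehat{\mathbf P}_n+a_n\Omega_0$ means $\mathbf P^*_{k_n}-\widehat{\mathbf P}_n\in a_n\Omega_0$. *)

(* Defs.v *)
From HB Require Import structures.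
From mathcomp Require Import all_boot all_order all_algebra.
From mathcomp Require Import all_classical all_reals all_analysis.

Set Implicit Arguments.
Unset Strict Implicit.
Unset Printing Implicit Defensive.

Import Order.TTheory GRing.Theory Num.Theory.
Import numFieldNormedType.Exports.

Local Open Scope classical_set_scope.
Local Open Scope ring_scope.

Notation borel S := (g_sigma_algebraType (@open S)).

Section outer_inner_probability.
Context (R : realType) (U : Type).
Local Open Scope ereal_scope.

(* [D] is the whole space, [F] its sigma-field and [Q] a probability on [F]. *)
Definition outer_prob (F : set (set U)) (Q : set U -> \bar R) (B : set U) :=
  ereal_inf [set Q A | A in [set A | F A /\ B `<=` A]].

Definition inner_prob (D : set U) (F : set (set U)) (Q : set U -> \bar R)
  (B : set U) := 1 - outer_prob F Q (D `\` B).

End outer_inner_probability.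

Section independence.
Context d d' (T : measurableType d) (V : measurableType d') (R : realType).
Local Open Scope ereal_scope.

Definition mutually_independent (Pr : probability T R) (I : choiceType)
    (Y : I -> {mfun T >-> V}) :=
  forall (J : seq I) (A : I -> set V), uniq J ->
    (forall i, measurable (A i)) ->
    Pr (\bigcap_(i in [set` J]) (Y i @^-1` A i)) =
    \prod_(i <- J) Pr (Y i @^-1` A i).

Definition iid (Pr : probability T R) (I : choiceType)
    (Y : I -> {mfun T >-> V}) (Q : probability V R) :=
  mutually_independent Pr Y /\
  forall i A, measurable A -> distribution Pr (Y i) A = Q A.

End independence.

Section empirical_measure.
Context d (V : measurableType d) (R : realType).
Local Open Scope ereal_scope.

(* The normalized sum of Dirac masses; see [empiricalE]. For [n = 0], which the
   main statement never uses, it is the Dirac mass at a default point. *)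
Definition empirical n (x : n.-tuple V) : probability V R :=
  mnormalize (msum (fun i => dirac (nth point x i)) n) (dirac point).

Lemma empiricalE n (x : n.-tuple V) (A : set V) : (0 < n)%N ->
  empirical x A = (\sum_(i < n) \d_(tnth x i) A) * (n%:R^-1)%:E.
Proof.
move=> n0; rewrite /empirical /= /mnormalize.
set m := (X in X setT); have m1 : m [set: V] = n%:R%:E.
  rewrite /m /= /msum (eq_bigr (fun=> 1)); last first.
    by move=> i _; rewrite /= diracT.
  by rewrite sumEFin big_const_ord iter_addr_0.
rewrite m1 eqe pnatr_eq0 -leqn0 leqNgt n0 /=.
by congr (_ * _); apply: eq_bigr => i _; rewrite /= (tnth_nth point).
Qed.

End empirical_measure.

Section signed_measures.
Context d (V : measurableType d) (R : realType).
Implicit Type G : {charge set V -> \bar R}.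

Definition hahn_pos G : set V := sval (cid (Hahn_decomposition G)).

Definition hahn_neg G : set V := sval (cid (svalP (cid (Hahn_decomposition G)))).

Definition hahnP G : hahn_decomposition G (hahn_pos G) (hahn_neg G) :=
  svalP (cid (svalP (cid (Hahn_decomposition G)))).

Definition total_variation G : {measure set V -> \bar R} :=
  charge_variation (hahnP G).

Definition charge_integral G (f : V -> R) : R :=
  \int[jordan_pos (hahnP G)]_x f x - \int[jordan_neg (hahnP G)]_x f x.

(* Charges are finite-valued, hence of bounded variation. *)
Definition Lambda0 (Sigma : set (V -> R)) : set (charge V R) :=
  [set G : charge V R | G setT = 0%E /\ forall f, Sigma f ->
     (\int[total_variation G]_x (`|f x|)%:E < +oo)%E].

Definition Lambda (Sigma : set (V -> R)) : set (probability V R) :=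
  [set Q : probability V R | forall f, Sigma f -> (\int[Q]_x (`|f x|)%:E < +oo)%E].

Definition sigma_field (Sigma : set (V -> R)) : set (set (probability V R)) :=
  <<s Lambda Sigma, \bigcup_(f in Sigma)
        preimage_set_system (Lambda Sigma)
          (fun Q : probability V R => \int[Q]_x f x) measurable >>.

(* The type [Lambda0 Sigma] endowed with the tau_Sigma-topology. *)
Definition tau_space (Sigma : set (V -> R)) : topologicalType :=
  sup_topology (fun f : set_type Sigma => Topological.on
    (initial_topology (fun G : {classic set_type (Lambda0 Sigma)} =>
       charge_integral (set_val G) (set_val f)))).

Definition tau_val (Sigma : set (V -> R)) (G : tau_space Sigma) :
  charge V R := set_val (G : set_type (Lambda0 Sigma)).

Definition Theta (P : probability V R) (t : R) (h : R -> R) : set (V -> R) :=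
  [set f : V -> R | [/\ measurable_fun setT f,
     (\int[P]_x (`|f x| `^ t)%:E < +oo)%E &
     forall s : R, 0 < s -> (P [set x | (s^-1 < `|f x|)%R] < (h s)%:E)%E]].

Definition rho0sq (P : probability V R) G : \bar R :=
  if `[< G `<< P >] then
    ((2^-1)%:E * \int[P]_x (Radon_Nikodym G P x ^+ 2))%E
  else +oo%E.

Definition rho0sq_set (P : probability V R) (Sigma : set (V -> R))
  (Om : set (tau_space Sigma)) : \bar R :=
  ereal_inf [set rho0sq P (tau_val G) | G in Om].

(* [Q - Q0 \in a Om] inside [Lambda Sigma], equality of set functions being
   required on measurable sets only. *)
Definition shifted_set (Sigma : set (V -> R)) (Q0 : probability V R) (a : R)
  (Om : set (tau_space Sigma)) : set (probability V R) :=
  [set Q : probability V R | Lambda Sigma Q /\ exists2 G, Om G & forall A, measurable A ->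
     (Q A - Q0 A = a%:E * tau_val G A)%E].

End signed_measures.

Section laws.
Context d d' (T : measurableType d) (V : measurableType d') (R : realType).

Definition sample_law (Pr : probability T R) (X : nat -> {mfun T >-> V}) n :
  set (n.-tuple V) -> \bar R :=
  pushforward Pr (fun w => [tuple X i w | i < n]).

Definition empirical_law (Pr : probability T R) k (Y : 'I_k -> {mfun T >-> V}) :
  set (probability V R) -> \bar R :=
  fun A => Pr [set w | A (empirical R [tuple Y j w | j < k])].

End laws.

Arguments sample_law {d d' T V R} Pr X n _.

(* Main.v *)
(** Both bounds reduce to finitely many functions in the linear span of Theta,
    whose law under the resampling is controlled by exponential moments.

    Upper bound: if [r < rho0sq (cl Om0)], there are finitely many [u] in the span
    and [eta > 0] such that every [G] in [Om0] has
    [sqrt (2 r) * sd u + eta < |\int u dG|] for one of these [u]. Otherwise, along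
    an ultrafilter on [Om0], the functionals [u |-> \int u dG] have a limit bounded
    by [sqrt (2 r) * sd], which the Riesz representation theorem in L2(P) turns into
    a charge of rate at most [r] in [cl Om0]. Each of these half-spaces has the right
    probability by Chernoff's bound.

    Lower bound: a basic neighbourhood of [G], with functions [f], lies in [Om0].
    As [rho0sq G <= r], the functional [f |-> \int f dG] is nearly the covariance
    with some [w] in the span, [var w / 2] being at most about [r]. Tilting
    the empirical weights by [exp (a_n w)] moves the resampled means to this
    neighbourhood at the cost [exp (- k_n a_n^2 var w / 2)].

    Both arguments need only that the sample variances and covariances are close to
    the true ones, which fails with probability O(n^(1 - t/2)) by a Fuk-Nagaev bound
    since [t > 2], and that [a_n u(X_i)] is small for all [i <= n], which fails with
    probability at most [n h(D a_n)] up to a constant, by definition of Theta. *)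
Require Import Defs.
From mathcomp Require Import all_boot all_order all_algebra.
From mathcomp Require Import all_classical all_reals all_analysis.
From mathcomp Require Import measurable_realfun ring lra.
Import Order.TTheory GRing.Theory Num.Theory.
Import numFieldNormedType.Exports.
Local Open Scope classical_set_scope.
Local Open Scope ring_scope.

Set Implicit Arguments.
Unset Strict Implicit.
Unset Printing Implicit Defensive.

(** The shifted set need not lie in [sigma_field], so each bound passes through an event of
    [sigma_field] defined by finitely many integrals: it contains the shifted set for the upper
    bound, and the complement of that set for the lower one. These functions depend on [Om0] and the
    tolerance but not on [n], which makes the constants uniform. Theta is not stable under sums or
    multiples, as its tail condition involves a fixed [h]; on the span the tail is at most
    [N * h (D * s)], and monotonicity of [h] allows one [D] for finitely many functions. One
    variational argument serves both bounds: near-minimisers of [varP u / 2 - l u] over the span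
    nearly represent [l]. Their L2 limit yields the charge of the upper bound; a single one, still
    in the span and so controlled on the sample, is the tilting direction of the lower bound. A
    resample from [n] points is a finite product measure, so Chernoff's bound and tilting are
    inequalities between finite sums. The exponent [1 - t / 2] comes from sample covariances, which
    average products with a moment of order [t / 2] only. *)

Section expR_bounds.
Context {R : realType}.
Implicit Types z : R.

Lemma ge0_derive_ndecr (f f' : R -> R) :
  (forall x : R, is_derive x (1 : R) f (f' x)) -> (forall x, 0 <= f' x) ->
  {homo f : x y / x <= y}.
Proof.
move=> df f'0 x y; rewrite le_eqVlt => /predU1P[->//|xy].
have cf : {within `[x, y], continuous f}.
  by apply: derivable_within_continuous => z _; have [] := df z.
have [z _ E] := MVT xy (fun z _ => df z) cf.
by rewrite -subr_ge0 E mulr_ge0// subr_ge0 ltW.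
Qed.

Lemma expR_taylor2_homo : {homo (fun z => expR z - 1 - z - z ^+ 2 / 2) : x y / x <= y}.
Proof.
apply: (@ge0_derive_ndecr _ (fun z => expR z - 1 - z)) => x.
  apply: is_derive_eq; rewrite /GRing.scale/= ; lra.
by have := expR_ge1Dx x; lra.
Qed.

(** Comparing the values at [- z] and [0] and multiplying by [expR z] yields the Taylor bounds on
    the side that [expR_taylor2_homo] does not reach: the upper one for [z >= 0] and the lower one
    for [z < 0]. *)
Lemma expR_taylor2_homo' :
  {homo (fun z => (z - 1) * expR z - z ^+ 2 / 2) : x y / x <= y}.
Proof.
apply: (@ge0_derive_ndecr _ (fun z => z * (expR z - 1))) => x.
  apply: is_derive_eq; rewrite /GRing.scale/= ; lra.
have [x0|x0] := leP 0 x.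
  by rewrite mulr_ge0// subr_ge0 -expR0 ler_expR.
by rewrite mulr_le0 ?subr_le0 ?expR_le1 ?ltW.
Qed.

Lemma expR_le_taylor2 z : expR z <= 1 + z + z ^+ 2 / 2 * expR `|z|.
Proof.
have [z0|z0] := leP 0 z; last first.
  have := expR_taylor2_homo (ltW z0).
  rewrite expR0 expr0n/= => H.
  have : z ^+ 2 / 2 * 1 <= z ^+ 2 / 2 * expR `|z|.
    by rewrite ler_wpM2l ?divr_ge0 ?sqr_ge0// -expR0 ler_expR.
  by lra.
have : - z <= 0 by lra.
move=> /expR_taylor2_homo'; rewrite ger0_norm// expR0 expRN => H.
have e0 := expR_gt0 z.
have E : (expR z)^-1 * expR z = 1 by rewrite mulVf ?gt_eqF.
have := ler_wpM2r (ltW e0) H.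
have -> : ((- z - 1) * (expR z)^-1 - (- z) ^+ 2 / 2) * expR z =
  (- z - 1) * ((expR z)^-1 * expR z) - z ^+ 2 / 2 * expR z by ring.
rewrite E; lra.
Qed.

Lemma expR_ge_taylor2 z : 1 + z + z ^+ 2 / 2 * expR (- `|z|) <= expR z.
Proof.
have [z0|z0] := leP 0 z.
  have := expR_taylor2_homo z0; rewrite expR0 => H.
  have : z ^+ 2 / 2 * expR (- `|z|) <= z ^+ 2 / 2 * 1.
    by rewrite ler_wpM2l ?divr_ge0 ?sqr_ge0// -expR0 ler_expR oppr_le0.
  by move: H; rewrite !expr2; lra.
have : 0 <= - z by lra.
move=> /expR_taylor2_homo'; rewrite ltr0_norm// expR0 opprK expRN => H.
have e0 := expR_gt0 z.
have E : (expR z)^-1 * expR z = 1 by rewrite mulVf ?gt_eqF.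
have := ler_wpM2r (ltW e0) H.
have -> : ((- z - 1) * (expR z)^-1 - (- z) ^+ 2 / 2) * expR z =
  (- z - 1) * ((expR z)^-1 * expR z) - z ^+ 2 / 2 * expR z by ring.
rewrite E; lra.
Qed.

Lemma expR_le2 z : z <= 1 / 2 -> expR z <= 2.
Proof.
move=> z2; have := expR_ge1Dx (- z); rewrite expRN => H.
have e0 := expR_gt0 z.
have := ler_wpM2r (ltW e0) H; rewrite mulVf ?gt_eqF// => H2.
have : (1 / 2) * expR z <= (1 + - z) * expR z by rewrite ler_wpM2r//; lra.
lra.
Qed.

Lemma le_ln_1B (z : R) : 0 < z -> 1 - z^-1 <= ln z.
Proof.
move=> z0; have := expR_ge1Dx (- ln z); rewrite expRN lnK ?posrE//.
lra.
Qed.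

End expR_bounds.

(** * Finite product measures: exponential Markov inequality and tilting *)

Section finite_product.
Context {R : realType} {I : finType} (k : nat).
Implicit Types (q F : I -> R) (D : pred {ffun 'I_k -> I}).

(** The probability of [D] for [k] independent draws with weights [q]. Keeping it a real finite sum
    leaves all exponential estimates free of integration; [q] need not sum to 1. *)
Definition ffprob q D : R := \sum_(i | D i) \prod_(j < k) q (i j).

Lemma sum_prod_ffun F : \sum_i \prod_(j < k) F ((i : {ffun 'I_k -> I}) j) = (\sum_i F i) ^+ k.
Proof.
rewrite -[in RHS](card_ord k) -prodr_const.
by rewrite (bigA_distr_bigA (fun=> F)).
Qed.

Lemma ffprobT q : \sum_i q i = 1 -> ffprob q predT = 1.
Proof. by move=> q1; rewrite /ffprob sum_prod_ffun q1 expr1n. Qed.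

Lemma ffprobC q D : \sum_i q i = 1 -> ffprob q D = 1 - ffprob q (predC D).
Proof.
move=> q1; rewrite -(ffprobT q1) /ffprob.
rewrite [X in _ = X - _](bigID D)/=.
rewrite [X in _ = _ + X - _](eq_bigl (predC D))//; lra.
Qed.

Lemma ffprob_le q D D' : (forall i, 0 <= q i) -> (forall i, D i -> D' i) ->
  ffprob q D <= ffprob q D'.
Proof.
move=> q0 DD'; rewrite /ffprob [leRHS](bigID D)/=.
rewrite [X in _ <= X + _](eq_bigl D) => [|i]; last by have := DD' i; case: (D i) => [/(_ isT) ->|_]; rewrite ?andbF.
rewrite lerDl; apply: sumr_ge0 => i _.
by apply: prodr_ge0 => j _.
Qed.

Lemma eq_ffprob q D D' : D =1 D' -> ffprob q D = ffprob q D'.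
Proof. by move=> DD'; apply: eq_bigl. Qed.

Lemma ffprob_exists (J : finType) q (D : J -> pred {ffun 'I_k -> I}) :
  (forall i, 0 <= q i) ->
  ffprob q (fun i => [exists r, D r i]) <= \sum_r ffprob q (D r).
Proof.
move=> q0; rewrite /ffprob.
under [leRHS]eq_bigr do rewrite big_mkcond.
rewrite exchange_big/= [leLHS]big_mkcond/=; apply: ler_sum => i _.
have p0 : 0 <= \prod_(j < k) q (i j) by apply: prodr_ge0.
case: ifPn => [/existsP[r Dr]|_]; last by apply: sumr_ge0 => r _; case: ifP.
rewrite (bigD1 r)//= Dr lerDl.
by apply: sumr_ge0 => r' _; case: ifP.
Qed.

(** Exponential Markov inequality; by [sum_prod_ffun] the generating function of the sum over the
    draws is a [k]-th power. *)
Lemma ffprob_chernoff q F (c l : R) : (forall i, 0 <= q i) -> 0 <= l ->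
  ffprob q (fun i => c <= \sum_j F (i j)) <=
    expR (- (l * c)) * (\sum_i q i * expR (l * F i)) ^+ k.
Proof.
move=> q0 l0; rewrite -(sum_prod_ffun (fun i => q i * _)) mulr_sumr.
rewrite [leRHS](bigID (fun i : {ffun 'I_k -> I} => c <= \sum_j F (i j)))/=.
apply: ler_wpDr.
  apply: sumr_ge0 => i _; rewrite mulr_ge0 ?expR_ge0//.
  by apply: prodr_ge0 => j _; rewrite mulr_ge0 ?expR_ge0.
apply: ler_sum => i ci; rewrite big_split/= mulrCA ler_peMr//.
  by apply: prodr_ge0.
rewrite -expR_sum -expRD -expR0 ler_expR -mulr_sumr addrC -mulrBr.
by rewrite mulr_ge0// subr_ge0.
Qed.

(** In the second-order Taylor bound the linear term vanishes since [F] is centred, and the uniform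
    bound [kap] on the exponent turns the remainder into a multiple of the variance. *)
Lemma mgf_le q F (l kap v : R) : (forall i, 0 <= q i) -> \sum_i q i = 1 ->
  \sum_i q i * F i = 0 -> (forall i, `|l * F i| <= kap) ->
  \sum_i q i * F i ^+ 2 <= v ->
  \sum_i q i * expR (l * F i) <= expR (l ^+ 2 / 2 * v * expR kap).
Proof.
move=> q0 q1 qF Fk qv.
apply: le_trans (expR_ge1Dx _).
apply: (@le_trans _ _ (\sum_i (q i + l * (q i * F i) +
    l ^+ 2 / 2 * expR kap * (q i * F i ^+ 2)))).
  apply: ler_sum => i _.
  have -> : q i + l * (q i * F i) + l ^+ 2 / 2 * expR kap * (q i * F i ^+ 2) =
    q i * (1 + l * F i + (l * F i) ^+ 2 / 2 * expR kap) by rewrite exprMn; ring.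
  rewrite ler_wpM2l//; apply: le_trans (expR_le_taylor2 _) _.
  rewrite lerD2l ler_wpM2l ?divr_ge0 ?sqr_ge0//.
  by rewrite ler_expR Fk.
rewrite !big_split/= -!mulr_sumr q1 qF mulr0 addr0 lerD2l.
rewrite -[leRHS]mulrA (mulrC v) mulrA.
by rewrite ler_wpM2l// mulr_ge0 ?divr_ge0 ?sqr_ge0 ?expR_ge0.
Qed.

(* Chernoff's bound at the moderate-deviation scale: [k] draws, deviation [k a c]. *)
Lemma ffprob_mdp_le q F (a c th kap v : R) : (forall i, 0 <= q i) ->
  \sum_i q i = 1 -> 0 <= a -> 0 <= th ->
  \sum_i q i * F i = 0 -> (forall i, `|a * F i| <= kap) ->
  \sum_i q i * F i ^+ 2 <= v ->
  ffprob q (fun i => k%:R * (a * c) <= \sum_j F (i j)) <=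
    expR (- (k%:R * a ^+ 2 * (th * c - th ^+ 2 / 2 * v * expR (th * kap)))).
Proof.
move=> q0 q1 a0 th0 qF Fk qv.
(* The slope [th * a] puts gain and cost on one scale: each is [k * a ^+ 2] times a quantity in
   [th], [c], [v] and [kap]. *)
have ta0 : 0 <= th * a by rewrite mulr_ge0.
apply: le_trans (ffprob_chernoff F _ q0 ta0) _.
have Fk' i : `|th * a * F i| <= th * kap.
  by rewrite -mulrA normrM ger0_norm// ler_wpM2l.
have := mgf_le q0 q1 qF Fk' qv.
set M := \sum_i _ => Mle.
have M0 : 0 <= M by apply: sumr_ge0 => i _; rewrite mulr_ge0 ?expR_ge0.
apply: (@le_trans _ _ (expR (- (th * a * (k%:R * (a * c)))) *
   expR ((th * a) ^+ 2 / 2 * v * expR (th * kap)) ^+ k)).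
  by rewrite ler_wpM2l ?expR_ge0// lerXn2r// nnegrE// expR_ge0.
rewrite -expRM_natl -expRD ler_expR le_eqVlt; apply/orP; left; apply/eqP.
ring.
Qed.

(* Change of measure to the exponentially tilted weights. *)
Lemma ffprob_tilt q F (D : pred {ffun 'I_k -> I}) (b : R) : (forall i, 0 <= q i) ->
  let Z := \sum_i q i * expR (F i) in
  0 < Z ->
  (forall i, D i -> \sum_(j < k) F (i j) - k%:R * ln Z <= b) ->
  ffprob (fun i => q i * expR (F i) / Z) D * expR (- b) <= ffprob q D.
Proof.
move=> q0 Z Z0 Db; rewrite /ffprob mulr_suml; apply: ler_sum => i Di.
rewrite !big_split/= -expR_sum prodr_const card_ord exprVn.
rewrite -!mulrA ler_piMr//; first by apply: prodr_ge0.
rewrite -[X in X ^- _](@lnK _ Z) ?posrE// -expRM_natl -expRN -!expRD -[X in _ <= X]expR0.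
by rewrite ler_expR; have := Db i Di; lra.
Qed.

End finite_product.

(** * Lower bound for finitely many centred functions, tilting along one of them *)

Section moderate_lower_bound.
Context {R : realType} {I J : finType} (k : nat).
Variables (q : I -> R) (u : J -> I -> R) (j0 : J) (a dl V : R).
Hypotheses (q0 : forall i, 0 <= q i) (q1 : \sum_i q i = 1) (a0 : 0 <= a).
Hypotheses (dl0 : 0 < dl) (dl1 : dl <= 1) (V1 : 1 <= V).
Hypotheses (u0 : forall j, \sum_i q i * u j i = 0).
Hypotheses (ukap : forall j i, `|a * u j i| <= dl / (8 * V)).
Hypotheses (uV : forall j, \sum_i q i * u j i ^+ 2 <= V).

(** With this bound on [a * u], [kap * V = dl / 8]: every second-order error below is a fixed
    fraction of [dl], uniformly over the functions. *)
Let kap := dl / (8 * V).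
Let w := u j0.
Let vW := \sum_i q i * w i ^+ 2.
Let c j := \sum_i q i * (u j i * w i).
Let Z := \sum_i q i * expR (a * w i).
Let qt i := q i * expR (a * w i) / Z.
Let m j := \sum_i qt i * u j i.

(* Used by [//], as are several of the facts below. *)
Let V0 : 0 < V. Proof. exact: lt_le_trans V1. Qed.

Let kap0 : 0 < kap. Proof. by rewrite divr_gt0// mulr_gt0. Qed.

Let kapV : kap * V = dl / 8.
Proof. by rewrite /kap; field; rewrite gt_eqF. Qed.

Let kap8 : kap <= 1 / 8.
Proof. by have := kapV; have := V1; have := kap0; have := dl1; nra. Qed.

Let vW0 : 0 <= vW.
Proof. by apply: sumr_ge0 => i _; rewrite mulr_ge0// sqr_ge0. Qed.

Let vWV : vW <= V. Proof. exact: uV. Qed.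

Let sqr_kap x : `|x| <= kap -> x ^+ 2 <= kap ^+ 2.
Proof.
by move=> xk; rewrite -real_normK ?num_real// lerXn2r// nnegrE ltW.
Qed.

Let avW : a ^+ 2 * vW <= kap.
Proof.
rewrite mulr_sumr; apply: (@le_trans _ _ (\sum_i q i * kap ^+ 2)).
  apply: ler_sum => i _; rewrite mulrCA ler_wpM2l// -exprMn.
  exact/sqr_kap/ukap.
by rewrite -mulr_suml q1 mul1r; have := kap0; have := kap8; nra.
Qed.

Let exp_le x : `|x| <= kap -> expR x <= 1 + x + x ^+ 2.
Proof.
move=> xk; apply: le_trans (expR_le_taylor2 x) _.
rewrite lerD2l -[leRHS]mulr1 -mulrA ler_wpM2l ?sqr_ge0//.
by have := @expR_le2 R `|x|; have := kap8; move: xk; lra.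
Qed.

Let exp_ge x : `|x| <= kap -> 1 + x + x ^+ 2 / 2 * (1 - kap) <= expR x.
Proof.
move=> xk; apply: le_trans (expR_ge_taylor2 x).
rewrite lerD2l ler_wpM2l ?divr_ge0 ?sqr_ge0//.
by have := expR_ge1Dx (- `|x|); move: xk; lra.
Qed.

Let Zle : Z <= 1 + a ^+ 2 * vW.
Proof.
rewrite -[X in X + _]q1 -[\sum_i q i]addr0 -[X in _ + X + _](mulr0 a) -[X in a * X](u0 j0).
rewrite !mulr_sumr -!big_split/=; apply: ler_sum => i _.
have -> : q i + a * (q i * u j0 i) + a ^+ 2 * (q i * w i ^+ 2) =
  q i * (1 + a * w i + (a * w i) ^+ 2) by rewrite /w; ring.
by rewrite ler_wpM2l// exp_le// ukap.
Qed.

Let Zge : 1 + a ^+ 2 * vW / 2 * (1 - kap) <= Z.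
Proof.
rewrite -[X in X + _]q1 -[\sum_i q i]addr0 -[X in _ + X + _](mulr0 a) -[X in a * X](u0 j0).
rewrite !mulr_sumr !mulr_suml -!big_split/=; apply: ler_sum => i _.
have -> : q i + a * (q i * u j0 i) + a ^+ 2 * (q i * w i ^+ 2) / 2 * (1 - kap) =
  q i * (1 + a * w i + (a * w i) ^+ 2 / 2 * (1 - kap)) by rewrite /w; field.
by rewrite ler_wpM2l// exp_ge// ukap.
Qed.

Let avW0 : 0 <= a ^+ 2 * vW. Proof. by rewrite mulr_ge0// sqr_ge0. Qed.

Let Z1 : 1 <= Z.
Proof. by apply: le_trans Zge; have := kap8; have := avW0; nra. Qed.

Let Z0 : 0 < Z. Proof. exact: lt_le_trans Z1. Qed.

Let Zi1 : Z^-1 <= 1. Proof. by rewrite invf_le1. Qed.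

Let Zi0 : 0 < Z^-1. Proof. by rewrite invr_gt0. Qed.

Let ZZi : Z * Z^-1 = 1. Proof. by rewrite divff// gt_eqF. Qed.

Let Zi_ge : 1 - Z^-1 <= a ^+ 2 * vW.
Proof.
have -> : 1 - Z^-1 = (Z - 1) * Z^-1 by rewrite mulrBl ZZi mul1r.
apply: (@le_trans _ _ (Z - 1)); last by have := Zle; lra.
by rewrite ler_piMr// subr_ge0.
Qed.

Let cV j : `|c j| <= V.
Proof.
apply: le_trans (ler_norm_sum _ _ _) _.
apply: (@le_trans _ _ (\sum_i (q i * u j i ^+ 2 / 2 + q i * w i ^+ 2 / 2))).
  apply: ler_sum => i _; rewrite normrM ger0_norm// normrM.
  rewrite -!mulrA -mulrDr ler_wpM2l//.
  have : 0 <= (`|u j i| - `|w i|) ^+ 2 by rewrite sqr_ge0.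
  by rewrite sqrrB !real_normK ?num_real//; lra.
rewrite big_split/= -!mulr_suml.
by have := uV j; have := uV j0; rewrite -/w -/vW; lra.
Qed.

Let qt0 i : 0 <= qt i.
Proof. by rewrite /qt; apply: divr_ge0; [rewrite mulr_ge0 ?expR_ge0|exact: ltW]. Qed.

Let qt1 : \sum_i qt i = 1. Proof. by rewrite /qt -mulr_suml ZZi. Qed.

(** To first order the tilted mean of [u j] is [a] times its covariance with [w]. The remainder of
    the exponential in the numerator costs at most [a * kap * vW], and dividing by [Z] instead of 1
    costs [a * kap * V] more. *)
Let m_near j : `|m j - a * c j| <= 2 * (a * (kap * V)).
Proof.
pose num := \sum_i q i * expR (a * w i) * u j i.
have numE : `|num - a * c j| <= a * (kap * vW).
  have -> : num - a * c j =
      \sum_i q i * u j i * (expR (a * w i) - 1 - a * w i).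
    transitivity (num - \sum_i q i * u j i - a * c j).
      by rewrite u0 subr0.
    rewrite /num /c mulr_sumr -!sumrB; apply: eq_bigr => i _; ring.
  apply: le_trans (ler_norm_sum _ _ _) _.
  rewrite /vW !mulr_sumr; apply: ler_sum => i _.
  rewrite !normrM (ger0_norm (q0 i)).
  have -> : a * (kap * (q i * w i ^+ 2)) = q i * (kap * (a * w i ^+ 2)) by ring.
  rewrite -mulrA ler_wpM2l//.
  have kw := ukap j0 i; have := exp_le kw; have := exp_ge kw.
  set x := a * w i; move=> xge xle.
  have x2 : 0 <= x ^+ 2 by rewrite sqr_ge0.
  rewrite (@ger0_norm _ (_ - _ - _)); last by have := kap8; nra.
  apply: (@le_trans _ _ (`|u j i| * x ^+ 2)).
    by rewrite ler_wpM2l//; lra.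
  have -> : `|u j i| * x ^+ 2 = a * `|u j i| * (a * w i ^+ 2).
    by rewrite /x; ring.
  apply: ler_wpM2r; first by apply: mulr_ge0 => //; exact: sqr_ge0.
  by have := ukap j i; rewrite normrM ger0_norm.
have mE : m j = num * Z^-1.
  by rewrite /m /num mulr_suml; apply: eq_bigr => i _; rewrite /qt; ring.
have -> : m j - a * c j = (num - a * c j) * Z^-1 - a * c j * (1 - Z^-1).
  by rewrite mE; ring.
apply: le_trans (ler_normB _ _) _.
rewrite mulr_natl mulr2n lerD//.
  rewrite normrM (ger0_norm (ltW Zi0)).
  apply: (@le_trans _ _ `|num - a * c j|); first by rewrite ler_piMr.
  by apply: le_trans numE _; rewrite !ler_wpM2l// ltW.
rewrite !normrM (ger0_norm a0) -mulrA ler_wpM2l// mulrC.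
rewrite ger0_norm ?subr_ge0//; apply: ler_pM => //; first by rewrite subr_ge0.
exact: le_trans Zi_ge avW.
Qed.

(** Holds because [Z >= 1] and [a * w] is at most [1 / 8]; it bounds the second moments under the
    tilted weights by [2 * V]. *)
Let qt_le i : qt i <= 2 * q i.
Proof.
rewrite /qt -mulrA mulrC ler_wpM2r//.
apply: (@le_trans _ _ (expR (a * w i))); first by rewrite ler_piMr ?expR_ge0.
apply: expR_le2; apply: le_trans (ler_norm _) _.
by apply: le_trans (ukap _ _) _; rewrite -/kap; have := kap8; lra.
Qed.

Let am j : `|a * m j| <= kap.
Proof.
rewrite /m mulr_sumr; apply: le_trans (ler_norm_sum _ _ _) _.
rewrite -[leRHS]mul1r -qt1 mulr_suml; apply: ler_sum => i _.
by rewrite mulrCA normrM ger0_norm// ler_wpM2l// ukap.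
Qed.

(** The sign makes each two-sided deviation from the tilted mean a pair of one-sided ones, to which
    Chernoff's bound applies. *)
Let v j (s : bool) i := (-1) ^+ s * (u j i - m j).

Let qv j s : \sum_i qt i * v j s i = 0.
Proof.
have -> : \sum_i qt i * v j s i = (-1) ^+ s * (m j - (\sum_i qt i) * m j).
  rewrite {1}/m mulr_suml -sumrB mulr_sumr; apply: eq_bigr => i _; rewrite /v; set e := (-1) ^+ s; ring.
by rewrite qt1 mul1r subrr mulr0.
Qed.

Let vkap j s i : `|a * v j s i| <= 2 * kap.
Proof.
rewrite mulrCA normrM normrX normrN1 expr1n mul1r mulrBr.
apply: le_trans (ler_normB _ _) _.
by have := ukap j i; have := am j; rewrite -/kap; lra.
Qed.

Let vV j s : \sum_i qt i * v j s i ^+ 2 <= 2 * V.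
Proof.
have -> : \sum_i qt i * v j s i ^+ 2 = \sum_i qt i * u j i ^+ 2 - m j ^+ 2.
  transitivity (\sum_i qt i * u j i ^+ 2 - 2 * m j * m j + (\sum_i qt i) * m j ^+ 2).
    rewrite [X in _ - _ * X + _]/m mulr_sumr mulr_suml -sumrB -big_split/=.
    by apply: eq_bigr => i _; rewrite /v exprMn sqrr_sign; ring.
  by rewrite qt1; ring.
apply: (@le_trans _ _ (\sum_i qt i * u j i ^+ 2)).
  by rewrite gerBl sqr_ge0.
apply: (@le_trans _ _ (2 * \sum_i q i * u j i ^+ 2)).
  by rewrite mulr_sumr; apply: ler_sum => i _; rewrite mulrA ler_wpM2r ?sqr_ge0.
by rewrite ler_wpM2l// uV.
Qed.

Let tail j s : ffprob qt (fun i : {ffun 'I_k -> I} => k%:R * (a * (dl / 2)) <=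
    \sum_l v j s (i l)) <= expR (- (k%:R * a ^+ 2 * (dl ^+ 2 / (32 * V)))).
Proof.
(* Slope [kap] at deviation [dl / 2]: the gain is [kap * dl / 2 = dl ^+ 2 / (16 * V)], and since the
   exponential factor is at most 2 the cost is at most [2 * kap ^+ 2 * V = dl ^+ 2 / (32 * V)]. *)
apply: le_trans (@ffprob_mdp_le _ _ k qt (v j s) a (dl / 2) kap (2 * kap) (2 * V)
  qt0 qt1 a0 (ltW kap0) (qv j s) (vkap j s) (vV j s)) _.
rewrite ler_expR lerN2 ler_wpM2l//; first by rewrite mulr_ge0// sqr_ge0.
have -> : dl ^+ 2 / (32 * V) = kap * (dl / 2) - 2 * kap * (kap * V).
  by rewrite kapV /kap; field; rewrite gt_eqF.
have e2 : expR (kap * (2 * kap)) <= 2.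
  by apply: expR_le2; have := kap8; have := kap0; nra.
have : 0 <= kap ^+ 2 * V by rewrite mulr_ge0 ?sqr_ge0// ltW.
by move: e2; set E := expR _ => e2 k2; nra.
Qed.

(** The cost of the tilt is [a * \sum w - k * ln Z], with [\sum w] near [k * a * vW]; this bound on
    [ln Z] is what halves [a ^+ 2 * vW] there. *)
Let lnZ : a ^+ 2 * vW / 2 * (1 - 2 * kap) <= ln Z.
Proof.
apply: le_trans (le_ln_1B Z0).
have -> : 1 - Z^-1 = (Z - 1) * Z^-1 by rewrite mulrBl ZZi mul1r.
rewrite ler_pdivlMr//.
apply: (@le_trans _ _ (a ^+ 2 * vW / 2 * (1 - kap))); last by have := Zge; lra.
apply: (@le_trans _ _ (a ^+ 2 * vW / 2 * (1 - 2 * kap) * (1 + kap))).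
  rewrite ler_wpM2l//; first by have := kap8; have := avW0; nra.
  by have := Zle; have := avW; lra.
rewrite -mulrA ler_wpM2l//; first by have := avW0; lra.
by have := kap0; nra.
Qed.

(** The first factor bounds below the tilted probability that all sums are near their tilted means;
    the second is the price of returning to [q] on that event. *)
Lemma ffprob_mdp_ge :
  (1 - (2 * #|J|)%:R * expR (- (k%:R * a ^+ 2 * (dl ^+ 2 / (32 * V))))) *
    expR (- (k%:R * a ^+ 2 * (vW / 2 + dl))) <=
  ffprob q (fun i : {ffun 'I_k -> I} =>
    [forall j, `|\sum_l u j (i l) - k%:R * (a * c j)| <= k%:R * (a * dl)]).
Proof.
(* Only [dl / 2] is allowed around the tilted means: [m_near] uses up another [dl / 4] in passing
   from [m j] to [a * c j]. *)
pose D := (fun i : {ffun 'I_k -> I} =>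
  [forall j, `|\sum_l (u j (i l) - m j)| < k%:R * (a * (dl / 2))]).
have sumB i j : \sum_(l < k) (u j ((i : {ffun 'I_k -> I}) l) - m j) =
    \sum_l u j (i l) - k%:R * m j.
  by rewrite sumrB sumr_const card_ord mulr_natl.
have PD : 1 - (2 * #|J|)%:R * expR (- (k%:R * a ^+ 2 * (dl ^+ 2 / (32 * V)))) <=
    ffprob qt D.
  rewrite (ffprobC _ qt1) lerD2l lerN2.
  pose DD (r : J * bool) := (fun i : {ffun 'I_k -> I} =>
     k%:R * (a * (dl / 2)) <= \sum_l v r.1 r.2 (i l)).
  apply: (@le_trans _ _ (ffprob qt (fun i => [exists r, DD r i]))).
    apply: ffprob_le => // i /=; rewrite negb_forall => /existsP[j].
    rewrite -leNgt => H; apply/existsP.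
    have [s0|s0] := leP 0 (\sum_l (u j (i l) - m j)).
      exists (j, false); rewrite /DD/=; apply: le_trans H _.
      by rewrite ger0_norm// /v -mulr_sumr expr0 mul1r.
    exists (j, true); rewrite /DD/=; apply: le_trans H _.
    by rewrite ltr0_norm// /v -mulr_sumr expr1 mulN1r.
  apply: le_trans (ffprob_exists _ qt0) _.
  apply: (@le_trans _ _ (\sum_(r : J * bool)
      expR (- (k%:R * a ^+ 2 * (dl ^+ 2 / (32 * V)))))).
    by apply: ler_sum => -[j s] _; exact: tail.
  by rewrite sumr_const card_prod card_bool mulnC [leRHS]mulr_natl.
apply: (@le_trans _ _ (ffprob qt D * expR (- (k%:R * a ^+ 2 * (vW / 2 + dl))))).
  by rewrite ler_wpM2r ?expR_ge0.
apply: (@le_trans _ _ (ffprob q D)).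
  apply: (@ffprob_tilt _ _ k q (fun i => a * w i)) => // i /forallP/(_ j0).
  rewrite sumB -mulr_sumr -/w => H; have := ler_norm (\sum_(l < k) w (i l) - k%:R * m j0).
  have := m_near j0; have cw : c j0 = vW.
    by apply: eq_bigr => l _; rewrite expr2.
  rewrite cw => mn; have := ler_norm (m j0 - a * vW).
  move: mn H; rewrite -/Z kapV.
  set W := \sum_(l < k) _; set N := `|_|; set M := `|_| => mn H mN WM.
  have lZ := lnZ.
  have k0 : 0 <= k%:R :> R by [].
  have h1 : m j0 <= a * vW + 2 * (a * (dl / 8)) by lra.
  have h2 : W <= k%:R * (a * (dl / 2)) + k%:R * (a * vW + 2 * (a * (dl / 8))).
    by have := ler_wpM2l k0 h1; lra.
  have h3 : a * W <= k%:R * (a ^+ 2 * (dl * (3 / 4) + vW)).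
    by have := ler_wpM2l a0 h2; lra.
  have h4 := ler_wpM2l k0 lZ.
  have h5 : k%:R * a ^+ 2 * (kap * vW) <= k%:R * a ^+ 2 * (dl / 8).
    apply: ler_wpM2l; first by rewrite mulr_ge0// sqr_ge0.
    by rewrite -kapV ler_wpM2l// ltW.
  have h6 : 0 <= k%:R * a ^+ 2 * dl.
    by apply: mulr_ge0; [rewrite mulr_ge0// sqr_ge0|exact: ltW].
  lra.
apply: ffprob_le => // i /forallP H; apply/forallP => j.
have := H j; rewrite sumB => Hj.
have -> : \sum_l u j (i l) - k%:R * (a * c j) =
  (\sum_l u j (i l) - k%:R * m j) + k%:R * (m j - a * c j) by ring.
apply: le_trans (ler_normD _ _) _; rewrite normrM [`|k%:R|]ger0_norm//.
have k0 : 0 <= k%:R :> R by [].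
have := ler_wpM2l k0 (m_near j); rewrite kapV => h1.
have h6 : 0 <= k%:R * (a * dl) by do 2 apply: mulr_ge0 => //; exact: ltW.
by move: Hj h1; lra.
Qed.

End moderate_lower_bound.

(** * Events of finitely-valued statistics of independent variables *)

Section finite_valued_statistics.
Context d d' (T : measurableType d) (V : measurableType d') (R : realType).
Variables (Pr : probability T R) (Q : probability V R).
Context {J : finType} (phi : V -> J).
Hypothesis mphi : forall r, measurable (phi @^-1` [set r]).

Definition law_of (r : J) : R := fine (Q (phi @^-1` [set r])).

Lemma law_of_ge0 r : 0 <= law_of r. Proof. exact/fine_ge0/measure_ge0. Qed.

Lemma law_ofE r : (law_of r)%:E = Q (phi @^-1` [set r]).
Proof. by rewrite fineK// fin_num_measure. Qed.

Lemma measurable_fun_finite_valued (F : J -> R) : measurable_fun setT (F \o phi).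
Proof.
move=> _ B mB; rewrite setTI.
have -> : (F \o phi) @^-1` B = \bigcup_(r in [set r | B (F r)]) (phi @^-1` [set r]).
  by apply/seteqP; split=> [x Bx|x [r /= Br E]]; [by exists (phi x)|rewrite /= E].
by apply: fin_bigcup_measurable => //; exact: finite_finset.
Qed.

Lemma finite_valuedE (F : J -> R) x :
  F (phi x) = \sum_r F r * \1_(phi @^-1` [set r]) x.
Proof.
rewrite (bigD1 (phi x))//= indicE mem_set// mulr1 big1 ?addr0// => r rx.
by rewrite indicE memNset ?mulr0// => /= E; rewrite E eqxx in rx.
Qed.

Lemma Rintegral_finite_valued (F : J -> R) :
  \int[Q]_x F (phi x) = \sum_r law_of r * F r.
Proof.
rewrite /Rintegral; under eq_integral do rewrite finite_valuedE -sumEFin.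
have iF r : Q.-integrable setT (fun x => (F r * \1_(phi @^-1` [set r]) x)%:E).
  by under [X in integrable _ _ X]eq_fun do rewrite EFinM;
     apply: integrableZl => //; exact: integrable_indic.
rewrite integral_sum//=.
have iE r : (\int[Q]_x (F r * \1_(phi @^-1` [set r]) x)%:E = (law_of r * F r)%:E)%E.
  under eq_integral do rewrite EFinM.
  rewrite integralZl//; last exact: integrable_indic.
  by rewrite integral_indic// setIT EFinM law_ofE muleC.
by under eq_bigr do rewrite iE; rewrite sumEFin.
Qed.

Lemma sum_law_of : \sum_r law_of r = 1.
Proof.
have := Rintegral_finite_valued (fun=> 1).
have Q1 : fine (Q setT) = 1 by rewrite probability_setT.
rewrite Rintegral_cst// Q1 mul1r => E; rewrite [RHS]E.
by apply: eq_bigr => r _; rewrite mulr1.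
Qed.

Lemma measurable_ffun_event (k : nat) (Y : 'I_k -> {mfun T >-> V})
    (D : pred {ffun 'I_k -> J}) :
  measurable [set w | D [ffun j => phi (Y j w)]].
Proof.
have -> : [set w | D [ffun j => phi (Y j w)]] =
    \bigcup_(i in [set` D]) \bigcap_(j in [set: 'I_k]) (Y j @^-1` (phi @^-1` [set i j])).
  apply/seteqP; split=> [w Dw|w [i /= Di Ew]].
    by exists [ffun j => phi (Y j w)] => // j _ /=; rewrite ffunE.
  suff -> : [ffun j => phi (Y j w)] = i by [].
  by apply/ffunP => j; rewrite ffunE; exact: Ew.
apply: fin_bigcup_measurable => [|i _]; first exact: finite_finset.
apply: fin_bigcap_measurable => [|j _]; first exact: finite_finset.
by rewrite -[X in measurable X]setTI; apply: measurable_funP.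
Qed.

(** The event is a disjoint union of cylinders, each of which factorises. [idx] picks out the [k]
    variables: it is the embedding of ['I_n] in [nat] for the sample and the identity for the
    resample. *)
Lemma iid_ffprob (I : choiceType) (Y : I -> {mfun T >-> V}) (k : nat)
    (idx : 'I_k -> I) (D : pred {ffun 'I_k -> J}) :
  iid Pr Y Q -> injective idx ->
  Pr [set w | D [ffun j => phi (Y (idx j) w)]] = (ffprob law_of D)%:E.
Proof.
move=> [indY lawY] inj.
pose E (i : {ffun 'I_k -> J}) : set T :=
  \bigcap_(j in [set: 'I_k]) (Y (idx j) @^-1` (phi @^-1` [set i j])).
have mE i : measurable (E i).
  apply: fin_bigcap_measurable => [|j _]; first exact: finite_finset.
  by rewrite -[X in measurable X]setTI; apply: measurable_funP.
have PE i : Pr (E i) = (\prod_(j < k) law_of (i j))%:E.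
  (* Independence takes one set for every index of [I]; off the range of [idx] it is the whole
     space. *)
  pose A r := if [pick j | idx j == r] is Some j then phi @^-1` [set i j]
              else setT.
  have Aidx j : A (idx j) = phi @^-1` [set i j].
    rewrite /A; case: pickP => [j' /eqP/inj ->//|/(_ j)].
    by rewrite eqxx.
  have mA r : measurable (A r) by rewrite /A; case: pickP.
  have := indY [seq idx j | j <- enum 'I_k] A.
  rewrite map_inj_uniq// enum_uniq => /(_ isT mA).
  rewrite big_map big_enum/=.
  have PrE j : Pr (Y (idx j) @^-1` A (idx j)) = (law_of (i j))%:E.
    by rewrite Aidx law_ofE -(lawY (idx j)).
  under eq_bigr do rewrite PrE.
  rewrite prodEFin => <-; congr (Pr _).
  rewrite /E; apply/seteqP; split=> w H.
    by move=> _ /mapP[j _ ->]; rewrite Aidx; exact: H.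
  move=> j _; have := H (idx j); rewrite Aidx; apply.
  by apply/mapP; exists j; rewrite ?mem_enum.
have -> : [set w | D [ffun j => phi (Y (idx j) w)]] = \bigcup_(i in [set` D]) E i.
  apply/seteqP; split=> [w Dw|w [i /= Di Ew]].
    by exists [ffun j => phi (Y (idx j) w)] => // j _ /=; rewrite ffunE.
  suff -> : [ffun j => phi (Y (idx j) w)] = i by [].
  by apply/ffunP => j; rewrite ffunE; exact: Ew.
rewrite measure_fin_bigcup//; last first.
  move=> i i' _ _ [w [Ei Ei']]; apply/ffunP => j.
  by rewrite -(Ei j Logic.I) -(Ei' j Logic.I).
rewrite -(bigfs _ (index_enum_uniq _)); last first.
  by move=> i _; rewrite mem_index_enum.
by rewrite /ffprob -sumEFin; apply: eq_bigr => i _; exact: PE.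
Qed.

End finite_valued_statistics.

(** * Integrals against the empirical measure *)

Section empirical_integral.
Context d (V : measurableType d) (R : realType).

Lemma ge0_integral_empirical n (x : n.-tuple V) (f : V -> R) : (0 < n)%N ->
  measurable_fun setT f -> (forall s, 0 <= f s) ->
  (\int[empirical R x]_s (f s)%:E = ((\sum_(i < n) f (tnth x i)) / n%:R)%:E)%E.
Proof.
move=> n0 mf f0.
have n0' : (0 : R) <= n%:R^-1 by rewrite invr_ge0.
rewrite (@eq_measure_integral _ _ _ setT
  (mscale (NngNum n0') (msum (fun i => dirac (nth point x i)) n))); last first.
  move=> A mA _; etransitivity; first exact: empiricalE.
  rewrite /mscale/= muleC; congr (_ * _)%E.
  by rewrite /msum; apply: eq_bigr => i _; rewrite (tnth_nth point).
have /measurable_EFinP mEf := mf.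
rewrite ge0_integral_mscale//=; last by move=> s _; rewrite lee_fin.
rewrite ge0_integral_measure_sum//; last by move=> s _; rewrite lee_fin.
rewrite mulrC EFinM -sumEFin; congr (_ * _)%E; apply: eq_bigr => i _.
by rewrite integral_dirac// diracT mul1e (tnth_nth point).
Qed.

Lemma integrable_empirical n (x : n.-tuple V) (f : V -> R) : (0 < n)%N ->
  measurable_fun setT f -> (empirical R x).-integrable setT (EFin \o f).
Proof.
move=> n0 mf; apply/integrableP; split; first exact/measurable_EFinP.
rewrite -[X in (X < _)%E]/(\int[empirical R x]_s (`|f s|)%:E)%E.
by rewrite ge0_integral_empirical ?ltry//; exact: measurableT_comp.
Qed.

Lemma Rintegral_empirical n (x : n.-tuple V) (f : V -> R) : (0 < n)%N ->
  measurable_fun setT f ->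
  \int[empirical R x]_s f s = (\sum_(i < n) f (tnth x i)) / n%:R.
Proof.
move=> n0 mf.
have fE s : f s = f^\+ s - f^\- s by rewrite -[in LHS](funrposBneg f).
under eq_Rintegral do rewrite fE; under eq_bigr do rewrite fE.
have ip := integrable_funrpos measurableT (integrable_empirical x n0 mf).
have im := integrable_funrneg measurableT (integrable_empirical x n0 mf).
rewrite RintegralB// /Rintegral !ge0_integral_empirical//=.
- by rewrite sumrB mulrBl.
- exact: measurable_funrneg.
- exact: measurable_funrpos.
Qed.

End empirical_integral.

(** * Integrability of real functions and comparison of moments *)

Section real_integrability.
Context d (T : measurableType d) (R : realType).
Implicit Types f g : T -> R.

Lemma integrable_le (mu : {measure set T -> \bar R}) f g :
  measurable_fun setT f -> (forall x, `|f x| <= g x) ->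
  mu.-integrable setT (EFin \o g) -> mu.-integrable setT (EFin \o f).
Proof.
move=> mf fg; apply: le_integrable => //; first exact/measurable_EFinP.
by move=> x _ /=; rewrite lee_fin (le_trans (fg x))// ler_norm.
Qed.

Lemma integrable_cstR (mu : {finite_measure set T -> \bar R}) (c : R) :
  mu.-integrable setT (EFin \o cst c).
Proof. exact: finite_measure_integrable_cst. Qed.

Lemma integrable_addR (mu : {measure set T -> \bar R}) f g :
  mu.-integrable setT (EFin \o f) -> mu.-integrable setT (EFin \o g) ->
  mu.-integrable setT (EFin \o (fun x => f x + g x)).
Proof. by move=> iF ig; apply: eq_integrable (integrableD _ iF ig). Qed.

Lemma integrable_mulR (mu : {measure set T -> \bar R}) (c : R) f :
  mu.-integrable setT (EFin \o f) ->
  mu.-integrable setT (EFin \o (fun x => c * f x)).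
Proof. by move=> iF; apply: eq_integrable (integrableZl _ c iF). Qed.

Lemma ge0_integrableP (mu : {measure set T -> \bar R}) f :
  measurable_fun setT f -> (forall x, 0 <= f x) ->
  (\int[mu]_x (f x)%:E < +oo)%E -> mu.-integrable setT (EFin \o f).
Proof.
move=> mf f0 fy; apply/integrableP; split; first exact/measurable_EFinP.
by under eq_integral do rewrite /= ger0_norm//.
Qed.

Lemma Rintegral_cst1 (Q : probability T R) (c : R) : \int[Q]_x c = c.
Proof.
have Q1 : fine (Q setT) = 1 by rewrite probability_setT.
by rewrite Rintegral_cst// Q1 mulr1.
Qed.

Lemma markov_powR (Q : probability T R) f (p B : R) : 0 < B -> 0 < p ->
  measurable_fun setT f ->
  Q.-integrable setT (EFin \o (fun x => `|f x| `^ p)) ->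
  (Q [set x | (B < `|f x|)%R] <= (B `^ (- p) * \int[Q]_x (`|f x| `^ p))%:E)%E.
Proof.
move=> B0 p0 mf ip.
set A := [set x | _].
have mA : measurable A.
  have -> : A = (Num.norm \o f) @^-1` `]B, +oo[%classic.
    by apply/seteqP; split=> x; rewrite /A/= in_itv/= andbT.
  by rewrite -[X in measurable X]setTI; apply: measurableT_comp.
rewrite -(@fineK _ (Q A)) ?fin_num_measure// lee_fin.
have -> : fine (Q A) = \int[Q]_x \1_A x.
  by rewrite /Rintegral integral_indic// setIT.
rewrite -RintegralZl//; apply: le_Rintegral => //.
- exact: integrable_indic.
- exact: integrable_mulR.
move=> x _; rewrite indicE; case: (boolP (x \in A)) => [/set_mem Ax|_]; last first.
  by rewrite mulr_ge0 ?powR_ge0.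
rewrite powRN mulrC ler_pdivlMr ?powR_gt0// mul1r.
by rewrite ge0_ler_powR ?nnegrE ?(ltW B0) ?(ltW p0)//; exact: ltW.
Qed.

Lemma le_powRD1 (x q p : R) : 0 <= x -> 0 <= q -> q <= p -> x `^ q <= 1 + x `^ p.
Proof.
move=> x0 q0 qp; have [x1|x1] := leP 1 x.
  by rewrite (le_trans (ler_powR x1 qp))// lerDr.
apply: (@le_trans _ _ 1); last by rewrite lerDl powR_ge0.
have -> : 1 = 1 `^ q :> R by rewrite powR1.
rewrite ge0_ler_powR ?nnegrE ?ler01//; exact: ltW.
Qed.

Lemma integrable_powR_le (Q : probability T R) f (q p : R) : 0 <= q -> q <= p ->
  measurable_fun setT f ->
  Q.-integrable setT (EFin \o (fun x => `|f x| `^ p)) ->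
  Q.-integrable setT (EFin \o (fun x => `|f x| `^ q)).
Proof.
move=> q0 qp mf ip.
apply: (@integrable_le _ _ (fun x => 1 + `|f x| `^ p)).
- by apply: (measurableT_comp (measurable_powR _)) => //; exact: measurableT_comp.
- by move=> x; rewrite ger0_norm ?powR_ge0// le_powRD1.
- by apply: integrable_addR => //; exact: (integrable_cstR Q 1).
Qed.

End real_integrability.

(** * Chernoff's bound for bounded functions of the sample *)

Section truncated_chernoff.
Context {R : realType}.

(** Replaces the second-order Taylor bound when only a moment of order [q <= 2] is available:
    [z ^+ 2 <= |z| ^ q] for [|z| <= 1], while beyond 1 the last term dominates the linear one. *)
Lemma expR_le_powR (z q : R) : 1 <= q -> q <= 2 ->
  expR z <= 1 + z + `|z| `^ q * expR `|z|.
Proof.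
move=> q1 q2; have q0 : 0 <= q by exact: le_trans q1.
have [z1|z1] := leP `|z| 1.
  apply: le_trans (expR_le_taylor2 z) _; rewrite lerD2l ler_wpM2r ?expR_ge0//.
  have [->|zn0] := eqVneq z 0; first by rewrite normr0 expr2 mul0r mul0r powR_ge0.
  apply: (@le_trans _ _ (z ^+ 2)).
    by rewrite ler_pdivrMr// ler_peMr ?sqr_ge0// ler1n.
  rewrite -real_normK ?num_real// -powR_mulrn// ger_powR// z1 andbT.
  by rewrite normr_gt0.
have zq : `|z| <= `|z| `^ q by apply: le1r_powR => //; exact: ltW.
have [z0|z0] := leP 0 z.
  have e1 : expR z <= `|z| `^ q * expR `|z|.
    rewrite [in leRHS](ger0_norm z0) ler_peMl ?expR_ge0//.
    by rewrite -(ger0_norm z0); apply: le_trans zq; exact: ltW.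
  by lra.
have e1 : `|z| <= `|z| `^ q * expR `|z|.
  apply: le_trans zq _; rewrite ler_peMr ?powR_ge0//.
  by rewrite -expR0 ler_expR.
have : expR z <= 1 by rewrite expR_le1 ltW.
by move: e1; rewrite [in X in X <= _ -> _](ltr0_norm z0); lra.
Qed.

Context d d' (T : measurableType d) (V : measurableType d').
Variables (Pr : probability T R) (Q : probability V R).
Variables (X : nat -> {mfun T >-> V}).
Hypothesis iidX : iid Pr X Q.

(* [g] is rounded down to a multiple of [e], which makes the sample finite-valued. *)
Lemma iid_chernoff (g : V -> R) (B l c e : R) (n : nat) :
  measurable_fun setT g -> (forall s, `|g s| <= B) -> 0 <= l -> 0 < e ->
  (Pr [set w | (n%:R * c <= \sum_(i < n) g (X i w))%R] <=
   (expR (- (l * (n%:R * (c - e)))) * (\int[Q]_s expR (l * g s)) ^+ n)%:E)%E.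
Proof.
move=> mg gB l0 e0.
pose N := Num.truncn (2 * B / e).
pose y s := (g s + B) / e.
have y0 s : 0 <= y s.
  apply: divr_ge0; last exact: ltW.
  by have := gB s; rewrite ler_norml => /andP[]; lra.
have yN s : (Num.truncn (y s) < N.+1)%N.
  rewrite truncn_lt_nat//; apply: le_lt_trans (truncnS_gt _).
  rewrite ler_pM2r ?invr_gt0//.
  by have := gB s; rewrite ler_norml => /andP[]; lra.
pose phi s : 'I_N.+1 := Ordinal (yN s).
pose F (r : 'I_N.+1) : R := e * r%:R - B.
have my : measurable_fun setT y.
  apply: measurable_funM => //; exact: measurable_funD.
have mphi r : measurable (phi @^-1` [set r]).
  have -> : phi @^-1` [set r] = y @^-1` `[r%:R, r.+1%:R[%classic.
    apply/seteqP; split=> s /=; rewrite in_itv/=.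
      by move=> <- /=; exact: truncn_itv.
    by move=> H; apply/val_inj => /=; exact: truncn_def.
  by rewrite -[X in measurable X]setTI; apply: my.
have Fle s : F (phi s) <= g s.
  have /andP[+ _] := truncn_itv (y0 s).
  by rewrite /F /= {2}/y ler_pdivlMr//; lra.
have Fgt s : g s <= F (phi s) + e.
  have /andP[_ /ltW] := truncn_itv (y0 s).
  by rewrite /F /= {1}/y ler_pdivrMr// -natr1; lra.
pose D (i : {ffun 'I_n -> 'I_N.+1}) := n%:R * (c - e) <= \sum_j F (i j).
have DE w : D [ffun j : 'I_n => phi (X (nat_of_ord j) w)] =
    (n%:R * (c - e) <= \sum_(i < n) F (phi (X i w))).
  by rewrite /D; congr (_ <= _); apply: eq_bigr => i _; rewrite ffunE.
have mXg i : measurable_fun setT (g \o X i) by exact: measurableT_comp.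
apply: (@le_trans _ _ (Pr [set w | D [ffun j : 'I_n => phi (X (nat_of_ord j) w)]])).
  apply: le_measure.
  - rewrite inE.
    have -> : [set w | n%:R * c <= \sum_(i < n) g (X i w)] =
       (fun w => \sum_(i < n) (g \o X i) w) @^-1` `[n%:R * c, +oo[%classic.
      by apply/seteqP; split=> w; rewrite /= in_itv/= andbT.
    rewrite -[X in measurable X]setTI.
    by apply: measurable_sum.
  - rewrite inE.
    have -> : [set w | D [ffun j : 'I_n => phi (X (nat_of_ord j) w)]] =
       (fun w => \sum_(i < n) (F \o phi \o X i) w) @^-1` `[n%:R * (c - e), +oo[%classic.
      by apply/seteqP; split=> w; rewrite /= in_itv/= andbT DE.
    rewrite -[X in measurable X]setTI.
    apply: measurable_sum => // i.
    exact: (measurableT_comp (measurable_fun_finite_valued mphi F)). 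
  - move=> w /= H; rewrite DE.
    apply: (@le_trans _ _ (\sum_(i < n) g (X i w) - n%:R * e)); first by lra.
    have : \sum_(i < n) g (X i w) <= \sum_(i < n) (F (phi (X i w)) + e).
      by apply: ler_sum => i _.
    by rewrite big_split/= sumr_const card_ord mulr_natl; lra.
rewrite (iid_ffprob mphi _ iidX); last exact: val_inj.
rewrite lee_fin; apply: le_trans (@ffprob_chernoff _ _ n _ F _ _ (law_of_ge0 Q phi) l0) _.
rewrite ler_wpM2l ?expR_ge0// -Rintegral_finite_valued//.
have mE : measurable_fun setT (fun s => expR (l * g s)).
  by apply: measurableT_comp => //; apply: measurable_funM.
have mE' : measurable_fun setT (fun s => expR (l * F (phi s))).
  exact: (measurable_fun_finite_valued mphi (fun r => expR (l * F r))).
have le1 s : expR (l * g s) <= expR (l * B).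
  by rewrite ler_expR ler_wpM2l// (le_trans (ler_norm _)).
have le2 s : expR (l * F (phi s)) <= expR (l * g s).
  by rewrite ler_expR ler_wpM2l.
have ib := integrable_cstR Q (expR (l * B)).
rewrite lerXn2r ?nnegrE ?Rintegral_ge0//; try by move=> s _; exact: expR_ge0.
apply: le_Rintegral => //.
- apply: integrable_le ib => // s.
  by rewrite ger0_norm ?expR_ge0// (le_trans (le2 _)).
- by apply: integrable_le ib => // s; rewrite ger0_norm ?expR_ge0.
Qed.

End truncated_chernoff.

(** * Polynomial rate in the law of large numbers under a moment of order [p > 1] *)

Section law_of_large_numbers_rate.
Context {R : realType} d d' (T : measurableType d) (V : measurableType d').
Variables (Pr : probability T R) (Q : probability V R).
Variables (X : nat -> {mfun T >-> V}).
Hypothesis iidX : iid Pr X Q.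
Variables (Y : V -> R) (p : R).
Hypotheses (mY : measurable_fun setT Y) (p1 : 1 < p).
Hypothesis iYp : Q.-integrable setT (EFin \o (fun s => `|Y s| `^ p)).

Let p0 : 0 < p. Proof. exact: lt_trans p1. Qed.

Lemma integrable_powR_gt1 : Q.-integrable setT (EFin \o Y).
Proof.
have := integrable_powR_le (ler01 : 0 <= 1 :> R) (ltW p1) mY iYp.
apply: integrable_le => // s.
by rewrite powRr1.
Qed.

Let Mp := \int[Q]_s (`|Y s| `^ p).

Let Mp0 : 0 <= Mp. Proof. by apply: Rintegral_ge0 => s _; exact: powR_ge0. Qed.

Definition trunc_at (B : R) (s : V) : R := if `|Y s| <= B then Y s else 0.

Lemma measurable_trunc_at B : measurable_fun setT (trunc_at B).
Proof.
apply: measurable_fun_ifT => //.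
by apply: measurable_fun_ler => //; exact: measurableT_comp.
Qed.

Lemma trunc_at_le B s : 0 <= B -> `|trunc_at B s| <= B.
Proof. by rewrite /trunc_at; case: ifP => // _; rewrite normr0. Qed.

Lemma trunc_at_norm B s : `|trunc_at B s| <= `|Y s|.
Proof. by rewrite /trunc_at; case: ifP => // _; rewrite normr0. Qed.

Lemma integrable_trunc_at B : Q.-integrable setT (EFin \o trunc_at B).
Proof.
apply: (@integrable_le _ _ _ _ _ (fun s => `|Y s|)).
- exact: measurable_trunc_at.
- exact: trunc_at_norm.
- exact: integrable_norm integrable_powR_gt1.
Qed.

(** Where truncation acts, [B < |Y|], hence [|Y| <= B ^ (1 - p) * |Y| ^ p] as [p > 1]. *)
Lemma Rintegral_trunc_at B : 0 < B ->
  \int[Q]_s trunc_at B s <= \int[Q]_s Y s + Mp * B `^ (1 - p).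
Proof.
move=> B0; rewrite mulrC -RintegralZl// -RintegralD//; last 2 first.
- exact: integrable_powR_gt1.
- exact: integrable_mulR.
apply: le_Rintegral => //.
- exact: integrable_trunc_at.
- by apply: integrable_addR; [exact: integrable_powR_gt1|exact: integrable_mulR].
move=> s _; rewrite /trunc_at; case: ifPn => [_|].
  by rewrite lerDl mulr_ge0 ?powR_ge0.
rewrite -ltNge => BY.
have Y0 : 0 < `|Y s| by exact: lt_trans BY.
have : `|Y s| <= B `^ (1 - p) * `|Y s| `^ p.
  have -> : B `^ (1 - p) = (B `^ (p - 1))^-1 by rewrite -powRN opprB.
  rewrite mulrC ler_pdivlMr ?powR_gt0//.
  rewrite -(@mulr_powRB1 _ `|Y s|)// ler_wpM2l//.
  by rewrite ge0_ler_powR ?nnegrE ?subr_ge0 ?(ltW p1) ?(ltW B0)//; exact: ltW.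
by have := ler_norm (- Y s); rewrite normrN; lra.
Qed.

(** Two orders coexist: the bias of truncation uses the full moment [p], whereas the exponential
    inequality requires [q <= 2]; the application takes [q] to be the minimum of [p] and 2. *)
Lemma mgf_trunc_at (q l B : R) : 1 < q -> q <= 2 -> q <= p -> 0 <= l -> 0 < B ->
  \int[Q]_s expR (l * trunc_at B s) <=
  expR (l * (\int[Q]_s Y s + Mp * B `^ (1 - p)) +
        l `^ q * expR (l * B) * \int[Q]_s (`|Y s| `^ q)).
Proof.
move=> q1 q2 qp l0 B0.
have q0 : 0 <= q by rewrite (le_trans ler01)// ltW.
have mt := measurable_trunc_at B.
have iq := integrable_powR_le q0 qp mY iYp.
have it := integrable_trunc_at B.
have bnd s : expR (l * trunc_at B s) <=
    1 + (l * trunc_at B s + l `^ q * expR (l * B) * `|Y s| `^ q).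
  apply: le_trans (expR_le_powR _ (ltW q1) q2) _.
  rewrite addrA lerD2l -!mulrA normrM (ger0_norm l0) powRM// -!mulrA.
  rewrite ler_wpM2l ?powR_ge0// [leRHS]mulrC; apply: ler_pM.
  - exact: powR_ge0.
  - exact: expR_ge0.
  - by rewrite ge0_ler_powR ?nnegrE//; exact: trunc_at_norm.
  - by rewrite ler_expR ler_wpM2l// trunc_at_le// ltW.
have i1 := integrable_cstR Q 1.
have i2 := integrable_mulR l it.
have i3 := integrable_mulR (l `^ q * expR (l * B)) iq.
have i23 := integrable_addR i2 i3.
have i123 := integrable_addR i1 i23.
have mE : measurable_fun setT (fun s => expR (l * trunc_at B s)).
  by apply: measurableT_comp => //; exact: measurable_funM.
have iE : Q.-integrable setT (EFin \o (fun s => expR (l * trunc_at B s))).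
  by apply: integrable_le i123 => // s; rewrite ger0_norm ?expR_ge0.
apply: le_trans (le_Rintegral measurableT iE i123 (fun s _ => bnd s)) _.
rewrite RintegralD// Rintegral_cst1 RintegralD// !RintegralZl//.
apply: le_trans (expR_ge1Dx _); rewrite lerD2l lerD2r ler_wpM2l//.
exact: Rintegral_trunc_at.
Qed.

(* Fuk-Nagaev: Chernoff's bound with the slope [K ln n / n] for the sample
   truncated at [b n], the number of truncated terms being handled by Markov. *)
Lemma lln_upper_rate (dl : R) : 0 < dl -> exists (C : R) (n0 : nat), 0 < C /\
  forall n, (n0 < n)%N ->
  (Pr [set w | (n%:R * (\int[Q]_s Y s + dl) <= \sum_(i < n) Y (X i w))%R] <=
   (C * n%:R `^ (1 - p))%:E)%E.
Proof.
move=> dl0.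
pose q := Num.min p 2.
have q1 : 1 < q by rewrite lt_min p1/= ltr1n.
have q2 : q <= 2 by rewrite ge_min lexx orbT.
have qp : q <= p by rewrite ge_min lexx.
have q0 : 0 < q by exact: lt_trans q1.
(* With slope [K * ln n / n], a margin of [dl / 2] in the mean produces the factor
   [expR (- (p * ln n))], that is [n ^ (- p)]. *)
pose K := 2 * p / dl.
have K0 : 0 < K by rewrite divr_gt0// mulr_gt0.
(* Truncation at [b * n] makes [expR (l * B)] equal to [n ^ ((q - 1) / 2)], only half of what the
   factor [n ^ (1 - q)] can absorb. *)
pose b := (q - 1) / (2 * K).
have b0 : 0 < b by rewrite divr_gt0 ?subr_gt0// mulr_gt0.
(* The other half absorbs the logarithm: [ln n <= n ^ s0 / s0] with [s0 * q = (q - 1) / 2], so the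
   powers of [n] in the remainder cancel and a constant is left. *)
pose s0 := (q - 1) / (2 * q).
have s00 : 0 < s0 by rewrite divr_gt0 ?subr_gt0// mulr_gt0.
pose Mq := \int[Q]_s (`|Y s| `^ q).
have Mq0 : 0 <= Mq by apply: Rintegral_ge0 => s _; exact: powR_ge0.
pose D := (K / s0) `^ q.
pose C := Mp * b `^ (- p) + expR (D * Mq).
have C0 : 0 < C by rewrite ltr_wpDl ?expR_gt0// mulr_ge0 ?powR_ge0.
(* Once the truncation level exceeds [t0], the bias [Mp * B ^ (1 - p)] is at most [dl / 4]. *)
pose t0 := (dl / (4 * (Mp + 1))) `^ ((1 - p)^-1).
exists C, (Num.truncn (t0 / b)).+1; split=> // n n0n.
have n1 : (1 < n)%N by exact: leq_ltn_trans n0n.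
have n0 : (0 < n)%N by exact: ltn_trans n1.
have nR0 : 0 < n%:R :> R by rewrite ltr0n.
pose B := b * n%:R.
have B0 : 0 < B by rewrite mulr_gt0.
have tB : t0 <= B.
  rewrite /B mulrC -ler_pdivrMr//; apply: ltW; apply: lt_trans (truncnS_gt _) _.
  by rewrite ltr_nat.
have MB : Mp * B `^ (1 - p) <= dl / 4.
  have d4 : 0 < dl / (4 * (Mp + 1)) by rewrite divr_gt0// mulr_gt0// ltr_wpDl.
  have t00 : 0 < t0 by exact: powR_gt0.
  have : B `^ (1 - p) <= t0 `^ (1 - p).
    have -> : 1 - p = - (p - 1) by rewrite opprB.
    rewrite !powRN lef_pV2 ?posrE ?powR_gt0//.
    by rewrite ge0_ler_powR ?nnegrE ?subr_ge0 ?(ltW p1)//; exact: ltW.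
  rewrite -powRrM mulVf ?subr_eq0 ?lt_eqF// (powRr1 (ltW d4)) => H.
  apply: (@le_trans _ _ (Mp * (dl / (4 * (Mp + 1))))); first by rewrite ler_wpM2l.
  rewrite mulrA ler_pdivrMr ?mulr_gt0 ?ltr_wpDl//.
  by have := Mp0; move: dl0; nra.
pose l := K * ln n%:R / n%:R.
have ln0 : 0 < ln n%:R :> R by rewrite ln_gt0// ltr1n.
have l0 : 0 < l by rewrite divr_gt0// mulr_gt0.
have ln_E : l * n%:R = K * ln n%:R by rewrite /l divfK// gt_eqF.
pose E1 (i : nat) : set T := [set w | (B < `|Y (X i w)|)%R].
pose A1 := \big[setU/set0]_(i < n) E1 i.
pose A2 := [set w | (n%:R * (\int[Q]_s Y s + dl) <= \sum_(i < n) trunc_at B (X i w))%R].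
have mYX i : measurable_fun setT (Y \o X i) by exact: measurableT_comp.
have mA1i i : measurable [set w | (B < `|Y (X i w)|)%R].
  have -> : [set w | (B < `|Y (X i w)|)%R] =
     (fun w => `|(Y \o X i) w|) @^-1` `]B, +oo[%classic.
    by apply/seteqP; split=> w; rewrite /= in_itv/= andbT.
  rewrite -[X in measurable X]setTI.
  have : measurable_fun setT (fun w => `|(Y \o X i) w|) by exact: measurableT_comp.
  by apply.
have mA1 : measurable A1 by apply: bigsetU_measurable => i _; exact: mA1i.
have mA2 : measurable A2.
  have -> : A2 = (fun w => \sum_(i < n) (trunc_at B \o X i) w) @^-1`
      `[n%:R * (\int[Q]_s Y s + dl), +oo[%classic.
    by apply/seteqP; split=> w; rewrite /A2/= in_itv/= andbT.
  rewrite -[X in measurable X]setTI; apply: measurable_sum => // i.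
  exact: (measurableT_comp (measurable_trunc_at B)).
have mA : measurable [set w | (n%:R * (\int[Q]_s Y s + dl) <= \sum_(i < n) Y (X i w))%R].
  rewrite [X in measurable X](_ : _ = (fun w => \sum_(i < n) (Y \o X i) w) @^-1`
      `[n%:R * (\int[Q]_s Y s + dl), +oo[%classic); last first.
    by apply/seteqP; split=> w; rewrite /= in_itv/= andbT.
  by rewrite -[X in measurable X]setTI; apply: measurable_sum.
apply: (@le_trans _ _ (Pr A1 + Pr A2)%E).
  apply: (@le_trans _ _ (Pr (A1 `|` A2))); last exact: measureU2.
  apply: le_measure; rewrite ?inE//; first exact: measurableU.
  move=> w /= H; have [?|nA1] := pselect (A1 w); [by left|right].
  rewrite /A2/=; apply: le_trans H _; apply: ler_sum => i _.
  rewrite /trunc_at ifT// leNgt; apply/negP => Bi; apply: nA1.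
  by rewrite /A1 -(bigcup_mkord n E1); exists i => /=.
rewrite /C mulrDl EFinD; apply: leeD.
  apply: (@le_trans _ _ (\sum_(i < n) Pr [set w | (B < `|Y (X i w)|)%R])%E).
    by apply: (@Boole_inequality _ _ _ Pr E1) => i _; exact: mA1i.
  apply: (@le_trans _ _ (\sum_(i < n) (B `^ (- p) * Mp)%:E)%E).
    apply: lee_sum => i _; have [_ lawX] := iidX.
    have mS : measurable [set s | (B < `|Y s|)%R].
      rewrite [X in measurable X](_ : _ = (fun s => `|Y s|) @^-1` `]B, +oo[%classic).
        rewrite -[X in measurable X]setTI.
        have : measurable_fun setT (fun s => `|Y s|) by exact: measurableT_comp.
        by apply.
      by apply/seteqP; split=> w; rewrite /= in_itv/= andbT.
    have := lawX i _ mS; rewrite /distribution/= /pushforward => E.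
    rewrite [leLHS]E; exact: markov_powR.
  rewrite sumEFin lee_fin sumr_const card_ord -[leLHS]mulr_natl.
  rewrite /B powRM ?(ltW b0)// (@powRD _ n%:R 1 (- p)) ?(gt_eqF nR0) ?implybT//.
  by rewrite powRr1//; lra.
(* The margin [dl] is split into [dl / 4] for rounding, [dl / 4] for the bias of truncation and
   [dl / 2] for the exponential decay. *)
have e0 : 0 < dl / 4 by rewrite divr_gt0.
have gB s : `|trunc_at B s| <= B by exact: trunc_at_le (ltW B0).
have H := (iid_chernoff iidX (\int[Q]_s Y s + dl) n (measurable_trunc_at B)
  gB (ltW l0) e0); apply: le_trans H _.
rewrite lee_fin.
apply: (@le_trans _ _ (expR (- (l * (n%:R * (\int[Q]_s Y s + dl - dl / 4)))) *
  expR (l * (\int[Q]_s Y s + dl / 4) + l `^ q * expR (l * B) * Mq) ^+ n)).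
  rewrite ler_wpM2l ?expR_ge0// lerXn2r ?nnegrE ?expR_ge0//.
    by apply: Rintegral_ge0 => s _; exact: expR_ge0.
  apply: le_trans (mgf_trunc_at q1 q2 qp (ltW l0) B0) _.
  by rewrite ler_expR lerD2r ler_wpM2l ?(ltW l0)// lerD2l.
rewrite -expRM_natl -expRD.
have -> : - (l * (n%:R * (\int[Q]_s Y s + dl - dl / 4))) +
    n%:R * (l * (\int[Q]_s Y s + dl / 4) + l `^ q * expR (l * B) * Mq) =
  - (l * n%:R * (dl / 2)) + n%:R * l `^ q * expR (l * B) * Mq by field.
rewrite expRD mulrC; apply: ler_pM; rewrite ?expR_ge0//; last first.
  rewrite ln_E (_ : K * _ * _ = p * ln n%:R); last by rewrite /K; field; rewrite gt_eqF.
  rewrite -mulNr [X in expR X <= _](_ : _ = - p * ln n%:R)//.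
  rewrite -(@ln_powR R) lnK ?posrE ?powR_gt0//.
  by rewrite ler_powR ?ler1n//; lra.
rewrite ler_expR ler_wpM2r//.
have eB : expR (l * B) = n%:R `^ ((q - 1) / 2).
  rewrite /B mulrCA ln_E -(@lnK _ (n%:R `^ _)) ?posrE ?powR_gt0// ln_powR.
  by congr expR; rewrite /b; field; rewrite gt_eqF.
rewrite eB /l /D.
have lnn : ln n%:R <= n%:R `^ s0 / s0.
  rewrite ler_pdivlMr// mulrC -ln_powR.
  have := expR_ge1Dx (ln (n%:R `^ s0) : R); rewrite lnK ?posrE ?powR_gt0//.
  lra.
have Kln0 : 0 <= K * ln n%:R := mulr_ge0 (ltW K0) (ltW ln0).
have Ks0 : 0 <= K / s0 := divr_ge0 (ltW K0) (ltW s00).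
have ns0 : 0 <= n%:R `^ s0 / s0 := divr_ge0 (powR_ge0 _ _) (ltW s00).
have -> : n%:R * (K * ln n%:R / n%:R) `^ q = n%:R `^ (1 - q) * (K * ln n%:R) `^ q.
  rewrite powRM ?invr_ge0//.
  rewrite powRB ?(gt_eqF nR0) ?implybT// powRr1//.
  rewrite -(powR_inv1 (ltW nR0)) -powRrM mulN1r powRN; ring.
apply: (@le_trans _ _ (n%:R `^ (1 - q) * (K * (n%:R `^ s0 / s0)) `^ q *
    n%:R `^ ((q - 1) / 2))).
  rewrite ler_wpM2r ?powR_ge0// ler_wpM2l ?powR_ge0//.
  rewrite ge0_ler_powR ?nnegrE ?(ltW q0)//.
  - exact: mulr_ge0 (ltW K0) ns0.
  - exact: ler_wpM2l (ltW K0) _ _ lnn.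
have -> : K * (n%:R `^ s0 / s0) = K / s0 * n%:R `^ s0 by ring.
rewrite powRM ?powR_ge0// -powRrM.
have -> : n%:R `^ (1 - q) * ((K / s0) `^ q * n%:R `^ (s0 * q)) * n%:R `^ ((q - 1) / 2) =
  (K / s0) `^ q * (n%:R `^ (1 - q) * n%:R `^ (s0 * q) * n%:R `^ ((q - 1) / 2)).
  by ring.
rewrite -!powRD ?(gt_eqF nR0) ?implybT// (_ : _ + _ = 0) ?powRr0 ?mulr1//.
by rewrite /s0; field; rewrite gt_eqF.
Qed.

End law_of_large_numbers_rate.

(** * Square-integrable functions and completeness of L2(P) *)

Section square_integrable.
Context d (V : measurableType d) (R : realType) (P : probability V R).
Implicit Types f g u : V -> R.

Definition sqint f := measurable_fun setT f /\
  P.-integrable setT (EFin \o (fun s => f s ^+ 2)).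

Lemma sqint_mul f g : sqint f -> sqint g ->
  P.-integrable setT (EFin \o (fun s => f s * g s)).
Proof.
move=> [mf iF] [mg ig]; apply: integrable_le (integrable_addR iF ig).
  exact: measurable_funM.
move=> s; rewrite normrM.
have : 0 <= (`|f s| - `|g s|) ^+ 2 by rewrite sqr_ge0.
have : 0 <= `|f s| * `|g s| by rewrite mulr_ge0.
by rewrite sqrrB !real_normK ?num_real//; lra.
Qed.

Lemma sqint_cst (c : R) : sqint (fun=> c).
Proof. by split => //; exact: integrable_cstR. Qed.

Lemma sqint_int f : sqint f -> P.-integrable setT (EFin \o f).
Proof.
move=> sf; have := sqint_mul sf (sqint_cst 1).
by under eq_fun do rewrite mulr1.
Qed.

Lemma sqint_add f g : sqint f -> sqint g -> sqint (fun s => f s + g s).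
Proof.
move=> sf sg; have [mf iF] := sf; have [mg ig] := sg.
split; first exact: measurable_funD.
have ifg := integrable_mulR 2 (sqint_mul sf sg).
have H := integrable_addR (integrable_addR iF ig) ifg.
by apply: eq_integrable H => // s _ /=; congr EFin; ring.
Qed.

Lemma sqint_scale (c : R) f : sqint f -> sqint (fun s => c * f s).
Proof.
move=> [mf iF]; split; first exact: measurable_funM.
have H := integrable_mulR (c ^+ 2) iF.
by apply: eq_integrable H => // s _ /=; rewrite exprMn.
Qed.

Lemma sqint_sub f g : sqint f -> sqint g -> sqint (fun s => f s - g s).
Proof.
move=> sf /(sqint_scale (-1)) /(sqint_add sf).
by under eq_fun do rewrite mulN1r.
Qed.

Definition dotP f g : R := \int[P]_s (f s * g s).

Lemma dotPC f g : dotP f g = dotP g f.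
Proof. by apply: eq_Rintegral => s _; rewrite mulrC. Qed.

Lemma dotPDl f g u : sqint f -> sqint g -> sqint u ->
  dotP (fun s => f s + g s) u = dotP f u + dotP g u.
Proof.
move=> sf sg su; rewrite /dotP -RintegralD//; [|exact: sqint_mul..].
by apply: eq_Rintegral => s _; rewrite mulrDl.
Qed.

Lemma dotPZl (c : R) f u : sqint f -> sqint u ->
  dotP (fun s => c * f s) u = c * dotP f u.
Proof.
move=> sf su; rewrite /dotP -RintegralZl//; last exact: sqint_mul.
by apply: eq_Rintegral => s _; rewrite mulrA.
Qed.

Lemma dotPBl f g u : sqint f -> sqint g -> sqint u ->
  dotP (fun s => f s - g s) u = dotP f u - dotP g u.
Proof.
move=> sf sg su; rewrite /dotP -RintegralB//; [|exact: sqint_mul..].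
by apply: eq_Rintegral => s _; rewrite mulrBl.
Qed.

Lemma dotPDr f g u : sqint f -> sqint g -> sqint u ->
  dotP u (fun s => f s + g s) = dotP u f + dotP u g.
Proof. by move=> *; rewrite dotPC dotPDl// !(dotPC u). Qed.

Lemma dotPZr (c : R) f u : sqint f -> sqint u ->
  dotP u (fun s => c * f s) = c * dotP u f.
Proof. by move=> *; rewrite dotPC dotPZl// (dotPC u). Qed.

Lemma dotPBr f g u : sqint f -> sqint g -> sqint u ->
  dotP u (fun s => f s - g s) = dotP u f - dotP u g.
Proof. by move=> *; rewrite dotPC dotPBl// !(dotPC u). Qed.

Lemma dotP_ge0 f : 0 <= dotP f f.
Proof. by apply: Rintegral_ge0 => s _; rewrite -expr2 sqr_ge0. Qed.

Lemma dotP1r f : dotP f (fun=> 1) = \int[P]_s f s.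
Proof. by apply: eq_Rintegral => s _; rewrite mulr1. Qed.

(** The discriminant inequality, normalised so that it serves both Cauchy-Schwarz and the
    perturbation of a near-minimiser. *)
Lemma quadratic_ge0 (e b c : R) : 0 <= c ->
  (forall s, 0 <= e + s * b + s ^+ 2 / 2 * c) -> b ^+ 2 <= 2 * e * c.
Proof.
rewrite le_eqVlt => /predU1P[<-|c0] H.
  have [->|b0] := eqVneq b 0; first by rewrite mulr0 expr0n.
  have := H (- (e + 1) / b); rewrite mulr0 addr0 divfK//; lra.
have := H (- b / c).
have -> : e + - b / c * b + (- b / c) ^+ 2 / 2 * c = (2 * e * c - b ^+ 2) / (2 * c).
  by field; rewrite gt_eqF.
by rewrite pmulr_lge0 ?invr_gt0 ?mulr_gt0// subr_ge0.
Qed.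

Lemma dotP_cauchy_schwarz f g : sqint f -> sqint g ->
  dotP f g ^+ 2 <= dotP f f * dotP g g.
Proof.
move=> sf sg.
have := @quadratic_ge0 (dotP f f / 2) (dotP f g) (dotP g g) (dotP_ge0 g).
rewrite (_ : 2 * (dotP f f / 2) = dotP f f); last by field.
apply=> s; have sgs := sqint_scale s sg.
have := dotP_ge0 (fun x => f x + s * g x).
rewrite dotPDl ?dotPDr ?dotPZl ?dotPZr//; [|exact: sqint_add..].
by rewrite (dotPC g f); lra.
Qed.

(** The geometric rate makes consecutive differences summable in L1, hence the sequence converges
    almost everywhere; Fatou's lemma then carries the L2 bound to the limit. *)
Lemma L2_complete (g : nat -> V -> R) : (forall j, sqint (g j)) ->
  (forall j m, (j <= m)%N ->
     dotP (fun s => g m s - g j s) (fun s => g m s - g j s) <= (4^-1) ^+ j) ->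
  exists2 l, sqint l & forall j,
     dotP (fun s => l s - g j s) (fun s => l s - g j s) <= (4^-1) ^+ j.
Proof.
move=> sg cg.
have mg j : measurable_fun setT (g j) by have [] := sg j.
pose D j s := `|g j.+1 s - g j s|.
have mD j : measurable_fun setT (D j).
  by apply: measurableT_comp => //; exact: measurable_funB.
have sD j : sqint (D j).
  split=> //; have [_ H] := sqint_sub (sg j.+1) (sg j).
  by apply: eq_integrable H => // s _ /=; rewrite /D real_normK ?num_real.
have ED j : \int[P]_s D j s <= 2^-1 ^+ j.
  (* The L1 norm is bounded by the L2 norm through [x <= (2 ^+ j * x ^+ 2 + 2^-1 ^+ j) / 2], both
     halves being of order [2^-1 ^+ j]. *)
  apply: (@le_trans _ _ (\int[P]_s (2 ^+ j / 2 * D j s ^+ 2 + 2^-1 ^+ j / 2))).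
    apply: le_Rintegral => //.
    - exact: sqint_int.
    - apply: integrable_addR; last exact: integrable_cstR.
      by apply: integrable_mulR; have [] := sD j.
    move=> s _; set x := D j s.
    have h : 2 ^+ j * 2^-1 ^+ j = 1 :> R by rewrite -exprMn mulfV// expr1n.
    have a0 : 0 <= 2 ^+ j :> R by rewrite exprn_ge0.
    have : 0 <= 2 ^+ j * (x - 2^-1 ^+ j) ^+ 2 by rewrite mulr_ge0// sqr_ge0.
    move: h; set A := 2 ^+ j; set B := 2^-1 ^+ j => h.
    have -> : A * (x - B) ^+ 2 = A * x ^+ 2 - 2 * (A * B) * x + (A * B) * B by ring.
    by rewrite h; lra.
  have [_ iD2] := sD j.
  rewrite RintegralD//; [|exact: integrable_mulR|exact: integrable_cstR].
  rewrite Rintegral_cst1 RintegralZl//.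
  have := cg j j.+1 (leqnSn j); rewrite /dotP.
  under eq_Rintegral do rewrite -expr2 -real_normK ?num_real//.
  rewrite -/(D j) => H.
  have h : 2 ^+ j * 4^-1 ^+ j = 2^-1 ^+ j :> R.
    by rewrite -exprMn; congr (_ ^+ _); field.
  have a0 : 0 <= 2 ^+ j :> R by rewrite exprn_ge0.
  by have := ler_wpM2l a0 H; rewrite h; lra.
pose SD s := (\sum_(j <oo) (D j s)%:E)%E.
have mSD : measurable_fun setT SD.
  apply: ge0_emeasurable_sum => [j s _ _|j _]; first by rewrite lee_fin normr_ge0.
  exact/measurable_EFinP.
have iSD : P.-integrable setT SD.
  apply/integrableP; split=> //.
  have -> : (\int[P]_s `|SD s| = \int[P]_s SD s)%E.
    apply: eq_integral => s _; rewrite gee0_abs// nneseries_ge0// => j _ _.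
    by rewrite lee_fin normr_ge0.
  rewrite integral_nneseries; [|exact: measurableT|by move=> j; exact/measurable_EFinP|by move=> j s _; rewrite lee_fin normr_ge0].
  apply: (@le_lt_trans _ _ (\sum_(j <oo) (2^-1 ^+ j)%:E)%E).
    apply: lee_nneseries => [j _ _|j _].
      by apply: integral_ge0 => s _; rewrite lee_fin normr_ge0.
    rewrite -(@fineK _ (\int[P]_x _)%E); first by rewrite lee_fin ED.
    exact: (integrable_fin_num measurableT (sqint_int (sD j))).
  apply: (@le_lt_trans _ _ 2%:E); last exact: ltry.
  apply: lime_le; first by apply: is_cvg_nneseries => j _ _; rewrite lee_fin exprn_ge0// invr_ge0.
  apply: nearW => n; rewrite sumEFin lee_fin.
  have h0 : 0 < 2^-1 :> R by rewrite invr_gt0.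
  have h1 : `|2^-1| < 1 :> R by rewrite gtr0_norm// invf_lt1 ?ltr1n.
  have := @geometric_le_lim R n 1 2^-1 ler01 h0 h1.
  have -> : 1 * (1 - 2^-1)^-1 = 2 :> R by field.
  apply: le_trans; rewrite le_eqVlt; apply/orP; left; apply/eqP.
  by apply: eq_bigr => i _; rewrite /geometric/= mul1r.
pose A := [set s | SD s \is a fin_num].
have mA : measurable A.
  by rewrite -[A]setTI; exact: emeasurable_fin_num.
have PA : P (~` A) = 0.
  have [N [mN N0 AN]] := integrable_ae measurableT iSD.
  apply/eqP; rewrite eq_le measure_ge0 andbT -N0; apply: le_measure; rewrite ?inE//.
    exact: measurableC.
  by move=> s nAs; apply: AN => /= H; apply: nAs; exact: H.
have cvA s : A s -> cvgn (fun j => g j s).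
  move=> As.
  have : cvgn (series (telescope (fun j => g j s))).
    apply/normed_cvg; apply: (@nnseries_is_cvg _ (fun j => D j s)) => //.
      by move=> j; rewrite normr_ge0.
    by move: As; rewrite /A/= => /fineK; rewrite /SD => <-; exact: ltry.
  rewrite telescopeK => H.
  have -> : (fun j => g j s) = (fun j => (g j s - g 0%N s) + g 0%N s).
    by apply/funext => j; rewrite subrK.
  by apply: is_cvgD => //; exact: is_cvg_cst.
(* Annihilating the sequence off [A] makes it converge everywhere, so that the pointwise limit is
   measurable. *)
pose G j s := g j s * \1_A s.
have cvG s : cvgn (fun j => G j s).
  rewrite /G indicE; case: (boolP (s \in A)) => [/set_mem/cvA cs|_].
    by under eq_fun do rewrite mulr1.
  by under eq_fun do rewrite mulr0; exact: is_cvg_cst.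
pose l s := limn (fun j => G j s).
have Gl s : A s -> g j s @[j --> \oo] --> l s.
  move=> As; have := cvG s; rewrite /l /G indicE mem_set//.
  by under eq_fun do rewrite mulr1.
have ml : measurable_fun setT l.
  apply: (@measurable_fun_cvg _ _ _ _ G) => [j|s _].
    by apply: measurable_funM => //; exact: measurable_indic.
  exact: cvG.
have bnd j : (\int[P]_s ((l s - g j s) ^+ 2)%:E <= (4^-1 ^+ j)%:E)%E.
  have mh m : measurable_fun setT (fun s => ((g m s - g j s) ^+ 2)%:E).
    by apply/measurable_EFinP/measurable_funX; exact: measurable_funB.
  have mh2 : measurable_fun setT (fun s => ((l s - g j s) ^+ 2)%:E).
    by apply/measurable_EFinP/measurable_funX; exact: measurable_funB.
  rewrite (@ge0_negligible_integral _ _ _ P setT (~` A))//; last 2 first.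
    exact: measurableC.
    by move=> s _; rewrite lee_fin sqr_ge0.
  rewrite setTD setCK.
  rewrite (_ : (\int[P]_(s in A) _)%E =
     (\int[P]_(s in A) limn_einf (fun m => ((g m s - g j s) ^+ 2)%:E))%E); last first.
    apply: eq_integral => s /set_mem As; apply/esym.
    have : ((g m s - g j s) ^+ 2)%:E @[m --> \oo] --> ((l s - g j s) ^+ 2)%:E.
      apply: cvg_EFin; first exact: nearW.
      rewrite [X in X --> _](_ : _ = (fun m => (g m s - g j s) * (g m s - g j s)) @ \oo).
        by rewrite expr2; apply: cvgM; apply: cvgB => //; try exact: Gl; exact: cvg_cst.
      by congr (_ @ _).
    by move/cvg_limn_einf_sup => [].
  apply: le_trans (fatou P mA _ _) _.
  - by move=> m; apply: measurable_funTS.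
  - by move=> m s _; rewrite lee_fin sqr_ge0.
  rewrite limn_einf_lim; apply: lime_le; first exact: is_cvg_einfs.
  apply: nearW => n; rewrite /einfs/=.
  (* The infimum over indices at least [n] is evaluated at [maxn n j], because the Cauchy bound
     concerns only indices at least [j]. *)
  apply: (@le_trans _ _ (\int[P]_(s in A) ((g (maxn n j) s - g j s) ^+ 2)%:E)%E).
    by apply: ereal_inf_lbound; exists (maxn n j) => //=; exact: leq_maxl.
  apply: (@le_trans _ _ (\int[P]_s ((g (maxn n j) s - g j s) ^+ 2)%:E)%E).
    by apply: ge0_subset_integral => // s _; rewrite lee_fin sqr_ge0.
  have [_ iD2] := sqint_sub (sg (maxn n j)) (sg j).
  rewrite -(@fineK _ (\int[P]_s _)%E); last exact: (integrable_fin_num measurableT iD2).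
  rewrite lee_fin; apply: le_trans (cg j (maxn n j) (leq_maxr _ _)).
  by rewrite le_eqVlt; apply/orP; left; apply/eqP; apply: eq_Rintegral.
have sl0 j : sqint (fun s => l s - g j s).
  split; first exact: measurable_funB.
  apply: ge0_integrableP.
  - by apply: measurable_funX; exact: measurable_funB.
  - by move=> s; rewrite sqr_ge0.
  - by apply: le_lt_trans (bnd j) _; exact: ltry.
exists l.
  have := sqint_add (sl0 0%N) (sg 0%N).
  by under eq_fun do rewrite subrK.
move=> j; rewrite -lee_fin; apply: le_trans (bnd j).
have [_ iD2] := sl0 j.
rewrite -(@fineK _ (\int[P]_s _)%E); last exact: (integrable_fin_num measurableT iD2).
by rewrite lee_fin le_eqVlt; apply/orP; left; apply/eqP; apply: eq_Rintegral.
Qed.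

End square_integrable.

Lemma le0_half_pow (R : realType) (x K : R) :
  (forall j, x <= K * 2^-1 ^+ j) -> x <= 0.
Proof.
move=> H; rewrite leNgt; apply/negP => x0.
have K0 : 0 < K.
  by have := H 0%N; rewrite expr0 mulr1; exact: lt_le_trans.
pose j := (Num.truncn (K / x)).+1.
have Kj : K < x * j%:R.
  by rewrite mulrC -ltr_pdivrMr//; exact: truncnS_gt.
have := H j; rewrite exprVn ler_pdivlMr ?exprn_gt0// => H2.
have j2 : j%:R <= 2 ^+ j :> R by rewrite -natrX ler_nat ltnW// ltn_expl.
have := ler_wpM2l (ltW x0) j2; lra.
Qed.

(** * Riesz representation of a functional dominated by the standard deviation *)

Section riesz.
Context d (V : measurableType d) (R : realType) (P : probability V R).
Implicit Types u v : V -> R.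
Local Notation dotP := (dotP P).
Local Notation sqint := (sqint P).

Definition mean u : R := \int[P]_s u s.
Definition covP u v : R := dotP u v - mean u * mean v.
Definition varP u : R := covP u u.
Definition sdP u : R := Num.sqrt (varP u).

Lemma mean_addZ (c : R) u v : sqint u -> sqint v ->
  mean (fun s => u s + c * v s) = mean u + c * mean v.
Proof.
move=> su sv; rewrite /mean RintegralD//.
- by rewrite RintegralZl//; exact: sqint_int.
- exact: sqint_int.
- exact: (sqint_int (sqint_scale c sv)).
Qed.

Lemma covPC u v : covP u v = covP v u.
Proof. by rewrite /covP dotPC mulrC. Qed.

Lemma covP_addZl (c : R) u v w : sqint u -> sqint v -> sqint w ->
  covP (fun s => u s + c * v s) w = covP u w + c * covP v w.
Proof.
move=> su sv sw; rewrite /covP mean_addZ// dotPDl ?dotPZl//; last exact: sqint_scale.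
ring.
Qed.

Lemma covP_addZr (c : R) u v w : sqint u -> sqint v -> sqint w ->
  covP w (fun s => u s + c * v s) = covP w u + c * covP w v.
Proof. by move=> *; rewrite covPC covP_addZl// !(covPC w). Qed.

Lemma covPE u v : sqint u -> sqint v ->
  covP u v = dotP (fun s => u s - mean u) (fun s => v s - mean v).
Proof.
move=> su sv.
have s1 := sqint_cst P (mean u); have s2 := sqint_cst P (mean v).
rewrite dotPBl ?dotPBr//; [|exact: sqint_sub..].
have cE (c : R) w : sqint w -> dotP w (fun=> c) = c * mean w.
  move=> sw; rewrite /dotP /mean -RintegralZl//; last exact: sqint_int.
  by apply: eq_Rintegral => s _; rewrite mulrC.
rewrite cE// (dotPC _ (fun=> mean u)) cE// cE//.
have mc c : mean (fun=> c) = c by exact: Rintegral_cst1.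
rewrite mc /covP; ring.
Qed.

Lemma varP_ge0 u : sqint u -> 0 <= varP u.
Proof. by move=> su; rewrite /varP covPE// dotP_ge0. Qed.

Lemma sqr_sdP u : sqint u -> sdP u ^+ 2 = varP u.
Proof. by move=> su; rewrite sqr_sqrtr// varP_ge0. Qed.

Lemma sdP_ge0 u : 0 <= sdP u. Proof. exact: sqrtr_ge0. Qed.

Variables (W : (V -> R) -> Prop) (l : (V -> R) -> R) (rho : R).
Hypotheses (W0 : W (fun=> 0)) (sW : forall u, W u -> sqint u).
Hypothesis WD : forall c u v, W u -> W v -> W (fun s => u s + c * v s).
Hypothesis lD : forall c u v, W u -> W v ->
  l (fun s => u s + c * v s) = l u + c * l v.
Hypotheses (rho0 : 0 <= rho) (l_le : forall u, W u -> `|l u| <= rho * sdP u).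

(** [u] minimises [varP u / 2 - l u] up to [e]; this functional is at least [- rho ^+ 2 / 2]. At an
    exact minimum [covP u v = l v]; at a near one, the quadratic in [s] obtained by moving to
    [u + s v] stays above [- e], and its discriminant bounds the defect. Taking [v = u] bounds the
    deviation of [u]. *)
Lemma riesz_near (e : R) : 0 < e -> exists u, [/\ W u,
  forall v, W v -> (covP u v - l v) ^+ 2 <= 2 * e * varP v &
  sdP u <= rho + Num.sqrt (2 * e)].
Proof.
move=> e0.
pose J u := varP u / 2 - l u.
have Jge u : W u -> - rho ^+ 2 / 2 <= J u.
  move=> Wu; rewrite /J -sqr_sdP; last exact: sW.
  have := l_le Wu; have := ler_norm (l u); have := sqr_ge0 (sdP u - rho).
  by rewrite sqrrB; lra.
pose S := [set J u | u in W].
have hS : has_inf S.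
  split; first by exists (J (fun=> 0)); exists (fun=> 0).
  by exists (- rho ^+ 2 / 2) => _ [u Wu <-]; exact: Jge.
have [_ [u Wu <-] Ju] := inf_adherent e0 hS.
have Jmin v : W v -> J u <= J v + e.
  move=> Wv; have SJ : S (J v) by exists v.
  by have := ge_inf hS.2 SJ; move: Ju; lra.
have Hv v : W v -> (covP u v - l v) ^+ 2 <= 2 * e * varP v.
  move=> Wv; have su := sW Wu; have sv := sW Wv.
  apply: quadratic_ge0; first exact: varP_ge0.
  move=> s; have suv := sqint_add su (sqint_scale s sv).
  have := Jmin _ (WD s Wu Wv); rewrite /J /varP lD//.
  rewrite covP_addZl// !covP_addZr// (covPC v u).
  lra.
exists u; split => //.
have su := sW Wu.
have := Hv u Wu; rewrite -/(varP u) => H.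
have e2 : 0 <= 2 * e by rewrite mulr_ge0// ltW.
have H2 : `|varP u - l u| <= Num.sqrt (2 * e) * sdP u.
  by rewrite /sdP -sqrtrM// -sqrtr_sqr; exact: ler_wsqrtr.
have := ler_norm (varP u - l u); have := ler_norm (l u); have := l_le Wu.
move: H2; rewrite -(sqr_sdP su).
have := sdP_ge0 u; rewrite le_eqVlt => /predU1P[<-|s0].
  by rewrite addr_ge0 ?sqrtr_ge0.
set x := sdP u in s0 *; set y := Num.sqrt _ => h1 h2 h3 h4.
rewrite -(@ler_pM2r _ x)//; move: h1 h2 h3 h4; rewrite expr2; lra.
Qed.

(** The centred near-minimisers form a Cauchy sequence in L2. The limit may lie outside [W], so its
    norm is bounded through the approximants, on which [l] is dominated. *)
Lemma riesz : exists g, [/\ sqint g, mean g = 0,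
  forall u, W u -> dotP u g = l u & dotP g g <= rho ^+ 2].
Proof.
(* For the difference [v] of two near-minimisers of index at least [j], both defects are at most
   [2 * eta j * varP v] in square, whence [varP v <= 8 * eta j], the rate that [L2_complete] asks
   for. *)
pose eta j : R := (4^-1) ^+ j / 8.
have eta0 j : 0 < eta j by rewrite divr_gt0// exprn_gt0// invr_gt0.
have etaS j m : (j <= m)%N -> eta m <= eta j.
  move=> jm; rewrite /eta ler_wpM2r// ler_wiXn2l ?invr_ge0 ?invf_le1 ?ler1n//.
have [u_ H] := choice (fun j => riesz_near (eta0 j)).
pose g j s := u_ j s - mean (u_ j).
have su j : sqint (u_ j) by apply: sW; have [] := H j.
have sg j : sqint (g j) by apply: sqint_sub => //; exact: sqint_cst.
have [f sf fg] : exists2 f, sqint f & forall j,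
    dotP (fun s => f s - g j s) (fun s => f s - g j s) <= (4^-1) ^+ j.
  apply: L2_complete => // j m jm.
  pose v s := u_ m s + (-1) * u_ j s.
  have Wv : W v by apply: WD; [have [] := H m|have [] := H j].
  have sv := sW Wv.
  have -> : (fun s => g m s - g j s) = (fun s => v s - mean v).
    apply/funext => s; rewrite /v mean_addZ// /g; ring.
  rewrite -covPE// -/(varP v).
  have [_ /(_ v Wv) Hm _] := H m; have [_ /(_ v Wv) Hj _] := H j.
  have vE : varP v = covP (u_ m) v - covP (u_ j) v.
    by rewrite /varP {1}/v covP_addZl// mulN1r.
  have := varP_ge0 sv; rewrite le_eqVlt => /predU1P[<-|v0].
    by rewrite exprn_ge0// invr_ge0.
  rewrite -(@ler_pM2r _ (varP v))//.
  have := etaS _ _ jm; have e8 : 4^-1 ^+ j = 8 * eta j by rewrite /eta; field.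
  rewrite e8; move: Hm Hj vE; set x := covP (u_ m) v; set y := covP (u_ j) v.
  set z := l v; set w := varP v => Hm Hj vE em.
  have hm : 2 * eta m * w <= 2 * eta j * w by rewrite ler_pM2r// ler_pM2l.
  have : 0 <= ((x - z) + (y - z)) ^+ 2 by rewrite sqr_ge0.
  have -> : w * w = ((x - z) - (y - z)) ^+ 2 by rewrite vE; ring.
  move: Hm Hj; set X := x - z; set Y := y - z; rewrite !expr2; lra.
have half4 j : 4^-1 ^+ j = 2^-1 ^+ j * 2^-1 ^+ j :> R.
  by rewrite -exprMn; congr (_ ^+ _); field.
have half0 j : 0 <= 2^-1 ^+ j :> R by rewrite exprn_ge0// invr_ge0.
have half1 j : 2^-1 ^+ j <= 1 :> R by rewrite exprn_ile1 ?invr_ge0 ?invf_le1 ?ler1n.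
have quarter j : 4^-1 ^+ j <= 2^-1 ^+ j :> R by rewrite half4 ler_piMr.
have sfg j : sqint (fun s => f s - g j s) by exact: sqint_sub.
have dfg j v : sqint v -> dotP v (fun s => f s - g j s) ^+ 2 <=
    dotP v v * 4^-1 ^+ j.
  move=> sv; apply: le_trans (dotP_cauchy_schwarz sv (sfg j)) _.
  by rewrite ler_wpM2l// dotP_ge0.
have mg j : mean (g j) = 0.
  rewrite /mean /g RintegralB//; [|exact: sqint_int|exact: integrable_cstR].
  by rewrite Rintegral_cst1 subrr.
have one := sqint_cst P 1.
have mf : mean f = 0.
  apply/eqP; rewrite -sqrf_eq0 eq_le sqr_ge0 andbT.
  apply: (@le0_half_pow _ _ 1) => j; rewrite mul1r; apply: le_trans (quarter j).
  have d1 w : dotP (fun=> 1) w = mean w by rewrite dotPC dotP1r.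
  have m1 : mean (fun=> 1) = 1 by exact: Rintegral_cst1.
  by have := dfg j _ one; rewrite dotPBr// !d1 mg subr0 m1 mul1r.
have ulE u : W u -> dotP u f = l u.
  move=> Wu; have sgu := sW Wu.
  apply/eqP; rewrite -subr_eq0 -sqrf_eq0 eq_le sqr_ge0 andbT.
  apply: (@le0_half_pow _ _ (2 * dotP u u + varP u / 2)) => j.
  apply: (@le_trans _ _ ((2 * dotP u u + varP u / 2) * 4^-1 ^+ j)); last first.
    by rewrite ler_wpM2l// addr_ge0// ?mulr_ge0 ?dotP_ge0 ?varP_ge0.
  have [_ /(_ u Wu) Hj _] := H j.
  have := dfg j u sgu; rewrite dotPBr//.
  have -> : dotP u (g j) = covP (u_ j) u.
    rewrite covPC /covP /g dotPBr//; last exact: sqint_cst.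
    congr (_ - _); rewrite /dotP /mean -RintegralZr//.
    exact: sqint_int.
  move: Hj; rewrite /eta; set x := covP _ _; set y := l u; set z := dotP u f.
  set c := 4^-1 ^+ j => h1 h2.
  have : 0 <= ((z - x) - (x - y)) ^+ 2 by rewrite sqr_ge0.
  have -> : z - y = (z - x) + (x - y) by ring.
  by move: h1 h2; set X := z - x; set Y := x - y; rewrite !expr2; lra.
exists f; split => //.
rewrite leNgt; apply/negP => Nrho.
set N := dotP f f in Nrho.
have N0 : 0 < N by apply: le_lt_trans Nrho; exact: sqr_ge0.
(* The limiting form of [(l (u_ j)) ^+ 2 <= rho ^+ 2 * dotP (g j) (g j)], where both [l (u_ j)] and
   the squared norm of [g j] tend to [N]; the errors are of order [2^-1 ^+ j]. *)
suff : N * (N - rho ^+ 2) <= 0 by rewrite pmulr_rle0// subr_le0 leNgt Nrho.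
apply: (@le0_half_pow _ _ (2 * N * (N + 1) + 2 * rho ^+ 2 * (N + 1) + rho ^+ 2)) => j.
have [Wuj _ _] := H j.
have := dfg j f sf; rewrite -/N half4 => h1.
pose e := dotP f (fun s => f s - g j s).
have eN : `|e| <= (N + 1) * 2^-1 ^+ j.
  rewrite -(@ler_pXn2r _ 2)// ?nnegrE ?mulr_ge0 ?addr_ge0 ?(ltW N0)//.
  rewrite real_normK ?num_real//; apply: le_trans h1 _.
  rewrite exprMn [X in _ <= _ * X]expr2 ler_wpM2r ?mulr_ge0//.
  by rewrite sqrrD1; have := sqr_ge0 N; lra.
have e1 : dotP f (g j) = N - e by rewrite /e dotPBr// -/N; ring.
have e2 : dotP f (g j) = l (u_ j).
  rewrite -ulE// /g dotPBr//; last exact: sqint_cst.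
  rewrite (dotPC P f (u_ j)) [X in _ - X](_ : _ = 0) ?subr0//.
  by rewrite /dotP RintegralZr ?sqint_int// -/(mean f) mf mul0r.
have e3 : l (u_ j) ^+ 2 <= rho ^+ 2 * dotP (g j) (g j).
  rewrite -covPE// -/(varP _) -sqr_sdP// -exprMn -[leLHS]real_normK ?num_real//.
  by rewrite lerXn2r ?nnegrE ?mulr_ge0 ?sdP_ge0 ?l_le.
have e4 : dotP (g j) (g j) <= N - 2 * e + 2^-1 ^+ j.
  have := fg j; rewrite (dotPBl sf (sg j) (sfg j)) (dotPBr sf (sg j) sf) (dotPBr sf (sg j) (sg j)) (dotPC P (g j) f) -/N e1.
  by have := quarter j; lra.
have h2 : (N - e) ^+ 2 <= rho ^+ 2 * (N - 2 * e + 2^-1 ^+ j).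
  by rewrite -e1 e2; apply: le_trans e3 _; rewrite ler_wpM2l// sqr_ge0.
have h3 := ler_norm e; have h4 := ler_norm (- e); rewrite normrN in h4.
have r0 := sqr_ge0 rho.
have e5 := sqr_ge0 e.
have h5 : 2 * N * e <= 2 * N * ((N + 1) * 2^-1 ^+ j).
  by rewrite ler_pM2l ?mulr_gt0//; exact: le_trans eN.
have h6 : 2 * rho ^+ 2 * (- e) <= 2 * rho ^+ 2 * ((N + 1) * 2^-1 ^+ j).
  by rewrite ler_wpM2l ?mulr_ge0//; exact: le_trans eN.
move: h2 h5 h6; rewrite sqrrB; set T := 2^-1 ^+ j; lra.
Qed.

End riesz.

(** * Integration against a finite measure with a density *)

Section densities.
Context d (V : measurableType d) (R : realType) (P : probability V R).
Variables (m : {finite_measure set V -> \bar R}) (phi : V -> R).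
Hypothesis iphi : P.-integrable setT (EFin \o phi).
Hypothesis mE : forall A, measurable A -> m A = (\int[P]_(x in A) (phi x)%:E)%E.

Let mphi : measurable_fun setT phi.
Proof. exact/measurable_EFinP/(measurable_int P iphi). Qed.

Let m_dom : m `<< P.
Proof.
apply/null_content_dominatesP => A mA PA0; rewrite mE//.
by apply: null_set_integral => //; apply/measurable_EFinP/measurable_funTS.
Qed.

(** [phi] is not assumed nonnegative: it agrees almost everywhere with the Radon-Nikodym derivative
    of [m], to which the change of variables applies. *)
Lemma ge0_integral_density (f : V -> R) : measurable_fun setT f ->
  (forall x, 0 <= f x) ->
  (\int[m]_x (f x)%:E = \int[P]_x (f x * phi x)%:E)%E.
Proof.
move=> mf f0.
have mEf : measurable_fun setT (EFin \o f) by exact/measurable_EFinP.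
rewrite -(Radon_Nikodym_SigmaFinite.change_of_variables m_dom)//.
have iRN := Radon_Nikodym_SigmaFinite.f_integrable m_dom.
have mRN := measurable_int P iRN.
apply: ae_eq_integral => //.
- by apply: emeasurable_funM.
- by apply/measurable_EFinP; exact: measurable_funM.
have : ae_eq P setT (Radon_Nikodym_SigmaFinite.f m P) (EFin \o phi).
  apply: integral_ae_eq => //; first exact/measurable_EFinP.
  by move=> E _ mE'; rewrite -Radon_Nikodym_SigmaFinite.f_integral// mE.
by apply: filterS => x H _ /=; rewrite H// EFinM.
Qed.

Lemma integrable_density (f : V -> R) : measurable_fun setT f ->
  P.-integrable setT (EFin \o (fun x => f x * phi x)) ->
  m.-integrable setT (EFin \o f).
Proof.
move=> mf ifp; apply/integrableP; split; first exact/measurable_EFinP.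
rewrite (_ : (\int[m]_x _ = \int[m]_x (`|f x|)%:E)%E)//.
rewrite ge0_integral_density//; last exact: measurableT_comp.
apply: integrable_lty => //.
apply: (integrable_le _ _ (integrable_norm ifp)).
  by apply: measurable_funM => //; exact: measurableT_comp.
by move=> x; rewrite /= !normrM normr_id.
Qed.

Lemma Rintegral_density (f : V -> R) : measurable_fun setT f ->
  P.-integrable setT (EFin \o (fun x => f x * phi x)) ->
  \int[m]_x f x = \int[P]_x (f x * phi x).
Proof.
move=> mf ifp.
have iF := integrable_density mf ifp.
have mp : measurable_fun setT f^\+ by exact: measurable_funrpos.
have mn : measurable_fun setT f^\- by exact: measurable_funrneg.
have fE s : f s = f^\+ s - f^\- s by rewrite -[in LHS](funrposBneg f).
have bnd (g : V -> R) : measurable_fun setT g -> (forall s, 0 <= g s <= `|f s|) ->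
    P.-integrable setT (EFin \o (fun x => g x * phi x)).
  move=> mg gf; apply: (integrable_le _ _ (integrable_norm ifp)).
    exact: measurable_funM.
  move=> x; have /andP[g0 gle] := gf x.
  by rewrite /= !normrM (ger0_norm g0) ler_wpM2r.
have ip : P.-integrable setT (EFin \o (fun x => f^\+ x * phi x)).
  apply: bnd => // s; rewrite funrpos_ge0/= /funrpos.
  by rewrite ge_max ler_norm normr_ge0.
have im : P.-integrable setT (EFin \o (fun x => f^\- x * phi x)).
  apply: bnd => // s; rewrite funrneg_ge0/= /funrneg.
  by rewrite ge_max -normrN ler_norm normr_ge0.
under eq_Rintegral do rewrite fE.
under [RHS]eq_Rintegral do rewrite fE mulrBl.
rewrite RintegralB//; last 2 first.
- exact: integrable_funrpos.
- exact: integrable_funrneg.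
by rewrite RintegralB// /Rintegral !ge0_integral_density.
Qed.

End densities.

(** * Integrals against charges through their Jordan parts *)

Section charge_integrals.
Context d (V : measurableType d) (R : realType).
Implicit Types (G : charge V R) (f : V -> R).

Let mHP G : measurable (hahn_pos G). Proof. by have [[]] := hahnP G. Qed.
Let mHN G : measurable (hahn_neg G). Proof. by have [_ []] := hahnP G. Qed.

Definition tv_integrable G f := measurable_fun setT f /\
  (\int[Defs.total_variation G]_x (`|f x|)%:E < +oo)%E.

Lemma tv_integralE G f : measurable_fun setT f ->
  (\int[Defs.total_variation G]_x (`|f x|)%:E =
   \int[jordan_pos (hahnP G)]_x (`|f x|)%:E +
   \int[jordan_neg (hahnP G)]_x (`|f x|)%:E)%E.
Proof.
move=> mf; rewrite -ge0_integral_measure_add//.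
- by apply: eq_measure_integral => A mA _; apply/esym; exact: measure_addE.
- by apply/measurable_EFinP; exact: measurableT_comp.
Qed.

Lemma tv_integrable_pos G f : tv_integrable G f ->
  (jordan_pos (hahnP G)).-integrable setT (EFin \o f).
Proof.
move=> [mf]; rewrite tv_integralE// => H; apply/integrableP.
split; first exact/measurable_EFinP.
by apply: le_lt_trans H; rewrite leeDl// integral_ge0.
Qed.

Lemma tv_integrable_neg G f : tv_integrable G f ->
  (jordan_neg (hahnP G)).-integrable setT (EFin \o f).
Proof.
move=> [mf]; rewrite tv_integralE// => H; apply/integrableP.
split; first exact/measurable_EFinP.
by apply: le_lt_trans H; rewrite leeDr// integral_ge0.
Qed.

Lemma tv_integrableP G f : measurable_fun setT f ->
  (jordan_pos (hahnP G)).-integrable setT (EFin \o f) ->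
  (jordan_neg (hahnP G)).-integrable setT (EFin \o f) -> tv_integrable G f.
Proof.
move=> mf /integrableP[_ ip] /integrableP[_ im]; split=> //.
by rewrite tv_integralE//; apply: lte_add_pinfty.
Qed.

Lemma tv_integrable0 G : tv_integrable G (fun=> 0).
Proof.
split=> //; under eq_integral do rewrite normr0.
by rewrite integral0.
Qed.

Lemma tv_integrable_addZ G (c : R) f g : tv_integrable G f -> tv_integrable G g ->
  tv_integrable G (fun s => f s + c * g s).
Proof.
move=> Gf Gg; apply: tv_integrableP.
- by apply: measurable_funD; [case: Gf|apply: measurable_funM => //; case: Gg].
- apply: integrable_addR; first exact: tv_integrable_pos.
  by apply: integrable_mulR; exact: tv_integrable_pos.
- apply: integrable_addR; first exact: tv_integrable_neg.
  by apply: integrable_mulR; exact: tv_integrable_neg.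
Qed.

Lemma charge_integral_addZ G (c : R) f g : tv_integrable G f -> tv_integrable G g ->
  charge_integral G (fun s => f s + c * g s) =
  charge_integral G f + c * charge_integral G g.
Proof.
move=> Gf Gg; rewrite /charge_integral.
have pf := tv_integrable_pos Gf; have nf := tv_integrable_neg Gf.
have pg := tv_integrable_pos Gg; have ng := tv_integrable_neg Gg.
rewrite !RintegralD//; try exact: integrable_mulR.
by rewrite !RintegralZl//; ring.
Qed.

Lemma jordan_posE' G A : measurable A ->
  jordan_pos (hahnP G) A = G (A `&` hahn_pos G).
Proof. by move=> mA; rewrite jordan_posE cjordan_posE /crestr0 mem_set. Qed.

Lemma jordan_negE' G A : measurable A ->
  jordan_neg (hahnP G) A = (- G (A `&` hahn_neg G))%E.
Proof. by move=> mA; rewrite jordan_negE cjordan_negE /crestr0 mem_set. Qed.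

(** The Jordan parts have densities [g] on the positive Hahn set and [- g] on the negative one;
    these sets partition the space, so the two integrals recombine. *)
Lemma charge_density G (P : probability V R) (g : V -> R) f :
  P.-integrable setT (EFin \o g) ->
  (forall A, measurable A -> G A = (\int[P]_(x in A) (g x)%:E)%E) ->
  measurable_fun setT f ->
  P.-integrable setT (EFin \o (fun x => f x * g x)) ->
  tv_integrable G f /\ charge_integral G f = \int[P]_x (f x * g x).
Proof.
move=> ig GE mf ifg.
have mg : measurable_fun setT g by exact/measurable_EFinP/(measurable_int P ig).
have restr (D : set V) (u : V -> R) : measurable D ->
    P.-integrable setT (EFin \o u) ->
    P.-integrable setT (EFin \o (fun x => u x * \1_D x)).
  move=> mD iu; apply: (integrable_le _ _ (integrable_norm iu)).
    apply: measurable_funM; last exact: measurable_indic.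
    exact/measurable_EFinP/(measurable_int P iu).
  move=> x /=; rewrite normrM ler_piMr// indicE.
  by case: (x \in D); rewrite ?normr1 ?normr0.
have intr (D A : set V) : measurable D -> measurable A ->
    (\int[P]_(x in A `&` D) (g x)%:E = \int[P]_(x in A) (g x * \1_D x)%:E)%E.
  move=> mD mA; rewrite integral_mkcondr; apply: eq_integral => x _.
  by rewrite restrict_EFin /= patchE indicE; case: (x \in D); rewrite ?mulr1 ?mulr0.
have posE A : measurable A ->
    jordan_pos (hahnP G) A = (\int[P]_(x in A) (g x * \1_(hahn_pos G) x)%:E)%E.
  by move=> mA; rewrite jordan_posE'// GE ?intr//; exact: measurableI.
have negE A : measurable A ->
    jordan_neg (hahnP G) A = (\int[P]_(x in A) (-1 * (g x * \1_(hahn_neg G) x))%:E)%E.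
  move=> mA; rewrite jordan_negE'// GE ?intr//; last exact: measurableI.
  under [RHS]eq_integral do rewrite EFinM.
  rewrite integralZl ?mulN1e//.
  by apply: (integrableS measurableT) => //; exact: restr.
have ip := restr _ _ (mHP G) ig.
have im := integrable_mulR (-1) (restr _ _ (mHN G) ig).
have ifp : P.-integrable setT (EFin \o (fun x => f x * (g x * \1_(hahn_pos G) x))).
  by have := restr _ _ (mHP G) ifg; under eq_fun do rewrite -mulrA.
have ifm : P.-integrable setT
    (EFin \o (fun x => f x * (-1 * (g x * \1_(hahn_neg G) x)))).
  have := integrable_mulR (-1) (restr _ _ (mHN G) ifg).
  by under eq_fun do rewrite -mulrA mulrCA.
split.
  apply: tv_integrableP => //.
    exact: integrable_density ip posE _ mf ifp.
  exact: integrable_density im negE _ mf ifm.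
rewrite /charge_integral (Rintegral_density ip posE)// (Rintegral_density im negE)//.
rewrite -RintegralB//; apply: eq_Rintegral => x _.
rewrite !indicE; have [_ _ PN PN0] := hahnP G.
have : (hahn_pos G `|` hahn_neg G) x by rewrite PN.
have : ~ (hahn_pos G `&` hahn_neg G) x by rewrite PN0.
move=> nI [] Hx.
- by rewrite mem_set// memNset; [rewrite /= mulr1 !mulr0 subr0|move=> Hn; apply: nI].
- by rewrite memNset ?mem_set//; [rewrite /= mulr1 !mulr0 sub0r mulN1r mulrN opprK|move=> Hp; apply: nI].
Qed.

(** The Hahn sets of [G] bear no relation to [Q1] and [Q2] separately. Moving negative parts across
    gives an equality of measures, [Q1 + c G^- = Q2 + c G^+], which can be integrated. *)
Lemma charge_integral_diff G (c : R) (Q1 Q2 : probability V R) f : 0 <= c ->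
  (forall A, measurable A -> (Q1 A - Q2 A = c%:E * G A)%E) ->
  tv_integrable G f ->
  Q1.-integrable setT (EFin \o f) -> Q2.-integrable setT (EFin \o f) ->
  \int[Q1]_x f x - \int[Q2]_x f x = c * charge_integral G f.
Proof.
move=> c0 QG Gf i1 i2.
have mf : measurable_fun setT f by case: Gf.
pose J1 : {measure set V -> \bar R} := mscale (NngNum c0) (jordan_pos (hahnP G)).
pose J2 : {measure set V -> \bar R} := mscale (NngNum c0) (jordan_neg (hahnP G)).
have scaleE (m : {measure set V -> \bar R}) : m.-integrable setT (EFin \o f) ->
    (mscale (NngNum c0) m).-integrable setT (EFin \o f) /\
    \int[mscale (NngNum c0) m]_x f x = c * \int[m]_x f x.
  move=> im.
  have ge0E (g : V -> R) : measurable_fun setT g -> (forall x, 0 <= g x) ->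
      (\int[mscale (NngNum c0) m]_x (g x)%:E = c%:E * \int[m]_x (g x)%:E)%E.
    move=> mg g0; rewrite ge0_integral_mscale//.
      exact/measurable_EFinP.
    by move=> x _; rewrite lee_fin.
  have im' : (mscale (NngNum c0) m).-integrable setT (EFin \o f).
    apply/integrableP; split; first exact/measurable_EFinP.
    rewrite (_ : (\int[_]_x _ =
      \int[mscale (NngNum c0) m]_x (`|f x|)%:E)%E)//.
    rewrite ge0E//; last exact: measurableT_comp.
    apply: lte_mul_pinfty; rewrite ?lee_fin//.
    by have /integrableP[] := im.
  split=> //.
  have fE s : f s = f^\+ s - f^\- s by rewrite -[in LHS](funrposBneg f).
  have ip := integrable_funrpos measurableT im.
  have im2 := integrable_funrneg measurableT im.
  under eq_Rintegral do rewrite fE; under [in RHS]eq_Rintegral do rewrite fE.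
  rewrite !RintegralB//; try by [exact: integrable_funrpos|exact: integrable_funrneg].
  rewrite mulrBr /Rintegral !ge0E//; try by [exact: measurable_funrpos|exact: measurable_funrneg].
  by rewrite !fineM// integrable_fin_num.
have addE (m1 m2 : {measure set V -> \bar R}) :
    m1.-integrable setT (EFin \o f) -> m2.-integrable setT (EFin \o f) ->
    \int[measure_add m1 m2]_x f x = \int[m1]_x f x + \int[m2]_x f x.
  move=> j1 j2; rewrite /Rintegral integral_measure_add// fineD//.
  - exact: (integrable_fin_num measurableT j1).
  - exact: (integrable_fin_num measurableT j2).
have [j1 J1E] := scaleE _ (tv_integrable_pos Gf).
have [j2 J2E] := scaleE _ (tv_integrable_neg Gf).
suff : \int[Q1]_x f x + \int[J2]_x f x = \int[Q2]_x f x + \int[J1]_x f x.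
  by rewrite J1E J2E /charge_integral; lra.
rewrite -!addE//; rewrite /Rintegral; congr fine.
apply: eq_measure_integral => A mA _.
transitivity (Q1 A + J2 A)%E; first exact: measure_addE.
transitivity (Q2 A + J1 A)%E; last by apply/esym; exact: measure_addE.
rewrite /J1 /J2 /mscale/=.
have GE : G A = (jordan_pos (hahnP G) A - jordan_neg (hahnP G) A)%E.
  by rewrite (jordan_decomp (hahnP G) mA) /cadd/= cscaleN1.
have := QG A mA; rewrite GE.
pose p := jordan_pos (hahnP G) A; pose n := jordan_neg (hahnP G) A.
have fp : p \is a fin_num by exact: fin_num_measure.
have fn : n \is a fin_num by exact: fin_num_measure.
have f1 : Q1 A \is a fin_num by exact: fin_num_measure.
have f2 : Q2 A \is a fin_num by exact: fin_num_measure.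
rewrite -/p -/n => H.
suff : (Q1 A + c%:E * n = Q2 A + c%:E * p)%E by [].
move: H.
rewrite -(fineK fp) -(fineK fn) -(fineK f1) -(fineK f2).
rewrite -!EFinN -!EFinD -!EFinM => -[H]; congr EFin; lra.
Qed.

End charge_integrals.

Section charge_of_difference.
Context d (V : measurableType d) (R : realType).

Lemma integrable_le_measure (m Q : {measure set V -> \bar R}) (c : R) (f : V -> R) :
  0 <= c -> (forall A, measurable A -> (m A <= c%:E * Q A)%E) ->
  Q.-integrable setT (EFin \o f) -> m.-integrable setT (EFin \o f).
Proof.
move=> c0 mQ /integrableP[mf iF]; apply/integrableP; split=> //.
have ma : measurable_fun setT (fun x => `|(EFin \o f) x|%E) by exact: measurableT_comp.
apply: (@le_lt_trans _ _ (\int[mscale (NngNum c0) Q]_x `|(EFin \o f) x|)%E).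
  by apply: ge0_le_measure_integral => //.
rewrite ge0_integral_mscale//.
by apply: lte_mul_pinfty; rewrite ?lee_fin.
Qed.

(** The Jordan parts of [G] are dominated by [c * Q1] and [c * Q2]. *)
Lemma tv_integrable_diff (G : charge V R) (c : R) (Q1 Q2 : probability V R) (f : V -> R) :
  0 <= c -> (forall A, measurable A -> G A = (c%:E * (Q1 A - Q2 A))%E) ->
  Q1.-integrable setT (EFin \o f) -> Q2.-integrable setT (EFin \o f) ->
  tv_integrable G f.
Proof.
move=> c0 GE i1 i2.
have mf : measurable_fun setT f by exact/measurable_EFinP/(measurable_int Q1 i1).
have [[mP _] [mN _] _ _] := hahnP G.
have bnd A : measurable A -> (G A <= c%:E * Q1 A)%E /\ (- G A <= c%:E * Q2 A)%E.
  move=> mA; rewrite GE//.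
  have f1 : Q1 A \is a fin_num by exact: fin_num_measure.
  have f2 : Q2 A \is a fin_num by exact: fin_num_measure.
  have g1 : 0 <= fine (Q1 A) by exact/fine_ge0/measure_ge0.
  have g2 : 0 <= fine (Q2 A) by exact/fine_ge0/measure_ge0.
  rewrite -(fineK f1) -(fineK f2) -!EFinN -!EFinD -!EFinM !lee_fin.
  by split; [have := mulr_ge0 c0 g2|have := mulr_ge0 c0 g1]; lra.
have mono (Q : probability V R) A D : measurable A -> measurable D ->
    (c%:E * Q (A `&` D) <= c%:E * Q A)%E.
  move=> mA mD; apply: lee_wpmul2l; first by rewrite lee_fin.
  by apply: le_measure; rewrite ?inE//; exact: measurableI.
apply: tv_integrableP => //.
- apply: (integrable_le_measure c0 _ i1) => A mA.
  apply: (@le_trans _ _ (G (A `&` hahn_pos G))%E).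
    by rewrite le_eqVlt; apply/orP; left; apply/eqP; exact: jordan_posE'.
  apply: le_trans (mono Q1 A _ mA mP).
  by have [] := bnd (A `&` hahn_pos G) (measurableI _ _ mA mP).
- apply: (integrable_le_measure c0 _ i2) => A mA.
  apply: (@le_trans _ _ (- G (A `&` hahn_neg G))%E).
    by rewrite le_eqVlt; apply/orP; left; apply/eqP; exact: jordan_negE'.
  apply: le_trans (mono Q2 A _ mA mN).
  by have [] := bnd (A `&` hahn_neg G) (measurableI _ _ mA mN).
Qed.

End charge_of_difference.

(** * The rate function as half a squared L2 norm *)

Section rate_function.
Context d (V : measurableType d) (R : realType) (P : probability V R).

Lemma sqint_density_integral (G : charge V R) (g u : V -> R) : sqint P g ->
  (forall A, measurable A -> G A = (\int[P]_(x in A) (g x)%:E)%E) ->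
  sqint P u -> tv_integrable G u /\ charge_integral G u = dotP P u g.
Proof.
move=> sg GE su; apply: charge_density => //; first exact: sqint_int.
  by case: su.
exact: sqint_mul.
Qed.

(** Cauchy-Schwarz for the density. Total mass zero makes the density centred, so [u] can be centred
    as well and its variance replaces its second moment. *)
Lemma rho0sq_le (G : charge V R) (r : R) (u : V -> R) : G setT = 0%E ->
  (rho0sq P G <= r%:E)%E -> sqint P u ->
  charge_integral G u ^+ 2 <= 2 * r * varP P u.
Proof.
move=> G0; rewrite /rho0sq; case: ifPn => // /asboolP GP Hr su.
pose g x := fine (Radon_Nikodym G P x).
have gE x : (g x)%:E = Radon_Nikodym G P x.
  by rewrite /g fineK//; exact: Radon_Nikodym_fin_num.
have iRN := Radon_Nikodym_integrable GP.
have mg : measurable_fun setT g.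
  by apply: measurableT_comp => //; exact: (measurable_int P iRN).
have g2E : (\int[P]_x (g x ^+ 2)%:E <= (2 * r)%:E)%E.
  have -> : (\int[P]_x (g x ^+ 2)%:E = \int[P]_x (Radon_Nikodym G P x ^+ 2))%E.
    by apply: eq_integral => x _; rewrite -gE EFin_expe.
  rewrite -(@lee_pmul2l _ (2^-1)%:E)// ?lte_fin ?invr_gt0//.
  by rewrite -EFinM mulrA mulVf ?pnatr_eq0// mul1r.
have sg : sqint P g.
  split=> //; apply: ge0_integrableP.
  - exact: measurable_funX.
  - by move=> x; rewrite sqr_ge0.
  - by apply: le_lt_trans g2E _; rewrite ltry.
have GE A : measurable A -> G A = (\int[P]_(x in A) (g x)%:E)%E.
  by move=> mA; rewrite (Radon_Nikodym_integral GP mA); apply: eq_integral.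
have mg0 : mean P g = 0 by rewrite /mean /Rintegral -GE// G0.
have gg : dotP P g g <= 2 * r.
  rewrite -lee_fin; apply: le_trans g2E; rewrite /dotP /Rintegral fineK.
    by under eq_integral do rewrite -expr2.
  exact: (integrable_fin_num measurableT (sqint_mul sg sg)).
have [_ ->] := sqint_density_integral sg GE su.
have sc := sqint_cst P (mean P u).
have scu := sqint_sub su sc.
have -> : dotP P u g = dotP P (fun s => u s - mean P u) g.
  rewrite dotPBl// [X in _ - X](_ : _ = 0) ?subr0//.
  by rewrite /dotP RintegralZl ?sqint_int// -/(mean P g) mg0 mulr0.
apply: le_trans (dotP_cauchy_schwarz scu sg) _.
by rewrite -covPE// -/(varP P u) mulrC ler_wpM2r// varP_ge0.
Qed.

Lemma charge_of_density (g : V -> R) : sqint P g -> mean P g = 0 ->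
  exists G : charge V R, [/\ G setT = 0%E,
    forall u, sqint P u -> tv_integrable G u /\ charge_integral G u = dotP P u g &
    (rho0sq P G = (dotP P g g / 2)%:E)%E].
Proof.
move=> sg g0; have ig := sqint_int sg.
pose G : charge V R := induced_charge ig.
have GE A : measurable A -> G A = (\int[P]_(x in A) (g x)%:E)%E by [].
exists G; split.
- rewrite GE// -(@fineK _ (\int[P]_x _)%E); first by congr EFin.
  exact: (integrable_fin_num measurableT ig).
- by move=> u su; exact: sqint_density_integral.
have GP : G `<< P.
  apply/null_content_dominatesP => A mA PA0; rewrite GE//.
  apply: null_set_integral => //; apply/measurable_EFinP/measurable_funTS.
  by case: sg.
rewrite /rho0sq asboolT// mulrC EFinM; congr (_ * _)%E.
have iRN := Radon_Nikodym_integrable GP.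
have -> : (\int[P]_x (Radon_Nikodym G P x ^+ 2) = \int[P]_x (g x * g x)%:E)%E.
  apply: ae_eq_integral => //.
  - under eq_fun do rewrite expe2.
    by apply: emeasurable_funM; exact: (measurable_int P iRN).
  - exact/(measurable_int P (sqint_mul sg sg)).
  have : ae_eq P setT (Radon_Nikodym G P) (EFin \o g).
    apply: integral_ae_eq => //; first exact: (measurable_int P ig).
    by move=> E _ mE; rewrite -Radon_Nikodym_integral// GE.
  by apply: filterS => x H _ /=; rewrite H// EFinM expe2.
rewrite /dotP /Rintegral fineK//.
exact: (integrable_fin_num measurableT (sqint_mul sg sg)).
Qed.

End rate_function.

Section tau_topology.
Context d (V : measurableType d) (R : realType) (Sigma : set (V -> R)).

(** The topology is a supremum of initial topologies, so convergence is tested on one function of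
    [Sigma] at a time. *)
Lemma tau_cvgP (F : set_system (tau_space Sigma)) (G : tau_space Sigma) : Filter F ->
  (forall f, Sigma f ->
     (fun H : tau_space Sigma => charge_integral (tau_val H) f) @ F -->
     charge_integral (tau_val G) f) -> F --> G.
Proof.
move=> FF H; apply/cvg_sup => f A.
rewrite nbhsE => -[B [[U oU <-] BG] BA].
have fS : Sigma (set_val f) by exact: (set_mem (valP f)).
have FU := H _ fS U (open_nbhs_nbhs (conj oU BG)).
rewrite nbhs_filterE; apply: (@filterS _ F FF _ A _ FU) => x Ux; exact: BA.
Qed.

Lemma tau_mk (G : charge V R) : Lambda0 Sigma G ->
  exists H : tau_space Sigma, tau_val H = G.
Proof. by move=> LG; exists (SigSub (mem_set LG)). Qed.

Lemma tau_valP (G : tau_space Sigma) : Lambda0 Sigma (tau_val G).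
Proof. exact: (set_mem (valP (G : set_type (Lambda0 Sigma)))). Qed.

End tau_topology.

Section linear_span.
Context (V : Type) (R : realType) (Sigma : set (V -> R)).

(** The inductive form lets a property pass from [Sigma] to its span by checking [u + c v] alone, as
    [lspan_closed] records. *)
Inductive lspan : (V -> R) -> Prop :=
| lspan0 : lspan (fun=> 0)
| lspan_cons c f u : lspan u -> Sigma f -> lspan (fun s => u s + c * f s).

Lemma lspan_addZ c u v : lspan u -> lspan v -> lspan (fun s => u s + c * v s).
Proof.
move=> su; elim=> [|b f w sw IH Sf].
  by under eq_fun do rewrite mulr0 addr0.
have -> : (fun s => u s + c * (w s + b * f s)) =
    (fun s => (u s + c * w s) + c * b * f s) by apply/funext => s; ring.
exact: lspan_cons.
Qed.

Lemma lspan_sub f : Sigma f -> lspan f.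
Proof.
move=> Sf; have := lspan_cons 1 lspan0 Sf.
by under eq_fun do rewrite add0r mul1r.
Qed.

Lemma lspan_closed (C : (V -> R) -> Prop) : C (fun=> 0) ->
  (forall f, Sigma f -> C f) ->
  (forall c u v, C u -> C v -> C (fun s => u s + c * v s)) ->
  forall u, lspan u -> C u.
Proof. by move=> C0 CS CD u; elim=> // c f w _ Cw /CS; exact: CD. Qed.

End linear_span.

Section ultra_limits.
Context {R : realType}.

Lemma ultra_bounded_cvg (T : Type) (U : set_system T) (f : T -> R) (M : R) :
  UltraFilter U -> U [set x | `|f x| <= M] -> cvg (f x @[x --> U]).
Proof.
move=> UU UM; have PU : ProperFilter U by exact: ultra_proper.
have FM : (f x @[x --> U]) `[- M, M]%classic.
  apply: (@filterS _ U _ [set x | `|f x| <= M]) => // x /=. by rewrite in_itv/= ler_norml.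
have [p [_ cp]] := segment_compact (fmap_proper_filter f PU) FM.
apply/cvg_ex; exists p; apply/cvgrPdist_lt => e e0.
have [//|H] := in_ultra_setVsetC [set x | `|p - f x| < e] UU.
have nb : nbhs p [set y | `|p - y| < e] by apply/nbhs_ballP; exists e.
have Hc : (f x @[x --> U]) [set y | ~ `|p - y| < e].
  apply: (@filterS _ U _ _ _ _ H) => x /=. by [].

by have [y [/= h1 h2]] := cp _ _ Hc nb.
Qed.

End ultra_limits.

(** * From the topology to finitely many functions *)

Section covering.
Context d (V : measurableType d) (R : realType) (P : probability V R).
Variable Sigma : set (V -> R).
Hypothesis sqS : forall f, Sigma f -> sqint P f.

Lemma lspan_sqint u : lspan Sigma u -> sqint P u.
Proof.
apply: lspan_closed => //; first exact: sqint_cst.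
by move=> c v w sv sw; apply: sqint_add => //; exact: sqint_scale.
Qed.

Lemma Lambda0_tv G u : Lambda0 Sigma G -> lspan Sigma u -> tv_integrable G u.
Proof.
move=> [_ LG]; apply: lspan_closed; first exact: tv_integrable0.
- by move=> f Sf; split; [case: (sqS Sf)|exact: LG].
- by move=> c v w; exact: tv_integrable_addZ.
Qed.

(* Otherwise a limit of the functionals [u |-> int u dG] along an ultrafilter on
   [Om] is bounded by [sqrt (2 r) * sdP]; Riesz represents it by an element of
   the closure of [Om] of rate at most [r]. *)
Lemma covering (Om : set (tau_space Sigma)) (r : R) : 0 <= r ->
  (r%:E < rho0sq_set P (closure Om))%E ->
  exists (us : seq (V -> R)) (eta : R), [/\ 0 < eta,
    forall u, u \in us -> lspan Sigma u &
    forall G, Om G -> exists2 u, u \in us &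
      Num.sqrt (2 * r) * sdP P u + eta < `|charge_integral (tau_val G) u|].
Proof.
move=> r0 rOm; apply: contrapT => nex.
pose rho := Num.sqrt (2 * r).
pose D := [set i : seq (V -> R) * R | 0 < i.2 /\ forall u, u \in i.1 -> lspan Sigma u].
(* Failure of the conclusion says that none of these sets is empty. Concatenating lists and taking
   the smaller margin makes them a filter base. *)
pose B (i : seq (V -> R) * R) := [set G | Om G /\ forall u, u \in i.1 ->
   `|charge_integral (tau_val G) u| <= rho * sdP P u + i.2].
have FF : Filter (filter_from D B).
  apply: filter_from_filter; first by exists ([::], 1).
  move=> [us e] [vs e'] [/= e0 sus] [/= e'0 svs].
  exists (us ++ vs, Num.min e e').
    split; rewrite /= ?lt_min ?e0// => u.
    by rewrite mem_cat => /orP[/sus|/svs].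
  move=> G [/= OG H]; split; split=> //= u uu.
    have := H u; rewrite mem_cat uu => /(_ isT) /le_trans; apply.
    by rewrite lerD2l ge_min lexx.
  have := H u; rewrite mem_cat uu orbT => /(_ isT) /le_trans; apply.
  by rewrite lerD2l ge_min lexx orbT.
have PF : ProperFilter (filter_from D B).
  apply: filter_from_proper => -[us e] [/= e0 sus].
  apply: contrapT => nG; apply: nex; exists us, e; split=> // G OG.
  apply: contrapT => nu; apply: nG; exists G; split=> //= u uu.
  by rewrite leNgt; apply/negP => H; apply: nu; exists u.
have [U [UU FU]] := ultraFilterLemma PF.
have PU : ProperFilter U by exact: ultra_proper.
pose I (u : V -> R) (G : tau_space Sigma) := charge_integral (tau_val G) u.
have UB u e : lspan Sigma u -> 0 < e ->
    U [set G | Om G /\ `|I u G| <= rho * sdP P u + e].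
  move=> su e0; apply: (@filterS _ U _ (B ([:: u], e))).
    by move=> G [OG H]; split=> //; apply: H; rewrite mem_head.
  apply: FU; exists ([:: u], e) => //; split=> //= v.
  by rewrite inE => /eqP ->.
have UOm : U Om.
  by apply: filterS (UB _ _ (lspan0 Sigma) ltr01) => G [].
have Icvg u : lspan Sigma u -> cvg (I u G @[G --> U]).
  move=> su; apply: (@ultra_bounded_cvg _ _ _ _ (rho * sdP P u + 1) UU).
  by apply: filterS (UB _ _ su ltr01) => G [].
pose l u : R := lim (I u G @[G --> U]).
have lE u : lspan Sigma u -> I u G @[G --> U] --> l u by move=> /Icvg.
have lD c u v : lspan Sigma u -> lspan Sigma v ->
    l (fun s => u s + c * v s) = l u + c * l v.
  move=> su sv; apply/cvg_lim => //.
  have -> : I (fun s => u s + c * v s) = (fun G => I u G + c * I v G).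
    apply/funext => G; apply: charge_integral_addZ.
    - exact: Lambda0_tv (tau_valP G) su.
    - exact: Lambda0_tv (tau_valP G) sv.
  by apply: cvgD; [exact: lE|apply: cvgMr; exact: lE].
have l_le u : lspan Sigma u -> `|l u| <= rho * sdP P u.
  move=> su; apply/ler_addgt0Pr => e e0.
  have nl := cvg_norm (lE u su).
  have K := @cvgr_to_le _ U PU R (fun G => `|I u G|) `|l u| (rho * sdP P u + e).
  apply: K; first exact: nl.
  by apply: filterS (UB _ _ su e0) => G [].
have rho0 : 0 <= rho by exact: sqrtr_ge0.
have [g [sg g0 gE gle]] := riesz (lspan0 Sigma) lspan_sqint
  (fun c u v => @lspan_addZ _ _ _ c u v) lD rho0 l_le.
have [G [GT GI Grho]] := charge_of_density sg g0.
have LG : Lambda0 Sigma G.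
  by split=> // f /sqS /GI [[_ +] _].
have [H HG] := tau_mk LG.
have UH : U --> H.
  apply: tau_cvgP => f Sf.
  have sf := lspan_sub Sf.
  have [_ +] := GI _ (lspan_sqint sf); rewrite HG => ->.
  by rewrite gE//; exact: lE.
have clH : closure Om H.
  by move=> A /UH UA; apply: (filter_ex (F := U)); exact: filterI.
move: rOm; rewrite ltNge => /negP; apply.
apply: (@le_trans _ _ (rho0sq P (tau_val H))).
  by apply: ereal_inf_lbound; exists H.
rewrite HG Grho lee_fin ler_pdivrMr// mulrC.
by apply: le_trans gle _; rewrite sqr_sqrtr// mulr_ge0.
Qed.

(** The filter generated by the finite-dimensional neighbourhoods converges to [G] by [tau_cvgP], so
    one of its basic sets is inside [Om]. *)
Lemma interior_nbhs (Om : set (tau_space Sigma)) (G : tau_space Sigma) : Om° G ->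
  exists (fs : seq (V -> R)) (dl : R), [/\ 0 < dl,
    forall f, f \in fs -> Sigma f &
    forall H, (forall f, f \in fs ->
      `|charge_integral (tau_val H) f - charge_integral (tau_val G) f| < dl) -> Om H].
Proof.
move=> OG.
pose D := [set i : seq (V -> R) * R | 0 < i.2 /\ forall u, u \in i.1 -> Sigma u].
pose B (i : seq (V -> R) * R) := [set H : tau_space Sigma | forall f, f \in i.1 ->
   `|charge_integral (tau_val H) f - charge_integral (tau_val G) f| < i.2].
have FF : Filter (filter_from D B).
  apply: filter_from_filter; first by exists ([::], 1).
  move=> [us e] [vs e'] [/= e0 sus] [/= e'0 svs].
  exists (us ++ vs, Num.min e e').
    split; rewrite /= ?lt_min ?e0// => u.
    by rewrite mem_cat => /orP[/sus|/svs].
  move=> H /= HB; split=> u /= uu.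
    have := HB u; rewrite mem_cat uu => /(_ isT) /lt_le_trans; apply.
    by rewrite ge_min lexx.
  have := HB u; rewrite mem_cat uu orbT => /(_ isT) /lt_le_trans; apply.
  by rewrite ge_min lexx orbT.
have FG : filter_from D B --> G.
  apply: tau_cvgP => f Sf; apply/cvgrPdist_lt => e e0.
  exists ([:: f], e) => /=.
    by split=> //= v; rewrite inE => /eqP ->.
  by move=> H /(_ f (mem_head _ _)); rewrite distrC.
have [[fs dl] [/= dl0 Sfs] HB] := FG _ OG.
by exists fs, dl; split.
Qed.

End covering.

(** * The resample as draws from a finite set of indices *)

Section bootstrap.
Context d d' (T : measurableType d) (V : measurableType d') (R : realType).
Hypothesis mpoint : forall s : V, measurable [set s].
Variables (n : nat) (x : n.-tuple V) (n0 : (0 < n)%N).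

Definition avg (f : V -> R) : R := (\sum_(i < n) f (tnth x i)) / n%:R.
Definition covn (f g : V -> R) : R := avg (fun s => (f s - avg f) * (g s - avg g)).

Let nR0 : n%:R != 0 :> R. Proof. by rewrite pnatr_eq0 -lt0n. Qed.

Lemma avg_cst c : avg (fun=> c) = c.
Proof. by rewrite /avg sumr_const card_ord -[X in X / _]mulr_natl mulrAC mulfV// mul1r. Qed.

Lemma avg_add f g : avg (fun s => f s + g s) = avg f + avg g.
Proof. by rewrite /avg big_split/= mulrDl. Qed.

Lemma avg_scale c f : avg (fun s => c * f s) = c * avg f.
Proof. by rewrite /avg -mulr_sumr mulrA. Qed.

Lemma le_avg f g : (forall i, f (tnth x i) <= g (tnth x i)) -> avg f <= avg g.
Proof. by move=> fg; rewrite /avg ler_pM2r ?invr_gt0 ?ltr0n//; exact: ler_sum. Qed.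

Lemma norm_avg f (M : R) : (forall i, `|f (tnth x i)| <= M) -> `|avg f| <= M.
Proof.
move=> fM; rewrite ler_norml; apply/andP; split.
  by rewrite -(avg_cst (- M)); apply: le_avg => i; have := fM i; rewrite ler_norml => /andP[].
by rewrite -[leRHS](avg_cst M); apply: le_avg => i; have := fM i; rewrite ler_norml => /andP[].
Qed.

Lemma avg_centered f : avg (fun s => f s - avg f) = 0.
Proof.
by rewrite (avg_add f (fun=> - avg f)) avg_cst subrr.
Qed.

Lemma covnE f g : covn f g = avg (fun s => f s * g s) - avg f * avg g.
Proof.
have -> : covn f g = avg (fun s => f s * g s + ((- avg f) * g s +
    ((- avg g) * f s + avg f * avg g))).
  by congr avg; apply/funext => s; ring.
rewrite (avg_add (fun s => f s * g s)) (avg_add (fun s => _ * g s)) avg_scale.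
rewrite (avg_add (fun s => _ * f s)) avg_scale avg_cst; ring.
Qed.

(** Position of the first occurrence in the sample, or [n] when [s] is absent; repeated values share
    an index, whose weight is then their frequency. *)
Definition sample_index (s : V) : 'I_n.+1 := inord (index s x).
(** The default of [nth] is the first entry, so that even the index [n] is sent to an entry and
    bounds on the sample hold at every index. *)
Definition sample_value (r : 'I_n.+1) : V := nth (tnth x (Ordinal n0)) x r.

Lemma sample_indexE s : sample_index s = index s x :> nat.
Proof. by rewrite inordK// ltnS -[leqRHS](size_tuple x) index_size. Qed.

Lemma sample_valueK s : s \in x -> sample_value (sample_index s) = s.
Proof. by move=> sx; rewrite /sample_value sample_indexE nth_index. Qed.

Lemma sample_value_tnth r : exists i, sample_value r = tnth x i.
Proof.
have : sample_value r \in x.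
  rewrite /sample_value; have [rn|rn] := ltnP r (size x); first exact: mem_nth.
  by rewrite nth_default// mem_tnth.
by move=> /tnthP[i ->]; exists i.
Qed.

Lemma measurable_sample_index r : measurable (sample_index @^-1` [set r]).
Proof.
have fin (A : set V) : A `<=` [set` (x : seq V)] -> measurable A.
  move=> Ax; rewrite -[A]image_id -bigcup_imset1.
  apply: fin_bigcup_measurable => [|s _]; last exact: mpoint.
  exact: (sub_finite_set Ax (finite_seq _)).
have [rn|rn] := ltnP r n.
  apply: fin => s /= sr; rewrite -index_mem size_tuple -sample_indexE sr.
  exact: rn.
have -> : sample_index @^-1` [set r] = ~` [set` (x : seq V)].
  apply/seteqP; split=> s /=.
    move=> sr; apply/negP; rewrite -index_mem size_tuple -sample_indexE sr -leqNgt.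
    exact: rn.
  move/negP => sx; apply/val_inj => /=; rewrite sample_indexE memNindex//.
  rewrite size_tuple; apply/eqP; rewrite eqn_leq rn.
  by have := ltn_ord r; rewrite ltnS.
exact/measurableC/fin.
Qed.

Local Notation q := (law_of (empirical R x) sample_index).

Lemma boot_sum (f : V -> R) : \sum_r q r * f (sample_value r) = avg f.
Proof.
have := Rintegral_finite_valued (empirical R x) measurable_sample_index
  (fun r => f (sample_value r)).
rewrite Rintegral_empirical//; last first.
  exact: (measurable_fun_finite_valued measurable_sample_index (fun r => f (sample_value r))).
move=> <-; congr (_ / _); apply: eq_bigr => i _.
by rewrite sample_valueK// mem_tnth.
Qed.

Variables (k : nat) (B : probability T R) (Y : 'I_k -> {mfun T >-> V}).
Hypothesis iidY : iid B Y (empirical R x).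

(** The resample has law [empirical R x] without being confined to the sample; it leaves it only on
    the null set [N], off which [E] is compared with [D]. *)
Lemma boot_le (E : set T) (D : pred {ffun 'I_k -> 'I_n.+1}) : measurable E ->
  (forall w, (forall j, Y j w \in x) -> E w -> D [ffun j => sample_index (Y j w)]) ->
  (B E <= (ffprob q D)%:E)%E.
Proof.
move=> mE ED; rewrite -(iid_ffprob measurable_sample_index D iidY (@inj_id _)).
set E' := [set w | _].
have mx : measurable [set` (x : seq V)].
  rewrite -[X in measurable X]image_id -bigcup_imset1.
  apply: fin_bigcup_measurable => [|s _]; last exact: mpoint.
  exact: finite_seq.
pose N := \bigcup_(j in [set: 'I_k]) (Y j @^-1` (~` [set` (x : seq V)])).
have mYx j : measurable (Y j @^-1` (~` [set` (x : seq V)])).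
  by rewrite -[X in measurable X]setTI; apply: measurable_funP => //; exact: measurableC.
have mN : measurable N by apply: fin_bigcup_measurable.
have BYx j : B (Y j @^-1` (~` [set` (x : seq V)])) = 0%E.
  have [_ lawY] := iidY.
  have := lawY j _ (measurableC mx); rewrite /distribution/= /pushforward => E1.
  etransitivity; first exact: E1.
  etransitivity; first exact: empiricalE.
  rewrite big1 ?mul0e// => i _; rewrite diracE memNset//= => H; apply: H.
  exact: mem_tnth.
have BN : B N = 0%E.
  apply/measure_negligible => //.
  (* Negligibility is stable under unions indexed by [nat]; the indices beyond [k] receive the empty
     set. *)
  pose F (i : nat) := if insub i is Some j then Y j @^-1` (~` [set` (x : seq V)]) else set0.
  have -> : N = \bigcup_i F i.
    apply/seteqP; split=> w [j].
      by move=> _ Hj; exists (j : nat) => //; rewrite /F valK.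
    move=> _; rewrite /F; case: insubP => // u _ _ Hu.
    by exists u.
  apply: negligible_bigcup => i; rewrite /F.
  case: insubP => [u _ _|_]; first by apply/(negligibleP _ (mYx u)); exact: BYx.
  exact: negligible_set0.
have mE' : measurable E' by exact: (measurable_ffun_event measurable_sample_index Y D).
apply: (@le_trans _ _ (B (E' `|` N))).
  apply: le_measure; rewrite ?inE//; first exact: measurableU.
  move=> w Ew; have [H|H] := pselect (forall j, Y j w \in x).
    by left; exact: ED.
  by right; move/existsNP: H => [j Hj]; exists j.
apply: (@le_trans _ _ (B E' + B N)%E); first exact: measureU2.
by rewrite BN adde0.
Qed.


Let q0 r : 0 <= q r. Proof. exact: law_of_ge0. Qed.

Let q1 : \sum_r q r = 1. Proof. exact: (sum_law_of _ measurable_sample_index). Qed.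

Lemma boot_upper (u : V -> R) (a c th kap v : R) : measurable_fun setT u ->
  0 <= a -> 0 <= th -> (forall i, `|a * (u (tnth x i) - avg u)| <= kap) ->
  covn u u <= v ->
  (B [set w | (k%:R * (a * c) <= \sum_(j < k) (u (Y j w) - avg u))%R] <=
   (expR (- (k%:R * a ^+ 2 * (th * c - th ^+ 2 / 2 * v * expR (th * kap)))))%:E)%E.
Proof.
move=> mu a0 th0 uk uv.
pose F r := u (sample_value r) - avg u.
have F0 : \sum_r q r * F r = 0.
  by rewrite (boot_sum (fun s => u s - avg u)) avg_centered.
have Fk r : `|a * F r| <= kap.
  by rewrite /F; have [i ->] := sample_value_tnth r.
have Fv : \sum_r q r * F r ^+ 2 <= v.
  by rewrite (boot_sum (fun s => (u s - avg u) ^+ 2)).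
have := ffprob_mdp_le k c q0 q1 a0 th0 F0 Fk Fv.
rewrite -lee_fin; apply: le_trans; apply: boot_le.
  rewrite [X in measurable X](_ : _ =
    (fun w => \sum_(j < k) (u (Y j w) - avg u)) @^-1` `[k%:R * (a * c), +oo[%classic).
    rewrite -[X in measurable X]setTI.
    have : measurable_fun setT (fun w => \sum_(j < k) (u (Y j w) - avg u)).
      apply: measurable_sum => j; apply: measurable_funD => //.
      exact: (measurableT_comp mu).
    by apply.
  by apply/seteqP; split=> w; rewrite /= in_itv/= andbT.
move=> w wx /= H; apply: le_trans H _; apply: ler_sum => j _.
by rewrite ffunE /F sample_valueK.
Qed.

(** The lower bound is stated as an upper bound on the complementary event, the form that [boot_le]
    yields and that inner probability requires. *)
Lemma boot_lower (J : finType) (u : J -> V -> R) (j0 : J) (a dl U : R) :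
  (forall j, measurable_fun setT (u j)) -> 0 <= a -> 0 < dl -> dl <= 1 -> 1 <= U ->
  (forall j i, `|a * (u j (tnth x i) - avg (u j))| <= dl / (8 * U)) ->
  (forall j, covn (u j) (u j) <= U) ->
  (B [set w | exists j, (k%:R * (a * dl) <
     `|\sum_(l < k) (u j (Y l w) - avg (u j)) - k%:R * (a * covn (u j) (u j0))|)%R] <=
   (1 - (1 - (2 * #|J|)%:R * expR (- (k%:R * a ^+ 2 * (dl ^+ 2 / (32 * U))))) *
     expR (- (k%:R * a ^+ 2 * (covn (u j0) (u j0) / 2 + dl))))%:E)%E.
Proof.
move=> mu a0 dl0 dl1 U1 uk uU.
pose F j r := u j (sample_value r) - avg (u j).
have F0 j : \sum_r q r * F j r = 0.
  by rewrite (boot_sum (fun s => u j s - avg (u j))) avg_centered.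
have Fk j r : `|a * F j r| <= dl / (8 * U).
  by rewrite /F; have [i ->] := sample_value_tnth r.
have Fc i j : \sum_r q r * (F i r * F j r) = covn (u i) (u j).
  by rewrite (boot_sum (fun s => (u i s - avg (u i)) * (u j s - avg (u j)))).
have Fv j : \sum_r q r * F j r ^+ 2 = covn (u j) (u j).
  by rewrite -Fc; apply: eq_bigr => r _; rewrite expr2.
have FU j : \sum_r q r * F j r ^+ 2 <= U by rewrite Fv.
have := ffprob_mdp_ge k j0 q0 q1 a0 dl0 dl1 U1 F0 Fk FU.
rewrite Fv.
under [X in _ <= ffprob _ X -> _]eq_fun do under eq_forallb do rewrite Fc.
set p := (X in X <= _); set D := (X in _ <= ffprob _ X) => H.
apply: (@le_trans _ _ (ffprob q (predC D))%:E); last first.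
  by rewrite lee_fin (ffprobC (predC D) q1) lerD2l lerN2 (eq_ffprob _ (fun i => negbK _)).
apply: boot_le.
  have -> : [set w | exists j, (k%:R * (a * dl) <
     `|\sum_(l < k) (u j (Y l w) - avg (u j)) - k%:R * (a * covn (u j) (u j0))|)%R] =
     \bigcup_(j in [set: J]) ((fun w =>
     `|\sum_(l < k) (u j (Y l w) - avg (u j)) - k%:R * (a * covn (u j) (u j0))|) @^-1`
      `]k%:R * (a * dl), +oo[%classic).
    apply/seteqP; split=> w.
      by move=> [j Hj]; exists j => //=; rewrite in_itv/= Hj.
    by move=> [j _ /=]; rewrite in_itv/= andbT => Hj; exists j.
  apply: fin_bigcup_measurable => [|j _]; first exact: finite_finset.
  rewrite -[X in measurable X]setTI.
  have : measurable_fun setT (fun w =>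
     `|\sum_(l < k) (u j (Y l w) - avg (u j)) - k%:R * (a * covn (u j) (u j0))|).
    apply: measurableT_comp => //; apply: measurable_funB => //.
    apply: measurable_sum => l; apply: measurable_funB => //.
    exact: (measurableT_comp (mu j)).
  by apply.
move=> w wx /= [j Hj]; rewrite negb_forall; apply/existsP; exists j.
rewrite -ltNge; apply: lt_le_trans Hj _; rewrite le_eqVlt; apply/orP; left; apply/eqP.
congr (`|_ - _|); apply: eq_bigr => l _.
by rewrite ffunE /F sample_valueK.
Qed.

End bootstrap.

(** * Events of the sigma-field generated by the integrals *)

Section sigma_field_events.
Context d (V : measurableType d) (R : realType) (Sigma : set (V -> R)).
Hypothesis mS : forall f, Sigma f -> measurable_fun setT f.
Local Notation prob := (probability V R).
Local Notation LS := (Lambda Sigma : set prob).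
Local Notation sF := (sigma_field Sigma : set (set prob)).
Implicit Types (J : prob -> R) (A : set prob).

Lemma lspan_measurable u : lspan Sigma u -> measurable_fun setT u.
Proof.
apply: lspan_closed => // c v w mv mw.
by apply: measurable_funD => //; exact: measurable_funM.
Qed.

Lemma Lambda_integrable (Q : prob) u : LS Q -> lspan Sigma u ->
  Q.-integrable setT (EFin \o u).
Proof.
move=> LQ; apply: (@lspan_closed _ _ _ (fun u => Q.-integrable setT (EFin \o u))).
- exact: (integrable_cstR Q 0).
- move=> f Sf; apply/integrableP; split; first exact/measurable_EFinP/mS.
  exact: (LQ f Sf).
move=> c v w iv iw; apply: integrable_addR => //; exact: integrable_mulR.
Qed.

Lemma sF0 : sF set0.
Proof. by have [] := @smallest_sigma_algebra _ LS (\bigcup_(f in Sigma)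
  preimage_set_system LS (fun Q : prob => \int[Q]_x f x) measurable). Qed.

Lemma sFC A : sF A -> sF (LS `\` A).
Proof.
have [_ H _] := @smallest_sigma_algebra _ LS (\bigcup_(f in Sigma)
  preimage_set_system LS (fun Q : prob => \int[Q]_x f x) measurable).
exact: H.
Qed.

Lemma sFU A A' : sF A -> sF A' -> sF (A `|` A').
Proof.
move=> sA sA'; rewrite -bigcup2E; apply: sigma_algebra_bigcup.
by case=> [//|[//|n]] /=; exact: sF0.
Qed.

Lemma sFT : sF LS.
Proof. by rewrite -[LS]setD0; apply: sFC; exact: sF0. Qed.

Lemma sF_seq (W : eqType) (s : seq W) (A : W -> set prob) :
  (forall u, u \in s -> sF (A u)) ->
  sF [set Q | exists2 u, u \in s & A u Q].
Proof.
elim: s => [|u s IH] sA.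
  rewrite [X in sF X](_ : _ = set0); first exact: sF0.
  by apply/seteqP; split=> Q // -[].
rewrite [X in sF X](_ : _ = A u `|` [set Q | exists2 v, v \in s & A v Q]).
  apply: sFU; first by apply: sA; rewrite mem_head.
  by apply: IH => v vs; apply: sA; rewrite inE vs orbT.
apply/seteqP; split=> Q /=.
  by move=> [v]; rewrite inE => /predU1P[->|vs] ?; [left|right; exists v].
by move=> [H|[v vs H]]; [exists u; rewrite ?mem_head|exists v; rewrite ?inE ?vs ?orbT].
Qed.

(** Measurability is restated by hand because [sigma_field] is a sigma-field on the subset
    [Lambda Sigma] of the probabilities and not on the whole type. *)
Definition sF_measurable J :=
  forall E, measurable E -> sF (LS `&` J @^-1` E).

Lemma eq_sF_measurable J J' : (forall Q, LS Q -> J Q = J' Q) ->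
  sF_measurable J -> sF_measurable J'.
Proof.
move=> JJ' mJ E mE; rewrite [X in sF X](_ : _ = LS `&` J @^-1` E); first exact: mJ.
by apply/seteqP; split=> Q [LQ /=]; rewrite JJ'.
Qed.

Lemma sF_measurable_cst c : sF_measurable (fun=> c).
Proof.
move=> E _; have [Ec|Ec] := pselect (E c).
  by rewrite [X in sF X](_ : _ = LS); [exact: sFT|apply/seteqP; split=> Q // []].
by rewrite [X in sF X](_ : _ = set0); [exact: sF0|apply/seteqP; split=> Q // []].
Qed.

(** The sets whose preimage under the pair lies in the sigma-field form a sigma-algebra containing
    the generators of the product one. *)
Lemma sF_measurable_comp2 (g : R * R -> R) J J' : measurable_fun setT g ->
  sF_measurable J -> sF_measurable J' -> sF_measurable (fun Q => g (J Q, J' Q)).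
Proof.
move=> mg mJ mJ' E mE.
pose JJ Q := (J Q, J' Q).
have sub : @measurable _ (R * R)%type `<=` image_set_system LS JJ sF.
  apply: smallest_sub; first exact/sigma_algebra_image/smallest_sigma_algebra.
  by move=> X [] [Z mZ <-]; rewrite setTI; [exact: mJ|exact: mJ'].
have := sub (g @^-1` E); apply.
by rewrite -[X in measurable X]setTI; exact: mg.
Qed.

Lemma sF_measurable_integral u : lspan Sigma u ->
  sF_measurable (fun Q : prob => \int[Q]_x u x).
Proof.
elim=> [|c f v sv mv Sf].
  apply: eq_sF_measurable (sF_measurable_cst 0) => Q _.
  by rewrite Rintegral_cst1.
have mf : sF_measurable (fun Q : prob => \int[Q]_x f x).
  move=> E mE; apply: sub_sigma_algebra; exists f => //.
  by exists E.
have mg : measurable_fun setT (fun p : R * R => p.1 + c * p.2).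
  by apply: measurable_funD => //; exact: measurable_funM.
apply: eq_sF_measurable (sF_measurable_comp2 mg mv mf) => Q LQ /=.
have iv := Lambda_integrable LQ sv.
have iF := Lambda_integrable LQ (lspan_sub Sf).
by rewrite RintegralD//; [rewrite RintegralZl|exact: integrable_mulR].
Qed.

Lemma sF_dist u (m c : R) : lspan Sigma u ->
  sF [set Q : prob | LS Q /\ c < `|\int[Q]_x u x - m|].
Proof.
move=> su.
have mg : measurable_fun setT (fun y : R => `|y - m|).
  by apply: measurableT_comp => //; exact: measurable_funB.
have := sF_measurable_integral su (E := (fun y : R => `|y - m|) @^-1` `]c, +oo[%classic).
rewrite (_ : _ `&` _ = [set Q : prob | LS Q /\ c < `|\int[Q]_x u x - m|]).
  by apply; rewrite -[X in measurable X]setTI; exact: mg.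
by apply/seteqP; split=> Q /=; rewrite in_itv/= andbT.
Qed.

End sigma_field_events.

Section outer_inner.
Context (R : realType) (U : Type) (D : set U) (F : set (set U)) (Q : set U -> \bar R).

Lemma outer_prob_le B A : F A -> B `<=` A -> (outer_prob F Q B <= Q A)%E.
Proof. by move=> FA BA; apply: ereal_inf_lbound; exists A. Qed.

Lemma inner_prob_ge B A (p : R) : F A -> D `\` B `<=` A -> (Q A <= (1 - p)%:E)%E ->
  (p%:E <= inner_prob D F Q B)%E.
Proof.
move=> FA BA QA; have := le_trans (outer_prob_le FA BA) QA.
rewrite /inner_prob; case: (outer_prob _ _ _) => [y| |].
- by rewrite -EFinB !lee_fin; lra.
- by rewrite leye_eq.
- by rewrite leey.
Qed.

End outer_inner.

(** * Sample events whose failure probability is of the required order *)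

Section high_probability.
Context d d' (T : measurableType d) (V : measurableType d') (R : realType).
Variables (P : probability V R) (Pr : probability T R) (X : nat -> {mfun T >-> V}).
Hypothesis iidX : iid Pr X P.
Variables (a : nat -> R) (h : R -> R) (t : R).
Hypotheses (a_gt0 : forall n, (0 < n)%N -> 0 < a n)
  (h_ge0 : forall s : R, 0 < s -> 0 <= h s)
  (h_incr : forall s u : R, 0 < s -> s <= u -> h s <= h u) (t_gt2 : 2 < t).
Local Notation Sigma := (Theta P t h).

(* [D] is [(eps * C1)^-1] in part (1) and [C1^-1] in part (2). *)
Definition bad_rate (C D : R) (n : nat) : R :=
  C * (n%:R * h (D * a n) + n%:R `^ (1 - t / 2)).

(** Monotonicity of [h] makes rates with different [D] comparable, so that failure probabilities can
    be added at the largest [D]. *)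
Lemma bad_rate_le (C C' D D' : R) n : (0 < n)%N -> 0 <= C -> C <= C' -> 0 < D ->
  D <= D' -> bad_rate C D n <= bad_rate C' D' n.
Proof.
move=> n0 C0 CC D0 DD; have an := a_gt0 n0.
have Dan : 0 < D * a n by rewrite mulr_gt0.
apply: ler_pM => //; first by rewrite addr_ge0 ?powR_ge0// mulr_ge0 ?h_ge0.
rewrite lerD2r ler_wpM2l// h_incr// ler_pM2r//.
Qed.

Lemma bad_rateD (C C' D : R) n : bad_rate C D n + bad_rate C' D n = bad_rate (C + C') D n.
Proof. by rewrite /bad_rate mulrDl. Qed.

(** The failure set is only included in a measurable [A], because events about outer or inner
    probabilities need not be measurable. [n0], [C] and [D] come before [n]. *)
Definition whp (E : forall n, set (n.-tuple V)) := exists (n0 : nat) (C D : R),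
  [/\ 0 < C, 0 < D & forall n, (n0 < n)%N -> exists A : set (n.-tuple V),
     [/\ measurable A, ~` E n `<=` A &
         (sample_law Pr X n A <= (bad_rate C D n)%:E)%E]].

Lemma whp_sub (E E' : forall n, set (n.-tuple V)) m :
  (forall n, (m < n)%N -> E n `<=` E' n) -> whp E -> whp E'.
Proof.
move=> EE' [n0 [C [D [C0 D0 H]]]]; exists (maxn m n0), C, D; split=> // n.
rewrite gtn_max => /andP[mn /H[A [mA EA PA]]]; exists A; split=> //.
by apply: subset_trans EA; apply: subsetC; exact: EE'.
Qed.

Lemma measurable_sample n :
  measurable_fun setT (fun w => [tuple X i w | i < n]).
Proof.
apply/measurable_fun_tnthP => i.
by rewrite (_ : _ \o _ = X i)//; apply/funext => w /=; rewrite tnth_mktuple.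
Qed.

Lemma measurable_sample_preimage n (A : set (n.-tuple V)) : measurable A ->
  measurable ((fun w => [tuple X i w | i < n]) @^-1` A).
Proof. by move=> mA; rewrite -[X in measurable X]setTI; exact: measurable_sample. Qed.

Lemma whpI (E E' : forall n, set (n.-tuple V)) :
  whp E -> whp E' -> whp (fun n => E n `&` E' n).
Proof.
move=> [n0 [C [D [C0 D0 H]]]] [n0' [C' [D' [C'0 D'0 H']]]].
exists (maxn n0 n0'), (C + C'), (Num.max D D').
split; [by rewrite addr_gt0|by rewrite lt_max D0|move=> n].
rewrite gtn_max => /andP[nn nn'].
have n_gt0 : (0 < n)%N by exact: leq_ltn_trans nn.
have [A [mA EA PA]] := H n nn; have [A' [mA' EA' PA']] := H' n nn'.
exists (A `|` A'); split; first exact: measurableU.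
  by rewrite setCI; apply: setUSS.
rewrite -bad_rateD EFinD.
apply: (@le_trans _ _ (sample_law Pr X n A + sample_law Pr X n A')%E).
  rewrite /sample_law /pushforward preimage_setU.
  by apply: measureU2; exact: measurable_sample_preimage.
apply: leeD.
  apply: le_trans PA _; rewrite lee_fin bad_rate_le ?(ltW C0)// le_max lexx//.
apply: le_trans PA' _; rewrite lee_fin bad_rate_le ?(ltW C'0)// le_max lexx orbT//.
Qed.

Lemma whpT (E : forall n, set (n.-tuple V)) : (forall n x, E n x) -> whp E.
Proof.
move=> ET; exists 0%N, 1, 1; split=> // n n0; exists set0; split=> //.
  by move=> x; apply; exact: ET.
rewrite /sample_law /pushforward preimage_set0 measure0 lee_fin.
rewrite /bad_rate mul1r addr_ge0 ?powR_ge0// mulr_ge0// h_ge0//.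
by rewrite mul1r a_gt0.
Qed.

Lemma whp_seq (W : eqType) (s : seq W) (E : W -> forall n, set (n.-tuple V)) :
  (forall u, u \in s -> whp (E u)) ->
  whp (fun n => [set x | forall u, u \in s -> E u n x]).
Proof.
elim: s => [_|u s IH sE]; first exact: whpT.
have H1 := sE u (mem_head _ _).
have H2 : whp (fun n => [set x | forall u, u \in s -> E u n x]).
  by apply: IH => v vs; apply: sE; rewrite inE vs orbT.
apply: (@whp_sub _ _ 0%N) (whpI H1 H2) => n _ x [xu xs] v.
by rewrite inE => /predU1P[->//|]; exact: xs.
Qed.

(** The tail condition of Theta relaxed by two constants, which makes it stable under linear
    combinations. *)
Definition tail_bound (u : V -> R) := measurable_fun setT u /\
  exists N D : R, [/\ 0 < N, 0 < D & forall s : R, 0 < s ->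
    (P [set x | (s^-1 < `|u x|)%R] <= (N * h (D * s))%:E)%E].

Lemma measurable_gt (u : V -> R) (c : R) : measurable_fun setT u ->
  measurable [set x | c < `|u x|].
Proof.
move=> mu; rewrite [X in measurable X](_ : _ = (fun x => `|u x|) @^-1` `]c, +oo[%classic).
  rewrite -[X in measurable X]setTI.
  have : measurable_fun setT (fun x => `|u x|) by exact: measurableT_comp.
  by apply.
by apply/seteqP; split=> x; rewrite /= in_itv/= andbT.
Qed.

Lemma lspan_tail u : lspan Sigma u -> tail_bound u.
Proof.
apply: lspan_closed.
- split=> //; exists 1, 1; split=> // s s0.
  rewrite [X in P X](_ : _ = set0) ?measure0 ?lee_fin ?mul1r ?h_ge0//.
  apply/seteqP; split=> x //=; rewrite normr0 => H.
  by move: s0; rewrite -invr_gt0 => /(lt_trans H); rewrite ltxx.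
- move=> f [mf _ Hf]; split=> //; exists 1, 1; split=> // s s0.
  by rewrite !mul1r; apply: ltW; exact: Hf.
move=> {u} c u v [mu [N [D [N0 D0 Hu]]]] [mv [N' [D' [N'0 D'0 Hv]]]].
have mcv : measurable_fun setT (fun s => c * v s) by exact: measurable_funM.
split; first exact: measurable_funD.
(* Adding 1 keeps the divisor positive when [c = 0]; each of [u] and [c v] is allowed half of
   [s^-1]. *)
pose c1 := `|c| + 1; have c10 : 0 < c1 by rewrite ltr_wpDl.
exists (N + N'), (2 * D + 2 * c1 * D'); split.
- by rewrite addr_gt0.
- by rewrite addr_gt0// !mulr_gt0.
move=> s s0.
have s1 : 0 < 2 * s by rewrite mulr_gt0.
have s2 : 0 < 2 * c1 * s by rewrite !mulr_gt0.
apply: (@le_trans _ _ (P ([set x | ((2 * s)^-1 < `|u x|)%R] `|`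
    [set x | ((2 * c1 * s)^-1 < `|v x|)%R]))).
  apply: le_measure; rewrite ?inE.
  - by apply: measurable_gt; exact: measurable_funD.
  - by apply: measurableU; exact: measurable_gt.
  move=> x /= H; apply: contrapT => /not_orP[/negP + /negP].
  rewrite -!leNgt => Hu' Hv'; move: H; apply/negP; rewrite -leNgt.
  apply: le_trans (ler_normD _ _) _; rewrite normrM.
  have E1 : (2 * s)^-1 = s^-1 / 2 by rewrite invfM mulrC.
  have E2 : (2 * c1 * s)^-1 = s^-1 / 2 / c1.
    by field; rewrite !gt_eqF.
  rewrite E1 in Hu'; rewrite E2 in Hv'.
  have : `|c| * `|v x| <= c1 * (s^-1 / 2 / c1).
    by apply: ler_pM => //; rewrite /c1 lerDl.
  have -> : c1 * (s^-1 / 2 / c1) = s^-1 / 2 by field; rewrite !gt_eqF.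
  by move: Hu'; lra.
apply: le_trans (measureU2 _ (measurable_gt _ mu) (measurable_gt _ mv)) _.
rewrite [X in X%:E]mulrDl EFinD; apply: leeD.
  apply: le_trans (Hu _ s1) _; rewrite lee_fin ler_pM2l//.
  apply: h_incr; first by rewrite !mulr_gt0.
  have : 0 <= c1 * D' * s by rewrite !mulr_ge0// ltW.
  lra.
apply: le_trans (Hv _ s2) _; rewrite lee_fin ler_pM2l//.
apply: h_incr; first by rewrite !mulr_gt0.
have : 0 <= D * s by rewrite mulr_ge0// ltW.
lra.
Qed.

(** Union bound over the [n] observations, with the tail bound taken at [s = a n / kap]; the term
    [n * h (D * a n)] of the rate originates here. *)
Lemma whp_bounded u (kap : R) : lspan Sigma u -> 0 < kap ->
  whp (fun n => [set x | forall i, `|a n * u (tnth x i)| <= kap]).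
Proof.
move=> /lspan_tail[mu [N [D [N0 D0 Hu]]]] kap0.
exists 0%N, N, (D / kap); split=> //; first by rewrite divr_gt0.
move=> n n0; have an := a_gt0 n0.
pose S0 := [set s | kap / a n < `|u s|].
pose A i := [set x : n.-tuple V | kap / a n < `|u (tnth x i)|].
have mA i : measurable (A i).
  rewrite -[X in measurable X]setTI.
  exact: (measurable_tnth i measurableT (measurable_gt (kap / a n) mu)).
exists (\bigcup_(i in [set: 'I_n]) A i); split.
- by apply: fin_bigcup_measurable => // i _; exact: mA.
- move=> x /= /existsNP[i Hi]; exists i => //; rewrite /A/=.
  rewrite ltr_pdivrMr// mulrC.
  by move/negP : Hi; rewrite -ltNge normrM gtr0_norm.
rewrite /sample_law /pushforward.
have -> : (fun w => [tuple X i w | i < n]) @^-1` (\bigcup_(i in [set: 'I_n]) A i) =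
    \big[setU/set0]_(i < n) (X i @^-1` S0).
  rewrite -(bigcup_mkord n (fun i => X i @^-1` S0)).
  apply/seteqP; split=> w.
    by move=> [i _]; rewrite /A/= tnth_mktuple => Hi; exists (nat_of_ord i) => /=.
  move=> [i /= ilt Hi]; exists (Ordinal ilt) => //.
  by rewrite /A/= tnth_mktuple.
apply: (@le_trans _ _ (\sum_(i < n) Pr (X i @^-1` S0))%E).
  apply: (@Boole_inequality _ _ _ Pr (fun i => X i @^-1` S0)) => i _.
  rewrite -[X in measurable X]setTI; apply: measurable_funP => //.
  exact: measurable_gt.
apply: (@le_trans _ _ (\sum_(i < n) (N * h (D / kap * a n))%:E)%E).
  apply: lee_sum => i _; have [_ lawX] := iidX.
  have := lawX i _ (measurable_gt (kap / a n) mu).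
  rewrite /distribution/= /pushforward => E; rewrite [leLHS]E.
  have := Hu (a n / kap) (divr_gt0 an kap0); rewrite invf_div.
  by rewrite mulrA mulrAC.
rewrite sumEFin lee_fin sumr_const card_ord -[leLHS]mulr_natl /bad_rate.
by have := powR_ge0 n%:R (1 - t / 2); move=> /(mulr_ge0 (ltW N0)); lra.
Qed.

(** The one-sided rate is applied to [Y] and [- Y] with moment [p = t / 2 > 1]; it accounts for the
    term [n ^ (1 - t / 2)] of the rate. *)
Lemma whp_lln (Y : V -> R) (dl : R) : measurable_fun setT Y ->
  P.-integrable setT (EFin \o (fun s => `|Y s| `^ (t / 2))) -> 0 < dl ->
  whp (fun n => [set x | `|avg x Y - mean P Y| <= dl]).
Proof.
move=> mY iY dl0.
have t1 : 1 < t / 2 by rewrite ltr_pdivlMr ?mul1r.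
have mYN : measurable_fun setT (fun s => - Y s) by exact: measurableT_comp.
have iYN : P.-integrable setT (EFin \o (fun s => `|- Y s| `^ (t / 2))).
  by under eq_fun do rewrite normrN.
have mYNE : mean P (fun s => - Y s) = - mean P Y.
  rewrite -mulN1r -RintegralZl//; last exact: integrable_powR_gt1 mY t1 iY.
  by apply: eq_Rintegral => s _; rewrite mulN1r.
have [C [n0 [C0 H]]] := lln_upper_rate iidX mY t1 iY dl0.
have [C' [n0' [C'0 H']]] := lln_upper_rate iidX mYN t1 iYN dl0.
exists (maxn n0 n0'), (C + C'), 1; split=> //; first by rewrite addr_gt0.
move=> n; rewrite gtn_max => /andP[nn nn'].
have n_gt0 : (0 < n)%N by exact: leq_ltn_trans nn.
have nR : 0 < n%:R :> R by rewrite ltr0n.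
have mavg : measurable_fun setT (fun x : n.-tuple V => avg x Y - mean P Y).
  apply: measurable_funB => //; apply: measurable_funM => //.
  apply: measurable_sum => i; apply: measurableT_comp => //.
  exact: measurable_tnth.
have mbad : measurable [set x : n.-tuple V | dl < `|avg x Y - mean P Y|].
  rewrite [X in measurable X](_ : _ =
      (fun x => `|avg x Y - mean P Y|) @^-1` `]dl, +oo[%classic).
    rewrite -[X in measurable X]setTI.
    have : measurable_fun setT (fun x : n.-tuple V => `|avg x Y - mean P Y|).
      exact: measurableT_comp.
    by apply.
  by apply/seteqP; split=> x; rewrite /= in_itv/= andbT.
exists [set x : n.-tuple V | dl < `|avg x Y - mean P Y|]; split => //.
  by move=> x /= /negP; rewrite -ltNge.
have mge (Z : V -> R) c : measurable_fun setT Z ->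
    measurable [set w | c <= \sum_(i < n) Z (X i w)].
  move=> mZ; rewrite [X in measurable X](_ : _ =
      (fun w => \sum_(i < n) (Z \o X i) w) @^-1` `[c, +oo[%classic).
    rewrite -[X in measurable X]setTI.
    have : measurable_fun setT (fun w => \sum_(i < n) (Z \o X i) w).
      by apply: measurable_sum => i; exact: (measurableT_comp mZ).
    by apply.
  by apply/seteqP; split=> w; rewrite /= in_itv/= andbT.
pose A1 := [set w | n%:R * (mean P Y + dl) <= \sum_(i < n) Y (X i w)].
pose A2 := [set w | n%:R * (mean P (fun s => - Y s) + dl) <= \sum_(i < n) - Y (X i w)].
have mA1 : measurable A1 := mge Y _ mY.
have mA2 : measurable A2 := mge (fun s => - Y s) _ mYN.
apply: (@le_trans _ _ (Pr (A1 `|` A2))).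
  rewrite /sample_law /pushforward; apply: le_measure; rewrite ?inE.
  - exact: measurable_sample_preimage.
  - exact: measurableU.
  move=> w /=; rewrite /avg.
  under eq_bigr do rewrite tnth_mktuple.
  set S := \sum_(i < n) Y (X i w) => Hw.
  have [H0|H0] := leP 0 (S / n%:R - mean P Y).
    left; rewrite /A1/= -/S; move: Hw; rewrite ger0_norm// => Hw.
    have : dl + mean P Y <= S / n%:R by lra.
    by rewrite ler_pdivlMr//; lra.
  right; rewrite /A2/= sumrN -/S mYNE; move: Hw; rewrite ltr0_norm// => Hw.
  have : S / n%:R <= mean P Y - dl by lra.
  by rewrite ler_pdivrMr//; lra.
apply: (@le_trans _ _ (Pr A1 + Pr A2)%E).
  exact: measureU2.
apply: (@le_trans _ _ ((C * n%:R `^ (1 - t / 2))%:E + (C' * n%:R `^ (1 - t / 2))%:E)%E).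
  by apply: leeD; [exact: H|exact: H'].
rewrite -EFinD lee_fin /bad_rate -mulrDl ler_pM2l ?addr_gt0// lerDr.
by rewrite mulr_ge0// h_ge0// mul1r a_gt0.
Qed.

End high_probability.

(** * Moments of functions in the span *)

Section theta_moments.
Context d' (V : measurableType d') (R : realType) (P : probability V R).
Variables (h : R -> R) (t : R).
Hypothesis t_gt2 : 2 < t.
Local Notation Sigma := (Theta P t h).

Let t0 : 0 < t. Proof. exact: lt_trans t_gt2. Qed.

Definition finite_moment (u : V -> R) := measurable_fun setT u /\
  P.-integrable setT (EFin \o (fun s => `|u s| `^ t)).

Lemma powR_le_add (x y z p : R) : 0 <= x -> 0 <= y -> 0 <= z -> 0 <= p ->
  z <= Num.max x y -> z `^ p <= x `^ p + y `^ p.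
Proof.
move=> x0 y0 z0 p0; rewrite le_max => /orP[zx|zy].
  by apply: ler_wpDr; [exact: powR_ge0|rewrite ge0_ler_powR].
by apply: ler_wpDl; [exact: powR_ge0|rewrite ge0_ler_powR].
Qed.

Lemma measurable_powR_norm (u : V -> R) (p : R) : measurable_fun setT u ->
  measurable_fun setT (fun s => `|u s| `^ p).
Proof.
move=> mu; apply: (measurableT_comp (measurable_powR _)) => //.
exact: measurableT_comp.
Qed.

Lemma lspan_moment u : lspan Sigma u -> finite_moment u.
Proof.
apply: lspan_closed.
- split=> //; under eq_fun do rewrite normr0 powR0 ?gt_eqF//.
  exact: (integrable_cstR P 0).
- move=> f [mf iF _]; split=> //; apply: ge0_integrableP => //.
  exact: measurable_powR_norm.
move=> {u} c u v [mu iu] [mv iv].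
have mcv : measurable_fun setT (fun s => u s + c * v s).
  by apply: measurable_funD => //; exact: measurable_funM.
split=> //.
have H := integrable_mulR (2 `^ t) (integrable_addR iu (integrable_mulR (`|c| `^ t) iv)).
apply: integrable_le H; first exact: measurable_powR_norm.
move=> s; rewrite ger0_norm ?powR_ge0// -powRM// -normrM.
apply: (@le_trans _ _ ((2 * Num.max `|u s| `|c * v s|) `^ t)).
  have m0 : 0 <= 2 * Num.max `|u s| `|c * v s| by rewrite mulr_ge0// le_max normr_ge0.
  rewrite ge0_ler_powR ?nnegrE ?(ltW t0)//.
  rewrite mulr_natl mulr2n; apply: le_trans (ler_normD _ _) _.
  by apply: lerD; rewrite le_max lexx ?orbT.
rewrite powRM//.
rewrite ler_wpM2l ?powR_ge0//; apply: powR_le_add => //; exact: ltW.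
Qed.

Lemma finite_moment_sqint u : finite_moment u -> sqint P u.
Proof.
move=> [mu iu]; split=> //.
have H := integrable_powR_le (ler0n _ 2) (ltW t_gt2) mu iu.
apply: eq_integrable H => // s _ /=.
by rewrite powR_mulrn// real_normK ?num_real.
Qed.

Lemma Theta_sqint f : Sigma f -> sqint P f.
Proof. by move=> Sf; apply/finite_moment_sqint/lspan_moment/lspan_sub. Qed.

Lemma finite_moment_half u : finite_moment u ->
  P.-integrable setT (EFin \o (fun s => `|u s| `^ (t / 2))).
Proof.
move=> [mu iu]; apply: (integrable_powR_le _ _ mu iu).
  by rewrite divr_ge0// ltW.
by rewrite ler_pdivrMr// ler_peMr ?ler1n// ltW.
Qed.

(** The product is at most the square of the larger factor, so its moment of order [t / 2] is
    controlled by moments of order [t]. *)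
Lemma finite_moment_mul u v : finite_moment u -> finite_moment v ->
  P.-integrable setT (EFin \o (fun s => `|u s * v s| `^ (t / 2))).
Proof.
move=> [mu iu] [mv iv]; apply: integrable_le (integrable_addR iu iv).
  by apply: measurable_powR_norm; exact: measurable_funM.
move=> s; rewrite ger0_norm ?powR_ge0// normrM.
set x := `|u s|; set y := `|v s|.
have x0 : 0 <= x := normr_ge0 _; have y0 : 0 <= y := normr_ge0 _.
pose m := Num.max x y; have m0 : 0 <= m by rewrite le_max x0.
apply: (@le_trans _ _ (m `^ t)); last by apply: powR_le_add => //; exact: ltW.
have -> : m `^ t = (m ^+ 2) `^ (t / 2).
  by rewrite -powR_mulrn// -powRrM; congr (_ `^ _); field.
rewrite ge0_ler_powR ?nnegrE ?mulr_ge0 ?exprn_ge0// ?divr_ge0 ?(ltW t0)//.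
by rewrite expr2; apply: ler_pM => //; rewrite le_max lexx ?orbT.
Qed.

End theta_moments.

Section empirical_covariance.
Context d d' (T : measurableType d) (V : measurableType d') (R : realType).
Variables (P : probability V R) (Pr : probability T R) (X : nat -> {mfun T >-> V}).
Hypothesis iidX : iid Pr X P.
Variables (a : nat -> R) (h : R -> R) (t : R).
Hypotheses (a_gt0 : forall n, (0 < n)%N -> 0 < a n)
  (h_ge0 : forall s : R, 0 < s -> 0 <= h s)
  (h_incr : forall s u : R, 0 < s -> s <= u -> h s <= h u) (t_gt2 : 2 < t).
Local Notation Sigma := (Theta P t h).
Local Notation whp := (whp Pr X a h t).

Lemma whp_cov u v (dl : R) : lspan Sigma u -> lspan Sigma v -> 0 < dl ->
  whp (fun n => [set x | `|covn x u v - covP P u v| <= dl]).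
Proof.
move=> su sv dl0.
have mu := lspan_moment t_gt2 su; have mv := lspan_moment t_gt2 sv.
have [mu1 _] := mu; have [mv1 _] := mv.
(* The three laws of large numbers with error [e <= 1] combine to an error of at most
   [e * (1 + (|mean v| + 1) + |mean u|)], that is [e * M]. *)
pose M := `|mean P u| + `|mean P v| + 2.
have M0 : 0 < M by rewrite ltr_wpDl// addr_ge0.
pose e := Num.min 1 (dl / M).
have e0 : 0 < e by rewrite lt_min ltr01 divr_gt0.
have e1 : e <= 1 by rewrite ge_min lexx.
have eM : e * M <= dl by rewrite -ler_pdivlMr// ge_min lexx orbT.
have w1 := whp_lln iidX a_gt0 h_ge0 t_gt2 mu1 (finite_moment_half t_gt2 mu) e0.
have w2 := whp_lln iidX a_gt0 h_ge0 t_gt2 mv1 (finite_moment_half t_gt2 mv) e0.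
have w3 := whp_lln iidX a_gt0 h_ge0 t_gt2 (measurable_funM mu1 mv1)
  (finite_moment_mul t_gt2 mu mv) e0.
have H := whpI a_gt0 h_ge0 h_incr w1 (whpI a_gt0 h_ge0 h_incr w2 w3).
apply: (@whp_sub _ _ _ _ _ _ _ _ _ _ _ _ 0%N) H => n n0 x [/= h1 [h2 h3]].
rewrite covnE// /covP.
have -> : avg x (fun s => u s * v s) - avg x u * avg x v -
    (dotP P u v - mean P u * mean P v) =
  (avg x (fun s => u s * v s) - dotP P u v) -
   ((avg x u - mean P u) * avg x v + mean P u * (avg x v - mean P v)) by ring.
apply: le_trans (ler_normB _ _) _.
have h4 : `|avg x v| <= `|mean P v| + e.
  rewrite -(subrK (mean P v) (avg x v)) addrC.
  by apply: le_trans (ler_normD _ _) _; rewrite lerD2l.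
have h5 : `|(avg x u - mean P u) * avg x v + mean P u * (avg x v - mean P v)| <=
    e * (`|mean P v| + e) + `|mean P u| * e.
  apply: le_trans (ler_normD _ _) _; rewrite (normrM (avg x u - _)) (normrM (mean P u)).
  by apply: lerD; [exact: ler_pM|rewrite ler_wpM2l].
apply: (@le_trans _ _ (e + (e * (`|mean P v| + e) + `|mean P u| * e))).
  by apply: lerD.
apply: le_trans eM; rewrite /M.
have : e * e <= e * 1 by rewrite ler_wpM2l// ltW.
lra.
Qed.

End empirical_covariance.

(** * Passing between exponential bounds and normalised logarithms *)

Section scaled_logarithm.
Context {R : realType}.
Implicit Types (p q : \bar R) (N r : R).

Lemma le_lne p q : (p <= q)%E -> (lne p <= lne q)%E.
Proof.
move=> pq; have [p0|p0] := leP p 0%E; first by rewrite le0_lneNy// leNye.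
by rewrite lee_lne// in_itv/= leey ltW// (lt_le_trans p0 pq).
Qed.

Lemma lne_expR r : lne (expR r)%:E = r%:E.
Proof. by rewrite lne_EFin ?expR_gt0// expRK. Qed.

Lemma scaled_lne_le N r p : 0 < N -> (p <= (expR (- (N * r)))%:E)%E ->
  ((N^-1)%:E * lne p <= (- r)%:E)%E.
Proof.
move=> N0 /le_lne; rewrite lne_expR => H.
apply: le_trans (lee_wpmul2l _ H) _; first by rewrite lee_fin invr_ge0 ltW.
by rewrite -EFinM lee_fin mulrN mulrA mulVf ?mul1r// gt_eqF.
Qed.

Lemma scaled_lne_ge N r p : 0 < N -> ((expR (- (N * r)))%:E <= p)%E ->
  ((- r)%:E <= (N^-1)%:E * lne p)%E.
Proof.
move=> N0 /le_lne; rewrite lne_expR => H.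
apply: le_trans (lee_wpmul2l _ H); last by rewrite lee_fin invr_ge0 ltW.
by rewrite -EFinM lee_fin mulrN mulrA mulVf ?mul1r// gt_eqF.
Qed.

End scaled_logarithm.

Lemma measure_exists_seq_le d (T : measurableType d) (R : realType)
    (m : {measure set T -> \bar R}) (W : eqType) (s : seq W) (E : W -> set T) (M : R) :
  (forall u, u \in s -> measurable (E u) /\ (m (E u) <= M%:E)%E) ->
  measurable [set w | exists2 u, u \in s & E u w] /\
  (m [set w | exists2 u, u \in s & E u w] <= ((size s)%:R * M)%:E)%E.
Proof.
elim: s => [_|u s IH sE].
  rewrite (_ : mkset _ = set0); last by apply/seteqP; split=> w // -[].
  by rewrite measure0 mul0r.
have [mu uM] := sE u (mem_head _ _).
have [|ms sM] := IH; first by move=> v vs; apply: sE; rewrite inE vs orbT.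
have -> : [set w | exists2 v, v \in u :: s & E v w] =
    E u `|` [set w | exists2 v, v \in s & E v w].
  apply/seteqP; split=> w /=.
    by move=> [v]; rewrite inE => /predU1P[->|vs] ?; [left|right; exists v].
  by move=> [H|[v vs H]]; [exists u; rewrite ?mem_head|exists v; rewrite ?inE ?vs ?orbT].
split; first exact: measurableU.
apply: le_trans (measureU2 _ mu ms) _.
by rewrite /= -natr1 mulrDl mul1r addrC EFinD; exact: leeD.
Qed.

(** * Both bounds for the bootstrap, on sample events of high probability *)

Section bootstrap_moderate_deviations.
Context d d' d'' (T : measurableType d) (V : measurableType d') (T' : measurableType d'').
Context (R : realType).
Hypothesis mpoint : forall s : V, measurable [set s].
Variables (P : probability V R) (Pr : probability T R) (X : nat -> {mfun T >-> V}).
Hypothesis iidX : iid Pr X P.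
Variables (k : nat -> nat) (B : forall n, n.-tuple V -> probability T' R).
Variable Xs : forall n, n.-tuple V -> 'I_(k n) -> {mfun T' >-> V}.
Arguments B : clear implicits.
Arguments Xs : clear implicits.
Hypothesis k_gt0 : forall n, (0 < n)%N -> (0 < k n)%N.
Hypothesis iidXs : forall n (x : n.-tuple V), (0 < n)%N -> iid (B n x) (Xs n x) (empirical R x).
Variables (a : nat -> R) (h : R -> R) (t : R).
Hypotheses (a_gt0 : forall n, (0 < n)%N -> 0 < a n)
  (ka_infty : (k n)%:R * a n ^+ 2 @[n --> \oo] --> +oo)
  (h_ge0 : forall s : R, 0 < s -> 0 <= h s)
  (h_incr : forall s u : R, 0 < s -> s <= u -> h s <= h u) (t_gt2 : 2 < t).
Local Notation Sigma := (Theta P t h).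
Local Notation whp := (whp Pr X a h t).
Local Notation speed n := ((k n)%:R * a n ^+ 2).
Local Notation law n x := (empirical_law (B n x) (Xs n x)).

Let mSigma f : Sigma f -> measurable_fun setT f. Proof. by case. Qed.

Let sqS f : Sigma f -> sqint P f. Proof. exact: Theta_sqint. Qed.

Lemma speed_large (M : R) : exists m, forall n, (m < n)%N -> M <= speed n.
Proof.
have /cvgryPge/(_ M)[m _ H] := ka_infty.
by exists m => n mn; apply: H; exact: ltnW.
Qed.

Lemma speed_gt0 n : (0 < n)%N -> 0 < speed n.
Proof. by move=> n0; rewrite mulr_gt0 ?ltr0n ?k_gt0// exprn_gt0// a_gt0. Qed.

Lemma empirical_Lambda n (x : n.-tuple V) : (0 < n)%N ->
  Lambda Sigma (empirical R x).
Proof.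
move=> n0 f Sf; have mf := mSigma Sf.
by rewrite ge0_integral_empirical ?ltry//; exact: measurableT_comp.
Qed.

Lemma varPN u : sqint P u -> varP P (fun s => 0 + -1 * u s) = varP P u.
Proof.
move=> su; have s0 := sqint_cst P 0.
rewrite /varP covP_addZl//; last exact/sqint_add/sqint_scale.
have z w : covP P (fun=> 0) w = 0.
  have m0 : mean P (fun=> 0) = 0 by exact: Rintegral_cst1.
  rewrite /covP m0 mul0r subr0 -[RHS]m0; apply: eq_Rintegral => s _.
  by rewrite mul0r.
by rewrite z covP_addZr// (covPC P u (fun=> 0)) z; ring.
Qed.

Lemma whp_halfspace u (c r r1 : R) : lspan Sigma u -> 0 < c -> 0 <= r -> r < r1 ->
  2 * r1 * varP P u < c ^+ 2 ->
  whp (fun n => [set x : n.-tuple V | (B n x [set w |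
     ((k n)%:R * (a n * c) <= \sum_(j < k n) (u (Xs n x j w) - avg x u))%R] <=
       (expR (- (speed n * r)))%:E)%E]).
Proof.
move=> su c0 r0 rr1 uc.
have r10 : 0 < r1 by exact: le_lt_trans rr1.
have mu : measurable_fun setT u by exact: lspan_measurable su.
(* The variance for which level [c] has Gaussian rate exactly [r1]; it exceeds [varP P u], which
   leaves room for the error of the sample variance. *)
pose v := c ^+ 2 / (2 * r1).
have uv : varP P u < v by rewrite ltr_pdivlMr ?mulr_gt0// mulrC.
(* The optimal slope [c / v], for which the exponent is [2 * r1 - r1 * expR (th * kap)]. *)
pose th := 2 * r1 / c.
have th0 : 0 < th by rewrite divr_gt0// mulr_gt0.
have e1 : 1 < 2 - r / r1.
  have : r / r1 < 1 by rewrite ltr_pdivrMr// mul1r.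
  lra.
(* Solves [expR (th * kap) = 2 - r / r1], which brings the exponent exactly to [r]. *)
pose kap := ln (2 - r / r1) / th.
have kap0 : 0 < kap by rewrite divr_gt0// ln_gt0.
have ekap : expR (th * kap) = 2 - r / r1.
  rewrite /kap mulrCA mulfV ?mulr1 ?gt_eqF// lnK// posrE.
  exact: lt_trans e1.
have W1 := whp_bounded iidX a_gt0 h_ge0 h_incr su (divr_gt0 kap0 (ltr0Sn R 1)).
have d0 : 0 < v - varP P u by rewrite subr_gt0.
have W2 := whp_cov iidX a_gt0 h_ge0 h_incr t_gt2 su su d0.
apply: (@whp_sub _ _ _ _ _ _ _ _ _ _ _ _ 0%N) (whpI a_gt0 h_ge0 h_incr W1 W2).
move=> n n0 x [/= xk xv].
have an := a_gt0 n0.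
have ak : forall i, `|a n * (u (tnth x i) - avg x u)| <= kap.
  move=> i; rewrite mulrBr; apply: le_trans (ler_normB _ _) _.
  have := xk i; have : `|a n * avg x u| <= kap / 2.
    by rewrite -avg_scale; exact: norm_avg.
  lra.
have cu : covn x u u <= v.
  by have := ler_norm (covn x u u - covP P u u); move: xv; rewrite /varP; lra.
apply: le_trans (boot_upper mpoint n0 (iidXs x n0) c mu (ltW an) (ltW th0) ak cu) _.
rewrite lee_fin ler_expR lerN2 ler_wpM2l ?(ltW (speed_gt0 n0))//.
rewrite ekap /th /v le_eqVlt; apply/orP; left; apply/eqP.
by field; rewrite !gt_eqF.
Qed.

Variable Om0 : set (tau_space Sigma).
Local Notation event n x := (shifted_set (empirical R x) (a n) Om0).
Local Notation outer n x := (outer_prob (sigma_field Sigma) (law n x) (event n x)).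
Local Notation inner n x :=
  (inner_prob (Lambda Sigma) (sigma_field Sigma) (law n x) (event n x)).

Lemma outer_le1 n x : (0 < n)%N -> (outer n x <= 1)%E.
Proof.
move=> n0; apply: (@le_trans _ _ (law n x (Lambda Sigma))).
  by apply: outer_prob_le; [exact: sFT|move=> Q []].
rewrite /empirical_law (_ : [set w | _] = setT) ?probability_setT//.
by apply/seteqP; split=> w //= _; apply: empirical_Lambda; exact: k_gt0.
Qed.

Lemma Rintegral_resample n (x : n.-tuple V) u w : (0 < n)%N -> lspan Sigma u ->
  \int[empirical R [tuple Xs n x j w | j < k n]]_s u s - \int[empirical R x]_s u s =
  (\sum_(j < k n) (u (Xs n x j w) - avg x u)) / (k n)%:R.
Proof.
move=> n0 su; have mu := lspan_measurable mSigma su.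
rewrite !Rintegral_empirical ?k_gt0// -/(avg x u).
have kn : (k n)%:R != 0 :> R by rewrite pnatr_eq0 -lt0n k_gt0.
rewrite sumrB sumr_const card_ord mulrBl; congr (_ / _ - _).
  by apply: eq_bigr => j _; rewrite tnth_mktuple.
by rewrite -[X in X / _]mulr_natl mulrAC mulfV// mul1r.
Qed.

Lemma measurable_resample n (x : n.-tuple V) u : lspan Sigma u ->
  measurable_fun setT (fun w => \sum_(j < k n) (u (Xs n x j w) - avg x u)).
Proof.
move=> su; apply: measurable_sum => j; apply: measurable_funB => //.
exact: (measurableT_comp (lspan_measurable mSigma su)).
Qed.

Lemma measurable_ray (f : T' -> R) (c : R) : measurable_fun setT f ->
  measurable [set w | c <= f w] /\ measurable [set w | c < f w].
Proof.
move=> mf; split.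
  rewrite [X in measurable X](_ : _ = f @^-1` `[c, +oo[%classic).
    by rewrite -[X in measurable X]setTI; exact: mf.
  by apply/seteqP; split=> w; rewrite /= in_itv/= andbT.
rewrite [X in measurable X](_ : _ = f @^-1` `]c, +oo[%classic).
  by rewrite -[X in measurable X]setTI; exact: mf.
by apply/seteqP; split=> w; rewrite /= in_itv/= andbT.
Qed.

Lemma whp_upper (r : R) : 0 <= r -> (r%:E < rho0sq_set P (closure Om0))%E ->
  whp (fun n => [set x : n.-tuple V | (((speed n)^-1)%:E * lne (outer n x) <= (- r)%:E)%E]).
Proof.
move=> r0 rOm.
have [r1 [rr1 r1Om]] : exists r1, r < r1 /\ (r1%:E < rho0sq_set P (closure Om0))%E.
  case: (rho0sq_set P (closure Om0)) rOm => [y| |//].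
    by rewrite lte_fin => ry; exists ((r + y) / 2); rewrite lte_fin; split; lra.
  by exists (r + 1); rewrite ltry; split=> //; lra.
(* The covering is made at rate [r1]; the gap from [r1] to [r2] pays for Chernoff's remainder, and
   the gap from [r2] to [r] for the number of half-spaces. *)
pose r2 := (r + r1) / 2.
have rr2 : r < r2 by rewrite /r2; lra.
have r21 : r2 < r1 by rewrite /r2; lra.
have r20 : 0 <= r2 by exact/ltW/(le_lt_trans r0).
have r10 : 0 < r1 by exact: le_lt_trans rr1.
have [us [eta [eta0 sus Hus]]] := covering sqS (ltW r10) r1Om.
(* Since [eta > 0], the strict inequality [2 * r1 * varP P u < c u ^+ 2] survives even when the
   variance is zero. *)
pose c u := Num.sqrt (2 * r1) * sdP P u + eta.
have c0 u : 0 < c u by rewrite ltr_wpDl// mulr_ge0// sqrtr_ge0.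
have cu u : u \in us -> 2 * r1 * varP P u < c u ^+ 2.
  move=> uu; have su := lspan_sqint sqS (sus u uu).
  rewrite -sqr_sdP// /c sqrrD exprMn (@sqr_sqrtr _ (2 * r1)); last by rewrite mulr_ge0// ltW.
  rewrite -addrA ltrDl ltr_wpDl ?exprn_gt0// mulrn_wge0//.
  by apply: mulr_ge0; [apply: mulr_ge0; exact: sqrtr_ge0|exact: ltW].
pose neg u : V -> R := fun s => 0 + -1 * u s.
have sneg u : lspan Sigma u -> lspan Sigma (neg u).
  by move=> su; apply: lspan_addZ => //; exact: lspan0.
pose bound u (c' : R) n := [set x : n.-tuple V | (B n x [set w |
     ((k n)%:R * (a n * c') <= \sum_(j < k n) (u (Xs n x j w) - avg x u))%R] <=
       (expR (- (speed n * r2)))%:E)%E].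
have W : whp (fun n => [set x | forall u, u \in us ->
    (bound u (c u) n `&` bound (neg u) (c u) n) x]).
  apply: (whp_seq a_gt0 h_ge0 h_incr) => u uu.
  have su := sus u uu; have cuu := cu u uu.
  apply: (whpI a_gt0 h_ge0 h_incr).
    exact: whp_halfspace su (c0 u) r20 r21 cuu.
  apply: whp_halfspace (sneg _ su) (c0 u) r20 r21 _.
  by rewrite varPN//; exact: (lspan_sqint sqS su).
(* Beyond [m], [expR (speed n * (r2 - r))] exceeds the number [2 * size us] of half-spaces; the
   successor keeps the logarithm meaningful for an empty list. *)
have [m Hm] := speed_large (ln (2 * size us).+1%:R / (r2 - r)).
apply: (@whp_sub _ _ _ _ _ _ _ _ _ _ _ _ m) W.
move=> n mn x Hx.
have n0 : (0 < n)%N by exact: leq_ltn_trans mn.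
have an := a_gt0 n0.
apply: scaled_lne_le; first exact: speed_gt0.
(* An event of the sigma-field that contains the shifted set by the covering, since
   [Q - empirical = a n * G] scales each integral of [G] by [a n]. *)
pose A := [set Q : probability V R | exists2 u, u \in us & Lambda Sigma Q /\
   a n * c u < `|\int[Q]_s u s - \int[empirical R x]_s u s|].
have FA : sigma_field Sigma A.
  apply: sF_seq => u uu; exact: (sF_dist mSigma _ _ (sus u uu)).
apply: (@le_trans _ _ (law n x A)).
  apply: outer_prob_le => // Q [LQ [G OG HG]].
  have [u uu Hu] := Hus G OG; exists u => //; split=> //.
  have su := sus u uu.
  rewrite (charge_integral_diff (ltW an) HG).
  - by rewrite normrM gtr0_norm// ltr_pM2l.
  - exact: (Lambda0_tv sqS (tau_valP G) su).
  - exact: (Lambda_integrable mSigma LQ su).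
  - exact: (Lambda_integrable mSigma (empirical_Lambda x n0) su).
pose dev (u : V -> R) w := \sum_(j < k n) (u (Xs n x j w) - avg x u).
have kn : 0 < (k n)%:R :> R by rewrite ltr0n k_gt0.
pose E (u : V -> R) := [set w : T' | a n * c u < `|dev u w / (k n)%:R|].
have -> : law n x A = B n x [set w | exists2 u, u \in us & E u w].
  rewrite /empirical_law; congr (B n x _); apply/seteqP; split=> w [u uu].
    by move=> [_]; rewrite Rintegral_resample//; [exists u|exact: sus].
  move=> Eu; exists u => //; split; first exact/empirical_Lambda/k_gt0.
  by rewrite Rintegral_resample//; exact: sus.
have [|_] := @measure_exists_seq_le _ _ _ (B n x) _ us E
    (expR (- (speed n * r2)) + expR (- (speed n * r2))).
  move=> u uu; have su := sus u uu; have mdev := measurable_resample x su.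
  have [_ mE] := @measurable_ray (fun w => `|dev u w / (k n)%:R|) (a n * c u)
    (measurableT_comp (@normr_measurable R setT) (measurable_funM mdev (measurable_cst _))).
  split=> //.
  have [m1 _] := @measurable_ray (dev u) ((k n)%:R * (a n * c u)) mdev.
  have [m2 _] := @measurable_ray (dev (neg u)) ((k n)%:R * (a n * c u))
     (measurable_resample x (sneg _ su)).
  have [b1 b2] := Hx u uu.
  apply: (@le_trans _ _ (B n x ([set w | (k n)%:R * (a n * c u) <= dev u w] `|`
     [set w | (k n)%:R * (a n * c u) <= dev (neg u) w]))).
    apply: le_measure; rewrite ?inE//; first exact: measurableU.
    move=> w; rewrite /E/= normrM [`|_^-1|]gtr0_norm ?invr_gt0//.
    rewrite ltr_pdivlMr// [X in X < _]mulrC => /ltW H.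
    have [d0|d0] := leP 0 (dev u w); first by left; rewrite /= -(ger0_norm d0).
    right; rewrite /= (_ : dev (neg u) w = - dev u w); first by rewrite -(ltr0_norm d0).
    rewrite /dev -sumrN; apply: eq_bigr => j _.
    rewrite /neg (avg_add x (fun=> 0)) (avg_cst x n0) avg_scale; ring.
  rewrite EFinD; apply: le_trans (measureU2 _ m1 m2) _.
  by apply: leeD; [exact: b1|exact: b2].
move/le_trans; apply; rewrite lee_fin.
have -> : (size us)%:R * (expR (- (speed n * r2)) + expR (- (speed n * r2))) =
  expR (- (speed n * r2)) * (2 * size us)%:R by rewrite natrM; ring.
have -> : - (speed n * r) = - (speed n * r2) + speed n * (r2 - r) by ring.
rewrite expRD ler_wpM2l ?expR_ge0//.
have Nn := Hm n mn; rewrite ler_pdivrMr ?subr_gt0// in Nn.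
apply: (@le_trans _ _ (2 * size us).+1%:R); first by rewrite ler_nat.
by rewrite -[leLHS]lnK ?posrE ?ltr0n// ler_expR.
Qed.

(** The quotient [(Q - empirical) / a n] is a charge in [Lambda0], as both measures integrate every
    function of Theta. The premise is about any [H] with the right integrals, which is how a
    finite-dimensional neighbourhood is used. *)
Lemma shifted_set_mem n (x : n.-tuple V) (Q : probability V R) : (0 < n)%N ->
  Lambda Sigma Q -> (forall H : tau_space Sigma,
    (forall f, Sigma f -> \int[Q]_s f s - \int[empirical R x]_s f s =
       a n * charge_integral (tau_val H) f) -> Om0 H) -> event n x Q.
Proof.
move=> n0 LQ HO; have an := a_gt0 n0.
pose G : charge V R := cscale (a n)^-1
  (cadd (charge_of_finite_measure Q)
        (cscale (-1) (charge_of_finite_measure (empirical R x)))).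
have GE A : measurable A -> G A = ((a n)^-1%:E * (Q A - empirical R x A))%E.
  move=> mA; rewrite /G /cscale/= /cadd/= /cscale/=; congr (_ * (_ + _))%E.
  by rewrite -[RHS]mulN1e.
have Lx := empirical_Lambda x n0.
have Gtv f : Sigma f -> tv_integrable G f.
  move=> Sf; have sf := lspan_sub Sf.
  apply: (tv_integrable_diff _ GE); first by rewrite invr_ge0 ltW.
    exact: (Lambda_integrable mSigma LQ sf).
  exact: (Lambda_integrable mSigma Lx sf).
have LG : Lambda0 Sigma G.
  split; last by move=> f /Gtv[].
  by rewrite GE// !probability_setT subee// mule0.
have QG A : measurable A -> (Q A - empirical R x A = (a n)%:E * G A)%E.
  by move=> mA; rewrite GE// muleA -EFinM mulfV ?gt_eqF// mul1e.
have [H HG] := tau_mk LG.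
split=> //; exists H; last by move=> A mA; rewrite HG; exact: QG.
apply: HO => f Sf; rewrite HG; have sf := lspan_sub Sf.
apply: (charge_integral_diff (ltW an) QG) => //; first exact: Gtv.
  exact: (Lambda_integrable mSigma LQ sf).
exact: (Lambda_integrable mSigma Lx sf).
Qed.

(** The density of [G] need not lie in the span. By [rho0sq_le] its functional satisfies the
    hypothesis of [riesz_near], which supplies a substitute [w] in the span. *)
Lemma whp_lower (G : tau_space Sigma) (r eps : R) : Om0° G -> 0 <= r ->
  (rho0sq P (tau_val G) <= r%:E)%E -> 0 < eps ->
  whp (fun n => [set x : n.-tuple V |
    ((- (r + eps))%:E <= ((speed n)^-1)%:E * lne (inner n x))%E]).
Proof.
move=> OG r0 Gr eps0.
have [fs [dl0 [dl00 Sfs Hfs]]] := interior_nbhs OG.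
pose l u := charge_integral (tau_val G) u.
pose rho := Num.sqrt (2 * r).
have rho0 : 0 <= rho by exact: sqrtr_ge0.
have [GT _] := tau_valP G.
have l_le u : lspan Sigma u -> `|l u| <= rho * sdP P u.
  move=> su; have squ := lspan_sqint sqS su.
  have := rho0sq_le GT Gr squ; rewrite -/(l u) => H.
  rewrite -sqrtr_sqr /rho /sdP -sqrtrM ?mulr_ge0//; exact: ler_wsqrtr.
have lD c u v : lspan Sigma u -> lspan Sigma v ->
    l (fun s => u s + c * v s) = l u + c * l v.
  move=> su sv; apply: charge_integral_addZ.
  - exact: (Lambda0_tv sqS (tau_valP G) su).
  - exact: (Lambda0_tv sqS (tau_valP G) sv).
pose S := \sum_(f <- fs) sdP P f.
have S0 : 0 <= S by apply: sumr_ge0 => f _; exact: sqrtr_ge0.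
have fS f : f \in fs -> sdP P f <= S.
  move=> ff; rewrite /S (big_rem f)//= lerDl.
  by apply: sumr_ge0 => g _; exact: sqrtr_ge0.
(* Tolerance for the near-minimiser: [y * (rho + 1) <= eps / 4] controls the excess of [varP w / 2]
   over [r], and [y * (S + 1) <= dl0 / 4] the error of its covariance with each [f]. *)
pose y := Num.min 1 (Num.min (eps / (4 * (rho + 1))) (dl0 / (4 * (S + 1)))).
have y0 : 0 < y.
  by rewrite !lt_min ltr01/= !divr_gt0// mulr_gt0// ltr_wpDl.
have y1 : y <= 1 by rewrite ge_min lexx.
have y2 : y * (rho + 1) <= eps / 4.
  have : y <= eps / (4 * (rho + 1)) by rewrite !ge_min lexx !orbT.
  by rewrite ler_pdivlMr ?mulr_gt0 ?ltr_wpDl//; lra.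
have y3 : y * (S + 1) <= dl0 / 4.
  have : y <= dl0 / (4 * (S + 1)) by rewrite !ge_min lexx !orbT.
  by rewrite ler_pdivlMr ?mulr_gt0 ?ltr_wpDl//; lra.
have e0 : 0 < y ^+ 2 / 2 by rewrite divr_gt0// exprn_gt0.
have [w [sw wl sdw]] := riesz_near (lspan0 Sigma) (lspan_sqint sqS)
  (fun c u v => @lspan_addZ _ _ _ c u v) lD rho0 l_le e0.
have yE : 2 * (y ^+ 2 / 2) = y ^+ 2 by field.
rewrite yE in wl sdw; rewrite sqrtr_sqr gtr0_norm// in sdw.
have wf f : f \in fs -> `|covP P w f - l f| <= dl0 / 4.
  move=> ff; have sf := lspan_sub (Sfs f ff).
  apply: le_trans y3; apply: (@le_trans _ _ (y * sdP P f)).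
    rewrite -(@ler_pXn2r _ 2)// ?nnegrE// ?mulr_ge0 ?(ltW y0) ?sdP_ge0//.
    rewrite real_normK ?num_real// exprMn sqr_sdP; last exact: (lspan_sqint sqS sf).
    exact: wl.
  by rewrite ler_pM2l//; have := fS f ff; lra.
have varw : varP P w / 2 <= r + eps / 4.
  rewrite -sqr_sdP; last exact: (lspan_sqint sqS sw).
  apply: (@le_trans _ _ ((rho + y) ^+ 2 / 2)).
    by rewrite ler_pM2r// lerXn2r ?nnegrE ?sdP_ge0// addr_ge0// ltW.
  rewrite sqrrD sqr_sqrtr ?mulr_ge0//.
  have : y ^+ 2 <= y * 1 by rewrite expr2 ler_pM2l.
  by move: y2; rewrite -mulr_natl; lra.
(* [None] adds the tilting direction [w] to the functions of the neighbourhood. *)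
pose J : finType := option 'I_(size fs).
pose u (j : J) : V -> R := if j is Some i then nth w fs i else w.
have su j : lspan Sigma (u j).
  by case: j => [i|] //=; apply/lspan_sub/Sfs; rewrite mem_nth.
(* Exceeds each variance by at least 1, so it still bounds the sample variances, whose error is at
   most [dl <= 1]. *)
pose U := \sum_j varP P (u j) + 1.
have vU j : varP P (u j) + 1 <= U.
  rewrite lerD2r (bigD1 j)//= lerDl; apply: sumr_ge0 => i _.
  exact: varP_ge0 (lspan_sqint sqS (su i)).
have U1 : 1 <= U.
  by have := vU None; have := varP_ge0 (lspan_sqint sqS (su None)); lra.
have U0 : 0 < U by exact: lt_le_trans U1.
pose dl := Num.min 1 (Num.min (dl0 / 4) (eps / 4)).
have dlp : 0 < dl by rewrite !lt_min ltr01/= !divr_gt0.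
have dl1 : dl <= 1 by rewrite ge_min lexx.
have dld : dl <= dl0 / 4 by rewrite !ge_min lexx !orbT.
have dle : dl <= eps / 4 by rewrite !ge_min lexx !orbT.
pose kap := dl / (8 * U).
have kap0 : 0 < kap by rewrite divr_gt0// mulr_gt0.
have W : whp (fun n => [set x | forall j, j \in enum J ->
   ([set x : n.-tuple V | forall i, `|a n * u j (tnth x i)| <= kap / 2] `&`
    ([set x : n.-tuple V | `|covn x (u j) w - covP P (u j) w| <= dl] `&`
     [set x : n.-tuple V | `|covn x (u j) (u j) - covP P (u j) (u j)| <= dl])) x]).
  apply: (whp_seq a_gt0 h_ge0 h_incr) => j _.
  apply: (whpI a_gt0 h_ge0 h_incr).
    exact: (whp_bounded iidX a_gt0 h_ge0 h_incr (su j) (divr_gt0 kap0 (ltr0Sn R 1))).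
  apply: (whpI a_gt0 h_ge0 h_incr).
    exact: (whp_cov iidX a_gt0 h_ge0 h_incr t_gt2 (su j) sw dlp).
  exact: (whp_cov iidX a_gt0 h_ge0 h_incr t_gt2 (su j) (su j) dlp).
pose eta := dl ^+ 2 / (32 * U).
have eta0 : 0 < eta by rewrite divr_gt0 ?exprn_gt0// mulr_gt0.
(* Beyond [m1] the tilted event has probability at least [1 / 2]; beyond [m2] this factor is at
   least [expR (- (speed n * (eps / 8)))]. *)
have [m1 Hm1] := speed_large (ln (2 * (2 * #|J|).+1)%:R / eta).
have [m2 Hm2] := speed_large (ln 2 / (eps / 8)).
apply: (@whp_sub _ _ _ _ _ _ _ _ _ _ _ _ (maxn m1 m2)) W.
move=> n; rewrite gtn_max => /andP[mn1 mn2] x Hx.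
have n0 : (0 < n)%N by exact: leq_ltn_trans mn1.
have an := a_gt0 n0; have Nn := speed_gt0 n0.
have Hxj j := Hx j (mem_enum J j).
apply: scaled_lne_ge => //.
(* An event of the sigma-field containing every [Q] outside the shifted set. Its threshold is the
   error budget: [dl] for the resample, [dl] for the sample covariance and [dl0 / 4] for [w], with
   [dl <= dl0 / 4]. *)
pose A := [set Q : probability V R | exists2 f, f \in fs & Lambda Sigma Q /\
   a n * (3 / 4 * dl0) <
     `|\int[Q]_s f s - (\int[empirical R x]_s f s + a n * l f)|].
have FA : sigma_field Sigma A.
  by apply: sF_seq => f ff; exact: (sF_dist mSigma _ _ (lspan_sub (Sfs f ff))).
apply: (inner_prob_ge FA).
  move=> Q [LQ nE]; apply: contrapT => nA; apply: nE.
  apply: shifted_set_mem => // H HE; apply: Hfs => f ff.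
  have Hf : `|\int[Q]_s f s - (\int[empirical R x]_s f s + a n * l f)| <=
      a n * (3 / 4 * dl0).
    by rewrite leNgt; apply/negP => Hlt; apply: nA; exists f.
  rewrite -(@ltr_pM2l _ (a n))// -[X in X * `|_|]gtr0_norm// -normrM mulrBr -HE; last exact: Sfs.
  rewrite -/(l f) (_ : _ - _ - _ = \int[Q]_s f s -
     (\int[empirical R x]_s f s + a n * l f)); last by ring.
  apply: le_lt_trans Hf _; rewrite ltr_pM2l//.
  by move: dl00; lra.
pose bad := [set w0 | exists j, ((k n)%:R * (a n * dl) <
     `|\sum_(i < k n) (u j (Xs n x i w0) - avg x (u j)) -
       (k n)%:R * (a n * covn x (u j) (u None))|)%R].
have kn : 0 < (k n)%:R :> R by rewrite ltr0n k_gt0.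
have mdev f : lspan Sigma f -> measurable_fun setT
    (fun w0 => \sum_(i < k n) (f (Xs n x i w0) - avg x f)) := @measurable_resample n x f.
have mbad : measurable bad.
  rewrite [X in measurable X](_ : _ = \bigcup_(j in [set: J]) [set w0 |
     ((k n)%:R * (a n * dl) < `|\sum_(i < k n) (u j (Xs n x i w0) - avg x (u j)) -
       (k n)%:R * (a n * covn x (u j) (u None))|)%R]); last first.
    by apply/seteqP; split=> w0; [move=> [j Hj]; exists j|move=> [j _ Hj]; exists j].
  apply: fin_bigcup_measurable => [|j _]; first exact: finite_finset.
  by apply: (measurable_ray _ _).2; apply: measurableT_comp => //;
    apply: measurable_funB => //; exact: mdev.
apply: (@le_trans _ _ (B n x bad)).
  pose E f := [set w0 | a n * (3 / 4 * dl0) <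
    `|(\sum_(i < k n) (f (Xs n x i w0) - avg x f)) / (k n)%:R - a n * l f|].
  have mE f : f \in fs -> measurable (E f) /\ (B n x (E f) <= 1%:E)%E.
    move=> ff; suff mE : measurable (E f) by split=> //; exact: probability_le1.
    apply: (measurable_ray _ _).2; apply: measurableT_comp => //.
    apply: measurable_funB => //; apply: measurable_funM => //.
    exact/mdev/lspan_sub/Sfs.
  have -> : law n x A = B n x [set w0 | exists2 f, f \in fs & E f w0].
    rewrite /empirical_law; congr (B n x _); apply/seteqP; split=> w0 [f ff].
      move=> [_]; rewrite opprD addrA Rintegral_resample//; first by exists f.
      exact/lspan_sub/Sfs.
    move=> Ef; exists f => //; split; first exact/empirical_Lambda/k_gt0.
    by rewrite opprD addrA Rintegral_resample//; exact/lspan_sub/Sfs.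
  apply: le_measure; rewrite ?inE//; first exact: (measure_exists_seq_le mE).1.
  move=> w0 [f ff]; rewrite /E/= => Ef.
  have fi : (index f fs < size fs)%N by rewrite index_mem.
  have fE : f = u (Some (Ordinal fi)) by rewrite /u /= nth_index.
  exists (Some (Ordinal fi)); rewrite -fE.
  have Hc : `|covn x f w - covP P f w| <= dl.
    by rewrite fE; have [_ []] := Hxj (Some (Ordinal fi)).
  have Hw := wf f ff; rewrite covPC in Hw.
  set S1 := \sum_(i < k n) _ in Ef *.
  have -> : S1 - (k n)%:R * (a n * covn x f (u None)) =
      (k n)%:R * (S1 / (k n)%:R - a n * covn x f w).
    by rewrite mulrBr [X in _ = X - _]mulrCA mulfV ?gt_eqF// mulr1.
  rewrite normrM gtr0_norm// ltr_pM2l//.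
  have H1 : `|a n * (covn x f w - l f)| <= a n * (dl + dl0 / 4).
    rewrite normrM gtr0_norm// ler_pM2l//.
    rewrite (_ : _ - _ = (covn x f w - covP P f w) + (covP P f w - l f)); last by ring.
    by apply: le_trans (ler_normD _ _) _; exact: lerD.
  have H2 : a n * (3 / 4 * dl0) < `|S1 / (k n)%:R - a n * covn x f w| +
      `|a n * (covn x f w - l f)|.
    apply: lt_le_trans Ef _.
    rewrite (_ : _ - a n * l f = (S1 / (k n)%:R - a n * covn x f w) +
       a n * (covn x f w - l f)); last by ring.
    exact: ler_normD.
  have : a n * (2 * dl + dl0 / 4) <= a n * (3 / 4 * dl0) by rewrite ler_pM2l//; lra.
  lra.
have ak j i : `|a n * (u j (tnth x i) - avg x (u j))| <= dl / (8 * U).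
  rewrite mulrBr; apply: le_trans (ler_normB _ _) _.
  have [Hj _] := Hxj j.
  have := Hj i; have : `|a n * avg x (u j)| <= kap / 2.
    by rewrite -avg_scale; exact: norm_avg.
  by rewrite -/kap; lra.
have cU j : covn x (u j) (u j) <= U.
  have [_ [_ /= Hj]] := Hxj j; have := ler_norm (covn x (u j) (u j) - covP P (u j) (u j)).
  by have := vU j; move: Hj dl1; rewrite /varP; lra.
have mu j : measurable_fun setT (u j) := lspan_measurable mSigma (su j).
apply: le_trans (boot_lower mpoint n0 (iidXs x n0) None mu (ltW an) dlp dl1 U1 ak cU) _.
rewrite lee_fin lerD2l lerN2 -/eta.
have cw : covn x w w <= varP P w + dl.
  have [_ [_ /= Hj]] := Hxj None; have := ler_norm (covn x w w - covP P w w).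
  by move: Hj; rewrite /varP /=; lra.
have half : 2^-1 <= 1 - (2 * #|J|)%:R * expR (- (speed n * eta)).
  have := Hm1 n mn1; rewrite ler_pdivrMr// => H1.
  have H2 : (2 * (2 * #|J|).+1)%:R <= expR (speed n * eta).
    by rewrite -[leLHS]lnK ?posrE ?ltr0n// ler_expR.
  rewrite expRN.
  have : (2 * #|J|)%:R / expR (speed n * eta) <= 2^-1.
    rewrite ler_pdivrMr ?expR_gt0//; apply: le_trans (ler_wpM2l _ H2); last by rewrite invr_ge0.
    by rewrite [X in _ * X]natrM mulrA mulVf ?pnatr_eq0// mul1r ler_nat.
  by lra.
apply: (@le_trans _ _ (2^-1 * expR (- (speed n * (covn x w w / 2 + dl))))); last first.
  by rewrite ler_wpM2r// expR_ge0.
have h2 : expR (- (speed n * (eps / 8))) <= 2^-1.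
  have := Hm2 n mn2; rewrite ler_pdivrMr ?divr_gt0// => H1.
  by rewrite expRN lef_pV2 ?posrE ?expR_gt0// -[leLHS]lnK ?posrE// ler_expR.
apply: (@le_trans _ _ (expR (- (speed n * (eps / 8))) *
    expR (- (speed n * (covn x w w / 2 + dl))))); last first.
  by rewrite ler_wpM2r// expR_ge0.
rewrite -expRD ler_expR -opprD lerN2 -mulrDr ler_pM2l//.
by move: cw varw dle; lra.
Qed.

End bootstrap_moderate_deviations.

Section whp_inner_probability.
Context d d' (T : measurableType d) (V : measurableType d') (R : realType).
Variables (Pr : probability T R) (X : nat -> {mfun T >-> V}).
Variables (a : nat -> R) (h : R -> R) (t : R).
Hypotheses (a_gt0 : forall n, (0 < n)%N -> 0 < a n)
  (h_ge0 : forall s : R, 0 < s -> 0 <= h s).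

(** Passing from [C] to [C + 1] makes the inequality strict, because [n ^ (1 - t / 2)] is positive;
    the factor [1] stands for [C2]. *)
Lemma whp_inner_prob (E : forall n, set (n.-tuple V)) : whp Pr X a h t E ->
  exists (n0 : nat) (C D : R), [/\ 0 < C, 0 < D & forall n, (n0 < n)%N ->
    ((1 - C * (n%:R * h (D * a n) + 1 * n%:R `^ (1 - t / 2)))%:E <
     inner_prob setT measurable (sample_law Pr X n) (E n))%E].
Proof.
move=> [n0 [C [D [C0 D0 H]]]]; exists n0, (C + 1), D; split=> //; first by rewrite addr_gt0.
move=> n nn; have n_gt0 : (0 < n)%N by exact: leq_ltn_trans nn.
have [A [mA EA PA]] := H n nn.
have le : (outer_prob measurable (sample_law Pr X n) (setT `\` E n) <=
    (bad_rate a h t C D n)%:E)%E.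
  apply: le_trans PA; apply: outer_prob_le => //.
  by move=> x [_ nE]; exact: EA.
rewrite /inner_prob EFinB; apply: lt_le_trans (leeB (lexx _) le).
rewrite -EFinB lte_fin ltrD2l ltrN2 /bad_rate mul1r mulrDl ltrDl mul1r.
by rewrite ltr_wpDl ?powR_gt0 ?ltr0n// mulr_ge0// h_ge0// mulr_gt0// a_gt0.
Qed.

End whp_inner_probability.

Lemma rho0sq_ge0 d (V : measurableType d) (R : realType) (P : probability V R)
  (G : charge V R) : (0 <= rho0sq P G)%E.
Proof.
rewrite /rho0sq; case: ifP => // _; apply: mule_ge0; first by rewrite lee_fin invr_ge0.
by apply: integral_ge0 => x _; exact: sqre_ge0.
Qed.

Lemma rho0sq_set_ge0 d (V : measurableType d) (R : realType) (P : probability V R)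
  (Sigma : set (V -> R)) (Om : set (tau_space Sigma)) : (0 <= rho0sq_set P Om)%E.
Proof. by apply: le_ereal_inf_tmp => _ [G _ <-]; exact: rho0sq_ge0. Qed.

Lemma borel_measurable_set1 (S : ptopologicalType) : hausdorff_space S ->
  forall s : borel S, measurable [set s].
Proof.
move=> hS s; rewrite -[X in measurable X]setCK; apply: measurableC.
apply: sub_sigma_algebra; rewrite openC.
exact: (accessible_closed_set1 (hausdorff_accessible hS)).
Qed.

Theorem theorem2p2 (R : realType) (S : ptopologicalType)
  (hausdorffS : hausdorff_space S) (P : probability (borel S) R)
  (d : measure_display) (T : measurableType d) (Pr : probability T R)
  (X : nat -> {mfun T >-> borel S}) (iidX : iid Pr X P)
  (k : nat -> nat) (k_gt0 : forall n, (0 < n)%N -> (0 < k n)%N)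
  (k_infty : k n @[n --> \oo] --> \oo)
  (c0 : R) (k_le : forall n, (0 < n)%N -> (k n)%:R / n%:R < c0)
  (* the bootstrap: given that the sample is x, (Xs n x j)_(j < k n) is defined
     on the probability space (T', B n x) *)
  (d' : measure_display) (T' : measurableType d')
  (B : forall n, n.-tuple (borel S) -> probability T' R)
  (Xs : forall n, n.-tuple (borel S) -> 'I_(k n) -> {mfun T' >-> borel S})
  (iidXs : forall n x, (0 < n)%N ->
     iid (B n x) (Xs n x) (empirical R x))
  (a : nat -> R) (a_gt0 : forall n, (0 < n)%N -> 0 < a n)
  (a_decr : forall m n, (0 < m)%N -> (m <= n)%N -> a n <= a m)
  (a_cvg0 : a n @[n --> \oo] --> (0 : R))
  (a_ratio : a n.+1 / a n @[n --> \oo] --> (1 : R))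
  (ka_infty : (k n)%:R * a n ^+ 2 @[n --> \oo] --> +oo)
  (h : R -> R) (h_ge0 : forall s : R, 0 < s -> 0 <= h s)
  (h_incr : forall s u : R, 0 < s -> s <= u -> h s <= h u)
  (h_lim : forall c : R, 0 < c -> n%:R * h (c * a n) @[n --> \oo] --> (0 : R))
  (t : R) (t_gt2 : 2 < t)
  (Om0 : set (tau_space (Theta P t h))) :
  let Sigma := Theta P t h in
  let event n (x : n.-tuple (borel S)) :=
    shifted_set (empirical R x) (a n) Om0 in
  let law n (x : n.-tuple (borel S)) := empirical_law (B n x) (Xs n x) in
  let log_inner n (x : n.-tuple (borel S)) :=
    ((((k n)%:R * a n ^+ 2)^-1)%:E *
      lne (inner_prob (Lambda Sigma) (sigma_field Sigma) (law n x)
             (event n x)))%E in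
  let log_outer n (x : n.-tuple (borel S)) :=
    ((((k n)%:R * a n ^+ 2)^-1)%:E *
      lne (outer_prob (sigma_field Sigma) (law n x) (event n x)))%E in
  let sample_inner n (E : set (n.-tuple (borel S))) :=
    inner_prob setT measurable (sample_law Pr X n) E in
  (forall eps : R, 0 < eps ->
     exists (n0 : nat) (C C1 C2 : R), [/\ 0 < C, 0 < C1, 0 < C2 &
       forall n, (n0 < n)%N ->
         ((1 - C * (n%:R * h (a n / (eps * C1)) +
                    C2 * n%:R `^ (1 - t / 2)))%:E <
          sample_inner n [set x |
            (- rho0sq_set P Om0° - eps%:E <= log_inner n x)%E /\
            ((rho0sq_set P (closure Om0) < +oo)%E ->
             (log_outer n x <= - rho0sq_set P (closure Om0) + eps%:E)%E)])%E])
  /\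
  (rho0sq_set P (closure Om0) = +oo%E ->
   forall L : R, 0 < L ->
     exists (n0 : nat) (C C1 C2 : R), [/\ 0 < C, 0 < C1, 0 < C2 &
       forall n, (n0 < n)%N ->
         ((1 - C * (n%:R * h (a n / C1) + C2 * n%:R `^ (1 - t / 2)))%:E <
          sample_inner n [set x | (log_outer n x <= (- L)%:E)%E])%E]).
Proof.
move=> Sigma event law log_inner log_outer sample_inner.
have mpoint := borel_measurable_set1 hausdorffS.
pose whp' := whp Pr X a h t.
have upper r : 0 <= r -> (r%:E < rho0sq_set P (closure Om0))%E ->
    whp' (fun n => [set x | (log_outer n x <= (- r)%:E)%E]).
  exact: (whp_upper mpoint iidX k_gt0 (fun n x => @iidXs n x) a_gt0 ka_infty h_ge0 h_incr t_gt2).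
split=> [eps eps0|cl_infty L L0]; last first.
  have W : whp' (fun n => [set x | (log_outer n x <= (- L)%:E)%E]).
    by apply: upper; [exact: ltW|rewrite cl_infty ltry].
  have [n0 [C [D [C0 D0 H]]]] := whp_inner_prob a_gt0 h_ge0 W.
  exists n0, C, D^-1, 1; split; rewrite ?invr_gt0// => n nn.
  by rewrite invrK [a n * D]mulrC; exact: H.
have W1 : whp' (fun n => [set x |
    (- rho0sq_set P Om0° - eps%:E <= log_inner n x)%E]).
  have := rho0sq_set_ge0 P Om0°.
  (* For an infinite rate the bound is [-oo]. Otherwise half of [eps] buys an interior point nearly
     attaining the infimum, and the other half is left to [whp_lower]. *)
  case rE : (rho0sq_set P Om0°) => [r| |] // r0; last first.
    by apply: whpT => // n x /=; rewrite leNye.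
  have e2 : 0 < eps / 2 by rewrite divr_gt0.
  have [|_ [G OG <-] Gr] := @lb_ereal_inf_adherent _ [set rho0sq P (tau_val G) | G in Om0°] _ e2.
    by rewrite -/(rho0sq_set P _) rE.
  rewrite -/(rho0sq_set P _) rE -EFinD in Gr.
  have r1 : 0 <= r + eps / 2 by rewrite addr_ge0// ltW.
  have W := whp_lower mpoint iidX k_gt0 (fun n x => @iidXs n x) a_gt0 ka_infty h_ge0 h_incr
    t_gt2 OG r1 (ltW Gr) e2.
  apply: (@whp_sub _ _ _ _ _ _ _ _ _ _ _ _ 0%N) W => n _ x /=.
  by rewrite -addrA -splitr opprD.
have W2 : whp' (fun n => [set x | (rho0sq_set P (closure Om0) < +oo)%E ->
    (log_outer n x <= - rho0sq_set P (closure Om0) + eps%:E)%E]).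
  have := rho0sq_set_ge0 P (closure Om0).
  case rE : (rho0sq_set P (closure Om0)) => [r| |] // r0; last exact: whpT.
  rewrite lee_fin in r0.
  (* [whp_upper] requires a nonnegative rate. When [r <= eps] the right side is nonnegative while
     the logarithm of a probability is at most 0. *)
  have [re|re] := leP r eps.
    apply: (@whp_sub _ _ _ _ _ _ _ _ _ _ (fun=> setT) _ 0%N); last exact: whpT.
    move=> n n0 x _ /= _; apply: (@le_trans _ _ 0%E).
      apply: mule_ge0_le0.
        by rewrite lee_fin invr_ge0 mulr_ge0// exprn_ge0// ltW// a_gt0.
      by rewrite -[leRHS](@lne1 R); apply: le_lne; exact: outer_le1.
    by rewrite -EFinD lee_fin addrC subr_ge0.
  have W : whp' (fun n => [set x | (log_outer n x <= (- (r - eps))%:E)%E]).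
    by apply: upper; rewrite ?subr_ge0 ?ltW// rE lte_fin gtrBl.
  apply: (@whp_sub _ _ _ _ _ _ _ _ _ _ _ _ 0%N) W => n _ x /= H _.
  by rewrite -EFinD addrC -opprB; exact: H.
have [n0 [C [D [C0 D0 H]]]] := whp_inner_prob a_gt0 h_ge0 (whpI a_gt0 h_ge0 h_incr W1 W2).
(* This [C1] turns [a n / (eps * C1)] into [D * a n]. *)
exists n0, C, (eps * D)^-1, 1; split; rewrite ?invr_gt0 ?mulr_gt0// => n nn.
have -> : eps * (eps * D)^-1 = D^-1 by rewrite invfM mulrA mulfV ?gt_eqF// mul1r.
by rewrite invrK [a n * D]mulrC; exact: H.
Qed.
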